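(* Let $f\in\mathcal{D}_{+}^{2}$ and suppose the rank profile $\mathfrak{f}=f\circ Q_{f}$ satisfies $\mathfrak{f}(z)=(1-z)^{2\beta}L\big(\tfrac{1}{1-z}\big)$ near $z=1$, with $L$ slowly varying with smooth asymptotics, meaning that $L$ is eventually smooth with $s^{k}L^{(k)}(s)/L(s)\to0$ for $k=1,2$, so that the asymptotic relations below may be differentiated twice; this covers the regularly varying right tails $f^{(j)}(x)=(-1)^{j}(p)_{j}\,c_{0}\,x^{-p-j}(1+o(1))$ as $x\to\infty$, $j=0,1,2$, $p>1$ (the power case), for which $\beta=\tfrac{p}{2(p-1)}$, and exponential-or-faster tails, for which $\beta=\tfrac12$. Then $$U_{f}(z)=\frac{c_{+}+o(1)}{(1-z)^{2}},\qquad c_{+}=2\beta(1-\beta)=\frac{p(p-2)}{2(p-1)^{2}}\ \text{ in the power case},$$ and symmetrically at the left endpoint, with weight $c_{-}$. In particular: (i) always $c_{\pm}\le\tfrac12$, and no law whatsoever can satisfy $U\ge c\,(1-z)^{-2}$ near an endpoint (at the left endpoint, with $z$ in place of $1-z$) with $c>\tfrac12$; (ii) $c_{+}=0$ exactly for quadratic tails; $c_{+}=\tfrac12$ for exponential-or-faster tails; $c_{+}\in(0,\tfrac12)$ for $p>2$; and $c_{+}<0$ for $1<p<2$; (iii) the weights $c_{\pm}$ are invariants of the boundary-regular coadjoint action: every distortion extending to a $C^{3}$-diffeomorphism of the closed interval with nonvanishing endpoint derivatives, and every flow of a kernel that is $C^{2}$ up to the endpoints, preserves them; boundary regularity is essential,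 since the interior distortion $B(z)=z^{2}$ moves the left weight of the uniform law from $0$ to $-\tfrac32$.
   Context: A law is identified with its probability density. $\mathcal{D}_{+}$ is the set of probability densities on $\mathbb{R}$ that are continuous and strictly positive on an open interval and vanish outside it; $\mathcal{D}_{+}^{2}$ is the subset of those whose density is $C^{2}$ on the interior of the support. $F_{f}$ is the distribution function of $f$, $Q_{f}=F_{f}^{-1}$ on $(0,1)$ its quantile function, and its rank Hill potential is the Schwarzian derivative $U_{f}(z)=\{Q_{f},z\}=\frac{Q_{f}'''}{Q_{f}'}-\frac32\big(\frac{Q_{f}''}{Q_{f}'}\big)^{2}$. $(p)_{j}=p(p+1)\cdots(p+j-1)$ with $(p)_0=1$; $c_{0}>0$ is a constant; a quadratic tail is the power case $p=2$. A distortion is an increasing bijection $A$ of $[0,1]$ such that $A$ and $A^{-1}$ are absolutely continuous; it acts on laws by $\alpha_{A}f=A'(F_{f})f$, so that $Q_{\alpha_{A}f}=Q_{f}\circ B$ with $B=A^{-1}$, and correspondingly, for $A$ smooth on $(0,1)$, on potentials by the coadjoint action $U_{\alpha_{A}f}=(U_{f}\circ B)(B')^{2}+\{B,\cdot\}$; in (iii), $B(z)=z^{2}$ is used in this last formula. A kernel is a probability density $v$ on $[0,1]$, and its flow is $\partial_{t}f=(v(F)-1)f$, equivalently $\partial_{t}F=A_{v}(F)-F$ with $A_{v}(z)=\int_{0}^{z}v(s)\,ds$.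
   Formalization: Exponential-or-faster tails are taken to satisfy also f f''/f'^2 → 1 at infinity (decay alone does not give β=1/2), and ''c₊=0 exactly for quadratic tails'' is claimed among power and exponential-or-faster tails (the uniform law also has c₊=0). *)

(* Defs.v *)
From HB Require Import structures.
From mathcomp Require Export all_boot all_order.
From mathcomp Require Export ssralg ssrnum ssrint interval.
From mathcomp Require Export all_classical all_reals all_analysis.

Set Implicit Arguments.
Unset Strict Implicit.
Unset Printing Implicit Defensive.

Import Order.TTheory GRing.Theory Num.Theory.
Export numFieldNormedType.Exports.

Local Open Scope classical_set_scope.
Local Open Scope ring_scope.

Section regularity.
Context {R : realType}.
Implicit Types (g A B : R -> R) (D : set R) (n : nat).

(* [f^`(k)] is a total iterated derivative, so this predicate is meaningful
   (and says "of class C^n on D") when D is open. *)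
Definition Ck_on n D g :=
  forall x, D x ->
    (forall k, (k < n)%N -> derivable g^`(k) x 1) /\
    {for x, continuous g^`(n)}.

(* C^n up to the endpoints of [0, 1]; the values of g outside [0, 1] are
   irrelevant. *)
Definition Ck_closed n g :=
  exists h : R -> R, {in `[0, 1], g =1 h} /\ Ck_on n setT h.

Definition abs_continuous01 g :=
  forall e : R, 0 < e -> exists2 d : R, 0 < d &
    forall n (a b : 'I_n -> R),
      (forall i, 0 <= a i /\ a i <= b i /\ b i <= 1) ->
      trivIset setT (fun i => `]a i, b i[%classic) ->
      \sum_(i < n) (b i - a i) < d ->
      \sum_(i < n) `|g (b i) - g (a i)| < e.

(* A is a distortion and B is its inverse. *)
Definition distortion A B :=
  [/\ {in `[0, 1], forall z, A z \in `[0, 1] /\ B z \in `[0, 1]},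
      {in `[0, 1], cancel A B} /\ {in `[0, 1], cancel B A},
      {in `[0, 1] &, {homo A : y z / y < z}},
      abs_continuous01 A &
      abs_continuous01 B].

(* The distortion A, with inverse B, extends to a C^3-diffeomorphism of [0, 1]
   whose (one-sided) derivatives at 0 and 1 do not vanish. *)
Definition boundary_regular A B :=
  (exists h : R -> R, [/\ {in `[0, 1], A =1 h}, Ck_on 3 setT h,
                          h^`() 0 != 0 & h^`() 1 != 0]) /\
  Ck_closed 3 B.

Definition schwarzian g (z : R) : R :=
  g^`(3) z / g^`() z - 3 / 2 * (g^`(2) z / g^`() z) ^+ 2.

End regularity.

Section laws.
Context {R : realType}.
Implicit Types (f U A B L v : R -> R) (beta p c x z t : R).

Local Notation mu := (@lebesgue_measure R).

Definition prob_density f :=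
  [/\ measurable_fun setT f, (forall x, 0 <= f x) &
      (\int[mu]_x (f x)%:E = 1)%E].

Definition Dplus f :=
  prob_density f /\
  exists I : set R, [/\ open I, is_interval I,
    (forall x, I x -> 0 < f x /\ {for x, continuous f}) &
    (forall x, ~ I x -> f x = 0)].

(* For f in D_+, the set where f is positive is an open interval, equal to the
   interior of the support of f. *)
Definition Dplus2 f := Dplus f /\ Ck_on 2 [set x | 0 < f x] f.

Definition cdf_of f x : R := (\int[mu]_(t in `]-oo, x]) f t)%R.

(* The inverse of the distribution function; for f in D_+ and 0 < z < 1 the
   equation [cdf_of f x = z] has exactly one solution. *)
Definition quantile f z : R := xget 0 [set x | cdf_of f x = z].

Definition rank_profile f z : R := f (quantile f z).

Definition hill_potential f : R -> R := schwarzian (quantile f).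

(* U z = (c + o(1)) / (1 - z)^2 at 1, resp. (c + o(1)) / z^2 at 0. *)
Definition right_weight U c := (1 - z) ^+ 2 * U z @[z --> (1 : R)^'-] --> c.
Definition left_weight U c := z ^+ 2 * U z @[z --> (0 : R)^'+] --> c.

Definition slowly_varying L :=
  (\forall s \near +oo, 0 < L s) /\
  forall a : R, 0 < a -> L (a * s) / L s @[s --> +oo] --> (1 : R).

(* "Smooth" is C^2: the rank profile of a law in D_+^2 is in general no
   smoother. *)
Definition smoothly_slowly_varying L :=
  [/\ slowly_varying L,
      (exists M : R, Ck_on 2 `]M, +oo[ L) &
      forall k, (0 < k <= 2)%N ->
        s ^+ k * L^`(k) s / L s @[s --> +oo] --> (0 : R)].

Definition right_profile f beta L :=
  smoothly_slowly_varying L /\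
  \forall z \near (1 : R)^'-,
    rank_profile f z = (1 - z) `^ (2 * beta) * L (1 / (1 - z)).

Definition left_profile f beta L :=
  smoothly_slowly_varying L /\
  \forall z \near (0 : R)^'+,
    rank_profile f z = z `^ (2 * beta) * L (1 / z).

Definition rising p (j : nat) : R := \prod_(i < j) (p + i%:R).

Definition power_tail f p c0 :=
  forall j, (j <= 2)%N ->
    f^`(j) x / ((- 1) ^+ j * rising p j * c0 * x `^ (- p - j%:R))
      @[x --> +oo] --> (1 : R).

(* f decays at least exponentially at +oo, and f f'' / f'^2 tends to 1, i.e.
   f = exp (- V) with V'' / V'^2 --> 0.  This is the differentiated asymptotics
   of [power_tail], where f f'' / f'^2 --> (p + 1) / p, in the limit of an
   infinite exponent p. *)
Definition exponential_tail f :=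
  (exists lambda C : R, 0 < lambda /\
     \forall x \near +oo, f x <= C * expR (- (lambda * x))) /\
  f x * f^`(2) x / f^`() x ^+ 2 @[x --> +oo] --> (1 : R).

Definition reflect_law f : R -> R := fun x => f (- x).

(* Action of the distortion A on laws. *)
Definition act_law A f : R -> R := fun x => A^`() (cdf_of f x) * f x.

(* Coadjoint action on potentials, where B is the inverse of the distortion. *)
Definition coadjoint B U : R -> R :=
  fun z => U (B z) * B^`() z ^+ 2 + schwarzian B z.

Definition uniform_law : R -> R := \1_(`]0, 1[%classic).

Definition kernel_density v :=
  [/\ measurable_fun `[(0 : R), 1] v, {in `[0, 1], forall z, 0 <= v z} &
      (\int[mu]_(z in `[0%R, 1%R]) (v z)%:E = 1)%E].

(* ft t is the law at time t >= 0 of a solution of d_t f = (v(F) - 1) f. *)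
Definition kernel_flow v (ft : R -> R -> R) :=
  (forall t, 0 <= t -> prob_density (ft t)) /\
  forall x,
    ft t x @[t --> (0 : R)^'+] --> ft 0 x /\
    forall t, 0 < t ->
      is_derive t 1 (fun s => ft s x) ((v (cdf_of (ft t) x) - 1) * ft t x).

End laws.

Arguments uniform_law : clear implicits.

(* Main.v *)
From mathcomp Require Import ring lra measurable_realfun.
Require Import Defs.

(** Let r = f o Q be the rank profile of f.  Since Q' = 1 / r, the potential is
    U = - r'' / r + (r' / r)^2 / 2 ([hill_potentialE]), that is,
    U = - h' - h^2 / 2 for the logarithmic derivative h = r' / r.

    If r (z) = (1 - z)^b L (1 / (1 - z)) with b = 2 beta, then (1 - z) r' / r
    tends to - b and (1 - z)^2 r'' / r to b^2 - b, so (1 - z)^2 U tends to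
    b - b^2 / 2 = 2 beta (1 - beta) ([right_weight_of_profile]).  Power and
    exponential tails both satisfy the von Mises condition f f'' / f'^2 --> m,
    with m = (p + 1) / p and m = 1.  The function f^2 / f' has the derivative
    f (2 - f f'' / f'^2) and vanishes at infinity, so it can be compared with
    1 - F; this gives (1 - F) f' / f^2 --> - 1 / (2 - m), which is the limit of
    (1 - z) r' / r, hence b = 1 / (2 - m) ([right_profile_of_von_mises]).

    The bound 1/2 is an oscillation argument.  In the variable - ln (1 - z), an
    inequality (1 - z)^2 U >= c with c > 1/2 makes (1 - z) h the solution of a
    Riccati inequality that blows up in finite time, and an arctangent makes
    this explicit ([hill_potential_bound]).

    Invariance rests on the cocycle identity of the Schwarzian derivative: if g
    is the image of f under A, then Q_f = Q_g o A, so
    U_f = (U_g o A) A'^2 + {A, .} ([hill_potential_act]).  When A' is bounded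
    away from 0 and its two derivatives are bounded, (1 - z) A' / (1 - A) tends
    to 1 and (1 - z)^2 {A, .} to 0, so U_f and U_g have the same weights
    ([right_weight_coadjoint]).  Distortions smooth up to the boundary have
    these properties.  So do the maps Phi_t = F_t o Q_0 of a kernel flow: along
    the flow f_t = f_0 exp (int_0^t (v (F_s) - 1) ds), so that Phi_t' is the
    exponential of an integral that can be differentiated twice under the
    integral sign, with bounded derivatives ([flow_tame]).

    The left endpoint is reduced to the right one by the reflection x |-> - x
    of the line, which acts as z |-> 1 - z on ranks. *)

Set Implicit Arguments.
Unset Strict Implicit.
Unset Printing Implicit Defensive.

Import Order.TTheory GRing.Theory Num.Theory.

Local Open Scope classical_set_scope.
Local Open Scope ring_scope.

(** * Differentiation rules and iterated derivatives *)

Section calculus.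
Context {R : realType}.
Implicit Types (f g h : R -> R) (a b x : R) (D : set R).

(** The rules are stated for explicit abstractions, the form that the tactic
    [der_step] recognizes. *)
Lemma derD f g x a b : is_derive x 1 f a -> is_derive x 1 g b ->
  is_derive x 1 (fun y => f y + g y) (a + b).
Proof. by move=> ? ?; exact: is_deriveD. Qed.

Lemma derN f x a : is_derive x 1 f a -> is_derive x 1 (fun y => - f y) (- a).
Proof. by move=> ?; exact: is_deriveN. Qed.

Lemma derM f g x a b : is_derive x 1 f a -> is_derive x 1 g b ->
  is_derive x 1 (fun y => f y * g y) (a * g x + f x * b).
Proof.
move=> fa gb; have -> : a * g x + f x * b = f x *: b + g x *: a.
  by rewrite addrC /GRing.scale/= [g x * a]mulrC.
exact: is_deriveM.
Qed.

Lemma derV f x a : f x != 0 -> is_derive x 1 f a ->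
  is_derive x 1 (fun y => (f y)^-1) (- a / f x ^+ 2).
Proof.
move=> fx fa; have -> : - a / f x ^+ 2 = - (f x) ^- 2 *: a.
  by rewrite /GRing.scale/= mulrC mulrN mulNr.
exact: is_deriveV.
Qed.

Lemma derX f n x a : is_derive x 1 f a ->
  is_derive x 1 (fun y => f y ^+ n) (n%:R * f x ^+ n.-1 * a).
Proof.
move=> fa; have -> : n%:R * f x ^+ n.-1 * a = (n%:R * f x ^+ n.-1) *: a by [].
have -> : (fun y => f y ^+ n) = f ^+ n by apply/funext => y; rewrite exprfctE.
exact: is_deriveX.
Qed.

Lemma derC x a : is_derive x 1 (fun=> a) 0.
Proof. exact: is_derive_cst. Qed.

Lemma derI x : is_derive x 1 (fun y : R => y) 1.
Proof. exact: is_derive_id. Qed.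

Lemma der_comp f g x a b : is_derive (g x) 1 f a -> is_derive x 1 g b ->
  is_derive x 1 (fun y => f (g y)) (a * b).
Proof. by move=> ? ?; exact: is_derive1_comp. Qed.

Lemma der_powR f p x a : 0 < f x -> is_derive x 1 f a ->
  is_derive x 1 (fun y => f y `^ p) (p * f x `^ (p - 1) * a).
Proof.
move=> fx fa.
exact: (@der_comp (fun y => y `^ p) f x _ _ (is_derive1_powR p fx) fa).
Qed.

Lemma der_exp f x a : is_derive x 1 f a ->
  is_derive x 1 (fun y => expR (f y)) (expR (f x) * a).
Proof. by move=> fa; exact: (@der_comp expR f x _ _ (is_derive_expR _) fa). Qed.

Lemma der_ln f x a : 0 < f x -> is_derive x 1 f a ->
  is_derive x 1 (fun y => ln (f y)) ((f x)^-1 * a).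
Proof.
by move=> fx fa; exact: (@der_comp (@ln R) f x _ _ (is_derive1_ln fx) fa).
Qed.

Lemma der_atan f x a : is_derive x 1 f a ->
  is_derive x 1 (fun y => atan (f y)) ((1 + f x ^+ 2)^-1 * a).
Proof.
by move=> fa; exact: (@der_comp atan f x _ _ (is_derive1_atan _) fa).
Qed.

Lemma der_near f g x a : (\near x, f x = g x) -> is_derive x 1 f a ->
  is_derive x 1 g a.
Proof. exact: near_eq_is_derive. Qed.

Lemma der_open D f g x a : open D -> (forall y, D y -> f y = g y) -> D x ->
  is_derive x 1 f a -> is_derive x 1 g a.
Proof.
move=> oD fg Dx; apply: der_near.
by move: (open_nbhs_nbhs (conj oD Dx)); apply: filterS.
Qed.

Lemma der_cont f x a : is_derive x 1 f a -> {for x, continuous f}.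
Proof.
move=> [fx _]; exact/differentiable_continuous/derivable1_diffP.
Qed.

Lemma der1E f x a : is_derive x 1 f a -> f^`() x = a.
Proof. by move=> [_ <-]; rewrite derive1E. Qed.

Lemma der1P f x : derivable f x 1 -> is_derive x 1 f (f^`() x).
Proof. by move=> fx; rewrite derive1E; exact/derivableP. Qed.

End calculus.

(** Differentiates a composite of the operations above, leaving the positivity
    and nonvanishing conditions and the base functions to [leaf]. *)
Ltac der_step leaf :=
  lazymatch goal with
  | |- is_derive _ _ (fun _ => ?c) _ => exact: derC
  | |- is_derive _ _ (fun y => y) _ => exact: derI
  | |- is_derive _ _ (fun y => @?f y + @?g y) _ =>
      eapply (@derD _ f g); der_step leaf
  | |- is_derive _ _ (fun y => - @?f y) _ => eapply (@derN _ f); der_step leaf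
  | |- is_derive _ _ (fun y => @?f y ^+ ?n) _ =>
      eapply (@derX _ f n); der_step leaf
  | |- is_derive _ _ (fun y => @?f y * @?g y) _ =>
      eapply (@derM _ f g); der_step leaf
  | |- is_derive _ _ (fun y => (@?f y)^-1) _ =>
      eapply (@derV _ f); [cbv beta; leaf | der_step leaf]
  | |- is_derive _ _ (fun y => @?f y `^ ?p) _ =>
      eapply (@der_powR _ f p); [cbv beta; leaf | der_step leaf]
  | |- is_derive _ _ (fun y => expR (@?f y)) _ =>
      eapply (@der_exp _ f); der_step leaf
  | |- is_derive _ _ (fun y => ln (@?f y)) _ =>
      eapply (@der_ln _ f); [cbv beta; leaf | der_step leaf]
  | |- is_derive _ _ (fun y => atan (@?f y)) _ =>
      eapply (@der_atan _ f); der_step leaf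
  | |- is_derive _ _ (fun y => ?h (@?f y)) _ =>
      first [ leaf
            | eapply (@der_comp _ h f); [cbv beta; leaf | der_step leaf] ]
  | |- _ => leaf
  end.

Tactic Notation "derive_by" tactic3(leaf) :=
  eapply is_derive_eq; [der_step leaf | cbv beta].

Section smoothness.
Context {R : realType}.
Implicit Types (f g h A Q : R -> R) (a b x : R) (D E : set R).

Lemma Ck_on_is_derive n D g k x : Ck_on n D g -> D x -> (k < n)%N ->
  is_derive x 1 g^`(k) (g^`(k.+1) x).
Proof. by move=> gD Dx kn; rewrite derive1nS; apply/der1P/(gD x Dx).1. Qed.

Lemma Ck_on_continuous n D g k x : Ck_on n D g -> D x -> (k <= n)%N ->
  {for x, continuous g^`(k)}.
Proof.
move=> gD Dx; rewrite leq_eqVlt => /predU1P[->|kn]; first exact: (gD x Dx).2.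
exact: der_cont (Ck_on_is_derive gD Dx kn).
Qed.

Lemma Ck_on_sub n D D' g : D' `<=` D -> Ck_on n D g -> Ck_on n D' g.
Proof. by move=> DD' gD x /DD'; exact: gD. Qed.

(** The iterated derivatives are those of a total function; on an open set they
    are determined by the values on that set. *)
Lemma Ck_on_jet n D (d : nat -> R -> R) g : open D ->
  (forall x, D x -> d 0%N x = g x) ->
  (forall k x, (k < n)%N -> D x -> is_derive x 1 (d k) (d k.+1 x)) ->
  (forall x, D x -> {for x, continuous (d n)}) ->
  Ck_on n D g /\ forall k x, (k <= n)%N -> D x -> g^`(k) x = d k x.
Proof.
move=> oD dg dd dn.
have gd k x : (k <= n)%N -> D x -> g^`(k) x = d k x.
  elim: k x => [|k IH] x kn Dx; first by rewrite derive1n0 dg.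
  rewrite derive1nS; apply: der1E.
  apply: (der_open oD _ Dx (dd k x kn Dx)) => y Dy.
  by rewrite IH// ltnW.
split=> // x Dx; split.
  move=> k kn.
  suff : is_derive x 1 g^`(k) (d k.+1 x) by case.
  apply: (der_open oD _ Dx (dd k x kn Dx)) => y Dy.
  by rewrite gd// ltnW.
have : d n y @[y --> x] --> g^`(n) x by rewrite gd//; exact: dn.
apply: cvg_trans; apply: near_eq_cvg.
move: (open_nbhs_nbhs (conj oD Dx)); apply: filterS => y Dy.
by rewrite gd.
Qed.

Lemma Ck_on2 D g g0 g1 g2 : open D ->
  (forall x, D x -> g0 x = g x) ->
  (forall x, D x -> is_derive x 1 g0 (g1 x)) ->
  (forall x, D x -> is_derive x 1 g1 (g2 x)) ->
  (forall x, D x -> {for x, continuous g2}) ->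
  Ck_on 2 D g /\ forall x, D x -> g^`() x = g1 x /\ g^`(2) x = g2 x.
Proof.
move=> oD g0E d0 d1 c2.
have [|//|gD gE] := @Ck_on_jet 2 D (nth g2 [:: g0; g1]) g oD g0E.
  by move=> [|[|]] x // _ Dx; [exact: d0 | exact: d1].
split=> // x Dx; split; [exact: (gE 1%N) | exact: (gE 2%N)].
Qed.

Lemma Ck_on3 D g g0 g1 g2 g3 : open D ->
  (forall x, D x -> g0 x = g x) ->
  (forall x, D x -> is_derive x 1 g0 (g1 x)) ->
  (forall x, D x -> is_derive x 1 g1 (g2 x)) ->
  (forall x, D x -> is_derive x 1 g2 (g3 x)) ->
  (forall x, D x -> {for x, continuous g3}) ->
  Ck_on 3 D g /\
  forall x, D x -> [/\ g^`() x = g1 x, g^`(2) x = g2 x & g^`(3) x = g3 x].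
Proof.
move=> oD g0E d0 d1 d2 c3.
have [|//|gD gE] := @Ck_on_jet 3 D (nth g3 [:: g0; g1; g2]) g oD g0E.
  by move=> [|[|[|]]] x // _ Dx; [exact: d0 | exact: d1 | exact: d2].
split=> // x Dx; split; [exact: (gE 1%N) | exact: (gE 2%N) | exact: (gE 3%N)].
Qed.

Lemma Ck_on_eq n D f g : open D -> (forall x, D x -> f x = g x) ->
  Ck_on n D f ->
  Ck_on n D g /\ forall k x, (k <= n)%N -> D x -> g^`(k) x = f^`(k) x.
Proof.
move=> oD fg fD; apply: (@Ck_on_jet n D (fun k => f^`(k))) => //.
- by move=> k x kn Dx; exact: Ck_on_is_derive fD Dx kn.
- by move=> x Dx; exact: Ck_on_continuous fD Dx _.
Qed.

(** The cocycle identity, which turns the composition of a quantile function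
    with a distortion into the coadjoint action. *)
Lemma schwarzian_comp D E A Q x : open D -> open E ->
  (forall y, D y -> E (A y)) -> Ck_on 3 D A -> Ck_on 3 E Q -> D x ->
  A^`() x != 0 -> Q^`() (A x) != 0 ->
  Ck_on 3 D (Q \o A) /\
  schwarzian (Q \o A) x = schwarzian Q (A x) * A^`() x ^+ 2 + schwarzian A x.
Proof.
move=> oD oE DE DA EQ Dx; rewrite /schwarzian.
have a0 y : D y -> is_derive y 1 A (A^`() y).
  by move=> Dy; exact: (Ck_on_is_derive (k := 0) DA).
have a1 y : D y -> is_derive y 1 A^`() (A^`(2) y).
  by move=> Dy; exact: (Ck_on_is_derive (k := 1) DA).
have a2 y : D y -> is_derive y 1 A^`(2) (A^`(3) y).
  by move=> Dy; exact: (Ck_on_is_derive (k := 2) DA).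
have q0 y : D y -> is_derive (A y) 1 Q (Q^`() (A y)).
  by move=> /DE Ey; exact: (Ck_on_is_derive (k := 0) EQ).
have q1 y : D y -> is_derive (A y) 1 Q^`() (Q^`(2) (A y)).
  by move=> /DE Ey; exact: (Ck_on_is_derive (k := 1) EQ).
have q2 y : D y -> is_derive (A y) 1 Q^`(2) (Q^`(3) (A y)).
  by move=> /DE Ey; exact: (Ck_on_is_derive (k := 2) EQ).
have a3 y : D y -> {for y, continuous A^`(3)}.
  by move=> Dy; exact: (Ck_on_continuous DA).
have q3 y : D y -> {for A y, continuous Q^`(3)}.
  by move=> /DE Ey; exact: (Ck_on_continuous EQ).
move: (A^`()) (A^`(2)) (A^`(3)) (Q^`()) (Q^`(2)) (Q^`(3))
  a0 a1 a2 a3 q0 q1 q2 q3 => A1 A2 A3 Q1 Q2 Q3 a0 a1 a2 a3 q0 q1 q2 q3 A10 Q10.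
pose g1 y : R := Q1 (A y) * A1 y.
pose g2 y : R := Q2 (A y) * A1 y ^+ 2 + Q1 (A y) * A2 y.
pose g3 y : R := Q3 (A y) * A1 y ^+ 3
  + 3 * Q2 (A y) * A1 y * A2 y + Q1 (A y) * A3 y.
have [|y Dy|y Dy|y Dy|y Dy|CA gE] :=
  @Ck_on3 D (Q \o A) (fun y => Q (A y)) g1 g2 g3 oD.
- by [].
- by apply: der_comp; [exact: q0 | exact: a0].
- by rewrite /g1 /g2; derive_by ltac:(solve [eauto]); ring.
- by rewrite /g2 /g3; derive_by ltac:(solve [eauto]); rewrite /=; ring.
- have cA := der_cont (a0 y Dy).
  have cQ (q : R -> R) : {for A y, continuous q} ->
    q (A z) @[z --> y] --> q (A y).
    by move=> cq; apply: continuous_comp.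
  have cA1 := der_cont (a1 y Dy).
  apply: cvgD; first apply: cvgD.
  + apply: cvgM; first exact: cQ (q3 y Dy).
    exact: (cvg_comp _ _ cA1 (@exprn_continuous _ 3 _)).
  + apply: cvgM; last exact: der_cont (a2 y Dy).
    apply: cvgM => //.
    by apply: cvgM; [exact: cvg_cst | exact: cQ (der_cont (q2 y Dy))].
  + by apply: cvgM; [exact: cQ (der_cont (q1 y Dy)) | exact: a3].
split=> //; have [-> -> ->] := gE x Dx.
by rewrite /g1 /g2 /g3; field; rewrite A10 Q10.
Qed.

End smoothness.

(** * Distribution functions of densities *)

Section calculus_on_intervals.
Context {R : realType}.
Implicit Types (f g : R -> R) (a b x y z : R) (D : set R).

Lemma mean_value f f' a b : a < b ->
  (forall x, a <= x <= b -> is_derive x 1 f (f' x)) ->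
  exists2 c, a < c < b & f b - f a = f' c * (b - a).
Proof.
move=> ab fd; have [x xab||c cab fE] := @MVT R f f' a b ab.
- by apply: fd; rewrite !ltW ?(itvP xab).
- apply/(derivable_within_continuous (i := `[a, b])) => y yab.
  by have [] := fd y yab.
- by exists c => //; rewrite !(itvP cab).
Qed.

Lemma der_ge0_le f f' a b : a <= b ->
  (forall x, a <= x <= b -> is_derive x 1 f (f' x)) ->
  (forall x, a <= x <= b -> 0 <= f' x) -> f a <= f b.
Proof.
rewrite le_eqVlt => /predU1P[->//|ab] fd f0.
have [c /andP[ac cb] fE] := mean_value ab fd.
by rewrite -subr_ge0 fE mulr_ge0 ?f0 ?subr_ge0 ?ltW.
Qed.

Lemma der_gt0_lt f f' a b : a < b ->
  (forall x, a <= x <= b -> is_derive x 1 f (f' x)) ->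
  (forall x, a <= x <= b -> 0 < f' x) -> f a < f b.
Proof.
move=> ab fd f0; have [c /andP[ac cb] fE] := mean_value ab fd.
by rewrite -subr_gt0 fE mulr_gt0 ?f0 ?subr_gt0// !ltW.
Qed.

Lemma open_nbhs_pred D x : open D -> D x -> \forall y \near x, D y.
Proof. by move=> oD Dx; exact: (open_nbhs_nbhs (conj oD Dx)). Qed.

Lemma open_lt_gt D x : open D -> D x ->
  exists a b, [/\ D a, D b, a < x & x < b].
Proof.
move=> oD Dx; have /nbhs_ballP[e /= e0 De] := open_nbhs_pred oD Dx.
exists (x - e / 2), (x + e / 2); split.
- by apply: De; rewrite /ball/= opprB addrC subrK gtr0_norm; lra.
- by apply: De; rewrite /ball/= opprD addrA subrr add0r normrN gtr0_norm; lra.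
- lra.
- lra.
Qed.

Lemma open01 : open (`]0, 1[%classic : set R).
Proof. exact: interval_open. Qed.

End calculus_on_intervals.

Section densities.
Context {R : realType}.
Implicit Types (f g G : R -> R) (x y z : R) (J A : set R).
Local Notation mu := (@lebesgue_measure R).

Lemma density_integrable f A : prob_density f -> measurable A ->
  mu.-integrable A (EFin \o f).
Proof.
move=> [mf f0 f1] mA; apply: (@integrableS _ _ _ mu setT) => //.
apply/integrableP; split; first exact/measurable_EFinP.
under eq_integral do rewrite /= ger0_norm//.
by rewrite f1 ltry.
Qed.

Lemma cdf_of_sub f x y : prob_density f -> x <= y ->
  cdf_of f y - cdf_of f x = (\int[mu]_(t in `]x, y]) f t)%R.
Proof.
by move=> df xy; rewrite /cdf_of Rintegral_itvB//; exact: density_integrable.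
Qed.

Lemma Rintegral_density f : prob_density f -> (\int[mu]_t f t)%R = 1.
Proof. by move=> [_ _ f1]; rewrite /Rintegral f1. Qed.

Lemma ccdf_of f x : prob_density f ->
  1 - cdf_of f x = (\int[mu]_(t in `]x, +oo[) f t)%R.
Proof.
move=> df; rewrite -(Rintegral_density df) -set_itvNyy.
by rewrite /cdf_of Rintegral_itvB//; exact: density_integrable.
Qed.

Lemma cdf_of_nd f x y : prob_density f -> x <= y -> cdf_of f x <= cdf_of f y.
Proof.
move=> df xy; rewrite -subr_ge0 cdf_of_sub//.
by apply: Rintegral_ge0 => t _; case: df.
Qed.

Lemma cdf_of_ge0 f x : prob_density f -> 0 <= cdf_of f x.
Proof. by move=> [_ f0 _]; apply: Rintegral_ge0. Qed.

Lemma cdf_of_le1 f x : prob_density f -> cdf_of f x <= 1.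
Proof.
move=> df; rewrite -subr_ge0 ccdf_of//.
by apply: Rintegral_ge0 => t _; case: df.
Qed.

Lemma cvg_integral_bigcup f (S : nat -> set R) D : prob_density f ->
  (forall n, measurable (S n)) -> {homo S : m n / (m <= n)%N >-> m `<=` n} ->
  \bigcup_n S n = D ->
  (\int[mu]_(t in S n) f t)%R @[n --> \oo] --> (\int[mu]_(t in D) f t)%R.
Proof.
move=> df mS ndS <-; apply: fine_cvg.
have := @ge0_nondecreasing_set_cvg_integral _ (measurableTypeR R) _ S
  (EFin \o f) mu.
have mU : measurable (\bigcup_n S n) by exact: bigcup_measurable.
rewrite fineK; last exact: integrable_fin_num (density_integrable df mU).
apply => //.
- by move=> m n mn; apply/subsetPset; exact: ndS.
- by move=> i; apply: measurable_funTS; apply/measurable_EFinP; case: df.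
- by move=> i x _; rewrite lee_fin; case: df.
Qed.

Lemma cdf_of_gt f z : prob_density f -> z < 1 -> exists x, z < cdf_of f x.
Proof.
move=> df z1.
have : (\int[mu]_(t in `]-oo, n%:R]) f t)%R @[n --> \oo] --> (1 : R).
  rewrite -[X in _ --> X](Rintegral_density df); apply: cvg_integral_bigcup => //.
    move=> m n mn x /=; rewrite !in_itv/= => /le_trans; apply.
    by rewrite ler_nat.
  apply/seteqP; split=> // x _.
  have [n _ /(_ n (leqnn n))/= xn] := nbhs_infty_ger x.
  by exists n => //=; rewrite in_itv.
move=> /cvgr_gt/(_ _ z1)[n _ /(_ n (leqnn n)) nz].
by exists n%:R.
Qed.

Lemma cdf_of_lt f z : prob_density f -> 0 < z -> exists x, cdf_of f x < z.
Proof.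
move=> df z0; have z1 : 1 - z < 1 by lra.
have : (\int[mu]_(t in `](- n%:R)%R, +oo[) f t)%R @[n --> \oo] --> (1 : R).
  rewrite -[X in _ --> X](Rintegral_density df); apply: cvg_integral_bigcup => //.
    move=> m n mn x /=; rewrite !in_itv/= !andbT; apply: le_lt_trans.
    by rewrite lerN2 ler_nat.
  apply/seteqP; split=> // x _.
  have [n _ /(_ n (leqnn n))/= xn] := nbhs_infty_gtr (- x).
  by exists n => //=; rewrite in_itv/= andbT ltrNl.
move=> /cvgr_gt/(_ _ z1)[n _ /(_ n (leqnn n)) nz].
exists (- n%:R); move: nz; rewrite -ccdf_of//; lra.
Qed.

Lemma cdf_of_within_continuous f a b : prob_density f -> a <= b ->
  {within `[a, b], continuous (cdf_of f)}.
Proof.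
move=> df ab.
have ci := parameterized_integral_continuous ab
  (density_integrable df (measurable_itv `[a, b])).
have : {within `[a, b], continuous
   (fun x => cdf_of f a + parameterized_integral mu a x f)}.
  by move=> x; apply: cvgD; [exact: cvg_cst | exact: ci].
apply: subspace_eq_continuous => x; rewrite inE/= in_itv/= => /andP[ax _].
apply: esym; rewrite -[LHS](subrK (cdf_of f a)) cdf_of_sub// addrC.
by rewrite Rintegral_itv_obnd_cbnd//; exact: density_integrable.
Qed.

Lemma cdf_of_onto f z : prob_density f -> 0 < z < 1 -> exists x, cdf_of f x = z.
Proof.
move=> df /andP[z0 z1].
have [a az] := cdf_of_lt df z0; have [b bz] := cdf_of_gt df z1.
have ab : a <= b.
  by rewrite leNgt; apply/negP => /ltW /(cdf_of_nd df); lra.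
have [|c _ cz] := IVT ab (cdf_of_within_continuous df ab) (v := z).
  by rewrite ge_min (ltW az)/= le_max (ltW bz) orbT.
by exists c.
Qed.

End densities.

(** * Quantile functions *)

Section quantiles.
Context {R : realType}.
Implicit Types (f g G : R -> R) (x y z : R) (J A : set R).
Local Notation mu := (@lebesgue_measure R).

Lemma Dplus_support f : Dplus f ->
  [/\ prob_density f, open [set x | 0 < f x], is_interval [set x | 0 < f x] &
      forall x, 0 < f x -> {for x, continuous f}].
Proof.
move=> [df [I [oI itvI If If0]]].
have IE : [set x | 0 < f x] = I.
  apply/seteqP; split=> x /=; last by move=> /If[].
  move=> fx; apply: contrapT => /If0 fx0; lra.
by rewrite IE; split => // x fx; have [|_ //] := If x; rewrite -IE.
Qed.

Lemma density_eq0 f x : prob_density f -> ~ 0 < f x -> f x = 0.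
Proof. by move=> [_ f0 _] fx; have := f0 x; lra. Qed.

Lemma cdf_of_der f x : Dplus f -> 0 < f x -> is_derive x 1 (cdf_of f) (f x).
Proof.
move=> /Dplus_support[df _ _ cf] fx.
have [|||dF FE] := @continuous_FTC1 R f -oo%O x (x + 1) _ _ _ (cf x fx).
- by rewrite ltrDl.
- exact: density_integrable.
- by rewrite ltNyr.
- by apply: is_derive_eq (der1P dF) FE.
Qed.

Lemma cdf_of_incr f x y : Dplus f -> 0 < f x -> 0 < f y -> x < y ->
  cdf_of f x < cdf_of f y.
Proof.
move=> Df fx fy xy; have [_ _ itvf _] := Dplus_support Df.
have f0 t : x <= t <= y -> 0 < f t by exact: itvf.
by apply: (der_gt0_lt xy (f' := f)) => // t /f0; exact: cdf_of_der.
Qed.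

Lemma cdf_of_itv f x : Dplus f -> 0 < f x -> 0 < cdf_of f x < 1.
Proof.
move=> Df fx; have [df of_ _ _] := Dplus_support Df.
have [a [b [fa fb ax xb]]] := open_lt_gt of_ fx.
rewrite (le_lt_trans (cdf_of_ge0 a df) (cdf_of_incr Df fa fx ax)).
by rewrite (lt_le_trans (cdf_of_incr Df fx fb xb) (cdf_of_le1 b df)).
Qed.

(** The support is an interval, so a zero of the density has no mass on one of
    its sides. *)
Lemma supp_of_cdf f x : Dplus f -> 0 < cdf_of f x < 1 -> 0 < f x.
Proof.
move=> Df /andP[F0 F1]; have [df _ itvf _] := Dplus_support Df.
apply: contrapT => fx.
have [[y /= xy fy]|nl] := pselect (exists2 y, y <= x & 0 < f y).
- have : 1 - cdf_of f x = 0; last by lra.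
  rewrite ccdf_of// /Rintegral integral0_eq// => t /=.
  rewrite in_itv/= andbT => xt; congr EFin; apply: density_eq0 => // ft.
  by apply: fx; apply: (itvf y t) => //; rewrite xy ltW.
- have : cdf_of f x = 0; last by lra.
  rewrite /cdf_of /Rintegral integral0_eq// => t /=.
  rewrite in_itv/= => tx; congr EFin; apply: density_eq0 => // ft.
  by apply: nl; exists t.
Qed.

Lemma cdf_of_inj f x y : Dplus f -> 0 < f x -> 0 < f y ->
  cdf_of f x = cdf_of f y -> x = y.
Proof.
move=> Df fx fy Fxy; case: (ltgtP x y) => // xy.
- by have := cdf_of_incr Df fx fy xy; rewrite Fxy ltxx.
- by have := cdf_of_incr Df fy fx xy; rewrite Fxy ltxx.
Qed.

Lemma cdf_of_quantile f z : Dplus f -> 0 < z < 1 -> cdf_of f (quantile f z) = z.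
Proof.
move=> Df z01; have [df _ _ _] := Dplus_support Df.
by have := xgetPex 0 (cdf_of_onto df z01).
Qed.

Lemma quantile_supp f z : Dplus f -> 0 < z < 1 -> 0 < f (quantile f z).
Proof. by move=> Df z01; apply: supp_of_cdf => //; rewrite cdf_of_quantile. Qed.

Lemma quantile_cdf f x : Dplus f -> 0 < f x -> quantile f (cdf_of f x) = x.
Proof.
move=> Df fx; have F01 := cdf_of_itv Df fx.
by apply: (cdf_of_inj Df) => //; [exact: quantile_supp | exact: cdf_of_quantile].
Qed.

Lemma quantile_der f z : Dplus f -> 0 < z < 1 ->
  is_derive z 1 (quantile f) (rank_profile f z)^-1.
Proof.
move=> Df z01; have fQ := quantile_supp Df z01.
have [_ of_ _ _] := Dplus_support Df.
rewrite -[in X in is_derive X](cdf_of_quantile Df z01).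
apply: (@is_derive_inverse R (cdf_of f)); last by rewrite gt_eqF.
- by near=> x; apply: quantile_cdf => //; near: x; exact: open_nbhs_pred of_ fQ.
- near=> x; have fx : 0 < f x by near: x; exact: open_nbhs_pred of_ fQ.
  exact: der_cont (cdf_of_der Df fx).
- exact: cdf_of_der.
Unshelve. all: end_near. Qed.

(** The mass is computed along the compact intervals on which the antiderivative
    goes from 1/(n+2) to 1 - 1/(n+2).  Reflected laws, distorted laws and the
    uniform law are recognized as laws in this way. *)
Lemma density_of_antiderivative g G : (forall x, 0 <= g x) ->
  open [set x | 0 < g x] -> is_interval [set x | 0 < g x] ->
  (forall x, 0 < g x -> {for x, continuous g}) ->
  (forall x, 0 < g x -> is_derive x 1 G (g x)) ->
  (forall x, 0 < g x -> 0 < G x < 1) ->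
  (forall z, 0 < z < 1 -> exists2 x, 0 < g x & G x = z) ->
  Dplus g /\ forall x, 0 < g x -> cdf_of g x = G x.
Proof.
move=> g0 og itvg cg dG G01 Gonto.
set J := [set x | 0 < g x].
have gJ : g = g \_ J.
  apply/funext => x; rewrite patchE; case: ifPn => // /negP; rewrite inE => Jx.
  by apply/eqP; rewrite eq_le g0 andbT leNgt; apply/negP.
have gE : (EFin \o g) \_ J = EFin \o g by rewrite restrict_EFin -gJ.
have mJ : measurable J by exact: open_measurable.
have mg : measurable_fun setT g.
  rewrite gJ; apply/(measurable_restrictT g mJ).
  apply: subspace_continuous_measurable_fun => //.
  by apply: continuous_in_subspaceT => x; rewrite inE; exact: cg.
have Glt x y : 0 < g x -> 0 < g y -> x < y -> G x < G y.
  move=> gx gy xy; have g0' t : x <= t <= y -> 0 < g t by exact: itvg.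
  by apply: (der_gt0_lt xy (f' := g)) => // t /g0'; exact: dG.
have Gle x y : 0 < g x -> 0 < g y -> G x <= G y -> x <= y.
  move=> gx gy Gxy; rewrite leNgt; apply/negP => /(Glt _ _ gy gx).
  by rewrite ltNge Gxy.
have intg a b : 0 < g a -> 0 < g b -> a < b ->
    (\int[mu]_(x in `[a, b]) (g x)%:E = (G b - G a)%:E)%E.
  move=> ga gb ab; have gab t : a <= t <= b -> 0 < g t by exact: itvg.
  apply: continuous_FTC2 => //.
  - apply: continuous_in_subspaceT => x; rewrite inE/= in_itv/= => /gab.
    exact: cg.
  - split.
    + by move=> x; rewrite in_itv/= => /andP[/ltW ax /ltW xb];
        have [] := dG x (gab x _); rewrite ?ax.
    + by apply: cvg_at_right_filter; exact: der_cont (dG a ga).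
    + by apply: cvg_at_left_filter; exact: der_cont (dG b gb).
  - move=> x; rewrite in_itv/= => /andP[/ltW ax /ltW xb].
    by apply/der1E/dG/gab; rewrite ax.
pose e n : R := (n.+2)%:R^-1.
have e0 n : 0 < e n by rewrite invr_gt0.
have e12 n : e n <= 1 / 2.
  by rewrite /e div1r lef_pV2 ?posrE ?ler_nat.
have enincr m n : (m <= n)%N -> e n <= e m.
  by move=> mn; rewrite /e lef_pV2 ?posrE// ler_nat.
have ecvg : e n @[n --> \oo] --> (0 : R).
  by rewrite (cvg_shiftS (@harmonic R)); exact: cvg_harmonic.
have elt c : 0 < c -> \forall n \near \oo, e n < c.
  by move=> c0; exact: (cvgr_lt _ ecvg).
have /choice[a aP] n : exists x, 0 < g x /\ G x = e n.
  have [|x gx Gx] := Gonto (e n); last by exists x.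
  by rewrite e0 (le_lt_trans (e12 n))//; lra.
have /choice[b bP] n : exists x, 0 < g x /\ G x = 1 - e n.
  have [|x gx Gx] := Gonto (1 - e n); last by exists x.
  by have := e0 n; have := e12 n; lra.
have aincr m n : (m <= n)%N -> a n <= a m.
  move=> mn; have [gm Gm] := aP m; have [gn Gn] := aP n.
  by apply: Gle => //; rewrite Gm Gn enincr.
have bincr m n : (m <= n)%N -> b m <= b n.
  move=> mn; have [gm Gm] := bP m; have [gn Gn] := bP n.
  by apply: Gle => //; rewrite Gm Gn lerD2l lerN2 enincr.
have eventually_a x : 0 < g x -> \forall n \near \oo, a n < x.
  move=> gx; have /andP[Gx0 Gx1] := G01 _ gx.
  near=> n; have [gn Gn] := aP n.
  rewrite ltNge; apply/negP => xa.
  have : G x <= G (a n).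
    by move: xa; rewrite le_eqVlt => /predU1P[->//|/(Glt _ _ gx gn)/ltW].
  by rewrite Gn leNgt => /negP; apply; near: n; exact: elt.
have eventually_b x : 0 < g x -> \forall n \near \oo, x < b n.
  move=> gx; have /andP[Gx0 Gx1] := G01 _ gx.
  near=> n; have [gn Gn] := bP n.
  rewrite ltNge; apply/negP => xb.
  have : G (b n) <= G x.
    by move: xb; rewrite le_eqVlt => /predU1P[->//|/(Glt _ _ gn gx)/ltW].
  rewrite Gn; suff : e n < 1 - G x by lra.
  by near: n; apply: elt; lra.
have limg (S : nat -> set R) D : (forall n, measurable (S n)) ->
    {homo S : m n / (m <= n)%N >-> m `<=` n} -> \bigcup_n S n = D ->
    (\int[mu]_(t in S n) (g t)%:E)%E @[n --> \oo] -->
    (\int[mu]_(t in D) (g t)%:E)%E.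
  move=> mS ndS <-.
  apply: (@ge0_nondecreasing_set_cvg_integral _ (measurableTypeR R)) => //.
  - by move=> m n mn; apply/subsetPset; exact: ndS.
  - by move=> i; apply: measurable_funTS; exact/measurable_EFinP.
  - by move=> i x _; rewrite lee_fin.
have [x0 gx0 _] : exists2 x, 0 < g x & G x = 1 / 2 by apply: Gonto; lra.
have pg : prob_density g.
  split=> //; have -> : (\int[mu]_x (g x)%:E = \int[mu]_(x in J) (g x)%:E)%E.
    by rewrite [RHS]integral_mkcond gE.
  have lim1 : (\int[mu]_(t in `[a n, b n]) (g t)%:E)%E @[n --> \oo] -->
              (\int[mu]_(t in J) (g t)%:E)%E.
    apply: limg => //.
    - move=> m n mn x /=; rewrite !in_itv/= => /andP[ax xb].
      by rewrite (le_trans (aincr _ _ mn) ax) (le_trans xb (bincr _ _ mn)).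
    - apply/seteqP; split=> [x [n _]|x Jx] /=.
        by rewrite in_itv/=; apply: itvg; [have [] := aP n | have [] := bP n].
      have [n _ nx] : \forall n \near \oo, a n < x /\ x < b n.
        near=> n; split; near: n; [exact: eventually_a | exact: eventually_b].
      exists n => //=; have [an bn] := nx n (leqnn n).
      by rewrite in_itv/= !ltW.
  have lim2 : (\int[mu]_(t in `[a n, b n]) (g t)%:E)%E @[n --> \oo] --> 1%:E.
    have : (1 - e n - e n)%:E @[n --> \oo] --> (1%:E : \bar R).
      apply: cvg_EFin; first exact: nearW.
      rewrite -[X in _ --> X](_ : 1 - 0 - 0 = 1 :> R); last lra.
      by apply: cvgB => //; apply: cvgB => //; exact: cvg_cst.
    apply: cvg_trans; apply: near_eq_cvg; near=> n.
    have [gan Gan] := aP n; have [gbn Gbn] := bP n.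
    rewrite intg// ?Gan ?Gbn//.
    by apply: (@lt_trans _ _ x0); near: n;
      [exact: eventually_a | exact: eventually_b].
  exact: (cvg_unique _ lim1 lim2).
split.
  split=> //; exists J; split => //.
  - by move=> x Jx; split => //; exact: cg.
  - by move=> x Jx; apply: density_eq0.
move=> x gx.
have lim1 : (\int[mu]_(t in `[a n, x]) (g t)%:E)%E @[n --> \oo] -->
            (\int[mu]_(t in J `&` `]-oo, x]) (g t)%:E)%E.
  apply: limg => //.
  - move=> m n mn t /=; rewrite !in_itv/= => /andP[ax ->].
    by rewrite (le_trans (aincr _ _ mn) ax).
  - apply/seteqP; split=> [t [n _]|t [Jt]] /=; rewrite !in_itv/=.
      move=> /andP[at_ tx]; split => //.
      by apply: (itvg (a n) x) => //; [have [] := aP n | rewrite at_].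
    move=> tx; have [n _ nx] := eventually_a t Jt.
    by exists n => //=; rewrite in_itv/= tx ltW// nx/=.
have lim2 : (\int[mu]_(t in `[a n, x]) (g t)%:E)%E @[n --> \oo] --> (G x)%:E.
  have : (G x - e n)%:E @[n --> \oo] --> ((G x)%:E : \bar R).
    apply: cvg_EFin; first exact: nearW.
    rewrite -[X in _ --> X]subr0.
    by apply: cvgB => //; exact: cvg_cst.
  apply: cvg_trans; apply: near_eq_cvg; near=> n.
  have [gan Gan] := aP n.
  by rewrite intg// ?Gan//; near: n; exact: eventually_a.
rewrite /cdf_of /Rintegral.
have -> : (\int[mu]_(t in `]-oo, x]) (g t)%:E =
           \int[mu]_(t in J `&` `]-oo, x]) (g t)%:E)%E.
  by rewrite setIC integral_mkcondr gE.
by rewrite (cvg_unique _ lim1 lim2).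
Unshelve. all: end_near. Qed.

End quantiles.

(** * Limits at the two endpoints *)

Section endpoint_filters.
Context {R : realType}.
Implicit Types (U V : R -> R) (c z : R) (P : set R).

Lemma near_left1P P : (\forall z \near (1 : R)^'-, P z) <->
  exists2 a : R, 0 <= a < 1 & forall z, a < z < 1 -> P z.
Proof.
split=> [[e /= e0 eP]|[a /andP[a0 a1] aP]].
  exists (Num.max 0 (1 - e)).
    by rewrite le_max lexx/= gt_max ltr01/= ltrBlDr ltrDl.
  move=> z; rewrite gt_max => /andP[/andP[z0 ez] z1]; apply: eP => //=.
  by rewrite gtr0_norm; lra.
exists (1 - a) => /=; first lra.
move=> z /= + z1; rewrite gtr0_norm; last lra.
by move=> az; apply: aP; lra.
Qed.

Lemma near_right0P P : (\forall z \near (0 : R)^'+, P z) <->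
  exists2 a : R, 0 < a <= 1 & forall z, 0 < z < a -> P z.
Proof.
split=> [[e /= e0 eP]|[a /andP[a0 a1] aP]].
  exists (Num.min 1 e).
    by rewrite ge_min lexx/= lt_min ltr01 e0.
  move=> z; rewrite lt_min => /andP[z0 /andP[z1 ez]]; apply: eP => //=.
  by rewrite sub0r normrN gtr0_norm.
exists a => //= z /= + z0; rewrite sub0r normrN gtr0_norm// => az.
by apply: aP; rewrite z0.
Qed.

Lemma near_left1_in01 : \forall z \near (1 : R)^'-, 0 < z < 1.
Proof. by apply/near_left1P; exists 0; rewrite ?lexx ?ltr01. Qed.

Lemma near_left_right P :
  (\forall z \near (0 : R)^'+, P z) <-> \forall z \near (1 : R)^'-, P (1 - z).
Proof.
split=> [/near_right0P[a a01 aP]|/near_left1P[a a01 aP]].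
- by apply/near_left1P; exists (1 - a) => [|z z1]; [lra | apply: aP; lra].
- apply/near_right0P; exists (1 - a) => [|z z1]; first lra.
  by rewrite -(subKr 1 z); apply: aP; lra.
Qed.

Lemma right_weight_eq U V c : (forall z, 0 < z < 1 -> U z = V z) ->
  right_weight U c -> right_weight V c.
Proof.
move=> UV; apply: cvg_trans; apply: near_eq_cvg.
by move: near_left1_in01; apply: filterS => z /UV ->.
Qed.

(** The reflection z |-> 1 - z of the rank variable exchanges the two
    endpoints. *)
Lemma left_weightE U c : left_weight U c <-> right_weight (fun z => U (1 - z)) c.
Proof.
split=> /cvgrPdist_lt cU; apply/cvgrPdist_lt => e e0; have := cU e e0.
- by move/near_left_right.
- by move=> cU'; apply/near_left_right.
Qed.

Lemma right_weight_unique U c c' :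
  right_weight U c -> right_weight U c' -> c = c'.
Proof. by move=> Uc Uc'; exact: (cvg_unique _ Uc Uc'). Qed.

Lemma near_right0_lt (e : R) : 0 < e -> \forall s \near (0 : R)^'+, 0 < s < e.
Proof.
move=> e0; near=> s; apply/andP; split; near: s.
- exact: nbhs_right_gt.
- exact: nbhs_right_lt.
Unshelve. all: end_near. Qed.

Lemma cvg_right0_id : s @[s --> (0 : R)^'+] --> (0 : R).
Proof. by apply: cvg_at_right_filter; exact: cvg_id. Qed.

End endpoint_filters.

(** * The rank profile and the potential *)

Section rank_profile_and_potential.
Context {R : realType}.
Implicit Types (f g : R -> R) (x y z : R).

Lemma rank_profile_Ck f : Dplus2 f -> Ck_on 2 `]0, 1[ (rank_profile f) /\
  forall z, 0 < z < 1 -> let q := quantile f z in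
    (rank_profile f)^`() z = f^`() q / f q /\
    (rank_profile f)^`(2) z = (f q * f^`(2) q - f^`() q ^+ 2) / f q ^+ 3.
Proof.
move=> [Df f2]; have fQ z := @quantile_supp R f z Df.
have f0 z : 0 < z < 1 -> f (quantile f z) != 0 by move=> /fQ /lt0r_neq0.
have d0 z : 0 < z < 1 -> is_derive (quantile f z) 1 f (f^`() (quantile f z)).
  by move=> /fQ fq; exact: (Ck_on_is_derive (k := 0) f2).
have d1 z : 0 < z < 1 ->
    is_derive (quantile f z) 1 f^`() (f^`(2) (quantile f z)).
  by move=> /fQ fq; exact: (Ck_on_is_derive (k := 1) f2).
have d2 z : 0 < z < 1 -> {for quantile f z, continuous f^`(2)}.
  by move=> /fQ fq; exact: (Ck_on_continuous f2).
have dq z : 0 < z < 1 -> is_derive z 1 (quantile f) (f (quantile f z))^-1.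
  by move=> z01; exact: quantile_der.
rewrite /rank_profile.
move: (quantile f) (f^`()) (f^`(2)) f0 d0 d1 d2 dq => q f1 f2' f0 d0 d1 d2 dq.
pose g1 z : R := f1 (q z) / f (q z).
pose g2 z : R := (f (q z) * f2' (q z) - f1 (q z) ^+ 2) / f (q z) ^+ 3.
have E z : `]0, 1[%classic z <-> 0 < z < 1 by rewrite /= in_itv.
have [//|z /E z01|z /E z01|z /E z01|C gE] :=
  @Ck_on2 R `]0, 1[%classic (fun z => f (q z)) (fun z => f (q z)) g1 g2
    (@open01 R).
- rewrite /g1; derive_by ltac:(solve [eauto]); field; exact: f0.
- rewrite /g1 /g2; derive_by ltac:(solve [eauto]); field; exact: f0.
- have cq := der_cont (dq z z01).
  have cf (h : R -> R) : {for q z, continuous h} ->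
    h (q y) @[y --> z] --> h (q z) by move=> ch; apply: continuous_comp.
  have c0 := cf f (der_cont (d0 z z01)).
  have c1 := cf f1 (der_cont (d1 z z01)).
  apply: cvgM.
    apply: cvgB; first by apply: cvgM => //; exact/cf/d2.
    exact: (cvg_comp _ _ c1 (@exprn_continuous _ 2 _)).
  apply: cvgV; first by rewrite expf_neq0// f0.
  exact: (cvg_comp _ _ c0 (@exprn_continuous _ 3 _)).
split=> // z z01; exact/gE/E.
Qed.

Lemma quantile_Ck f : Dplus2 f -> Ck_on 3 `]0, 1[ (quantile f) /\
  forall z, 0 < z < 1 -> let r := rank_profile f in
    [/\ (quantile f)^`() z = (r z)^-1,
        (quantile f)^`(2) z = - r^`() z / r z ^+ 2 &
        (quantile f)^`(3) z =
          - r^`(2) z / r z ^+ 2 + 2 * r^`() z ^+ 2 / r z ^+ 3].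
Proof.
move=> Df2; have [Df _] := Df2; have [r2 _] := rank_profile_Ck Df2.
have E z : `]0, 1[%classic z <-> 0 < z < 1 by rewrite /= in_itv.
have r0 z : 0 < z < 1 -> rank_profile f z != 0.
  by move=> z01; rewrite lt0r_neq0//; exact: quantile_supp.
have d0 z : 0 < z < 1 ->
    is_derive z 1 (rank_profile f) ((rank_profile f)^`() z).
  by move=> /E z01; exact: (Ck_on_is_derive (k := 0) r2).
have d1 z : 0 < z < 1 ->
    is_derive z 1 (rank_profile f)^`() ((rank_profile f)^`(2) z).
  by move=> /E z01; exact: (Ck_on_is_derive (k := 1) r2).
have d2 z : 0 < z < 1 -> {for z, continuous (rank_profile f)^`(2)}.
  by move=> /E z01; exact: (Ck_on_continuous r2).
have dq z : 0 < z < 1 -> is_derive z 1 (quantile f) (rank_profile f z)^-1.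
  by move=> z01; exact: quantile_der.
clear r2; cbv zeta.
move: (rank_profile f) ((rank_profile f)^`()) ((rank_profile f)^`(2))
  r0 d0 d1 d2 dq => r s t r0 d0 d1 d2 dq.
pose g2 z : R := - s z / r z ^+ 2.
pose g3 z : R := - t z / r z ^+ 2 + 2 * s z ^+ 2 / r z ^+ 3.
have [|z /E z01|z /E z01|z /E z01|C gE] :=
  @Ck_on3 R `]0, 1[%classic (quantile f) (quantile f) (fun z => (r z)^-1) g2 g3
    (@open01 R).
- by [].
- rewrite /g2; derive_by ltac:(solve [eauto]); field; exact: r0.
- rewrite /g2 /g3; derive_by ltac:(first [apply: expf_neq0 | idtac]; solve [eauto]).
  field; exact: r0.
- have c0 := der_cont (d0 z z01); have c1 := der_cont (d1 z z01).
  have cX n (h : R -> R) : {for z, continuous h} ->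
      h y ^+ n @[y --> z] --> h z ^+ n.
    by move=> ch; exact: (cvg_comp _ _ ch (@exprn_continuous _ n _)).
  apply: cvgD; apply: cvgM.
  + by apply: cvgN; exact: (d2 z z01).
  + by apply: cvgV; [rewrite expf_neq0// r0 | exact: cX].
  + by apply: cvgM; [exact: cvg_cst | exact: cX].
  + by apply: cvgV; [rewrite expf_neq0// r0 | exact: cX].
split=> // z z01; exact/gE/E.
Qed.

(** With Q' = 1/r the Schwarzian derivative of the quantile function becomes
    the Riccati expression of the logarithmic derivative of r. *)
Lemma hill_potentialE f z : Dplus2 f -> 0 < z < 1 ->
  let r := rank_profile f in
  hill_potential f z = - (r^`(2) z / r z) + (r^`() z / r z) ^+ 2 / 2.
Proof.
move=> Df2 z01 r; have [_ /(_ z z01)[q1 q2 q3]] := quantile_Ck Df2.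
have r0 : r z != 0.
  by rewrite lt0r_neq0//; apply: quantile_supp z01; case: Df2.
by rewrite /hill_potential /schwarzian q1 q2 q3 -/r; field.
Qed.

End rank_profile_and_potential.

(** * Reflection of laws *)

Section reflection.
Context {R : realType}.
Implicit Types (f g : R -> R) (x y z : R).

Lemma derNx f x a : is_derive (- x) 1 f a ->
  is_derive x 1 (fun y => f (- y)) (- a).
Proof.
by move=> fa; rewrite -mulrN1; apply: der_comp.
Qed.

Lemma reflect_law_Dplus2 f : Dplus2 f ->
  [/\ Dplus2 (reflect_law f),
      forall x, 0 < f (- x) -> cdf_of (reflect_law f) x = 1 - cdf_of f (- x) &
      forall x, 0 < f (- x) -> (reflect_law f)^`() x = - f^`() (- x) /\
        (reflect_law f)^`(2) x = f^`(2) (- x)].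
Proof.
move=> [Df f2]; have [df of_ itvf cf] := Dplus_support Df.
have oN : open [set x | 0 < f (- x)].
  by apply: (@open_comp _ _ (-%R : R -> R) [set x | 0 < f x]) => // x _;
    exact: opp_continuous.
have [|||||||DN FN] :=
  @density_of_antiderivative R (reflect_law f) (fun x => 1 - cdf_of f (- x)).
- by move=> x; rewrite /reflect_law; case: df.
- exact: oN.
- move=> x y /= fx fy z /andP[xz zy].
  by apply: (itvf (- y) (- x)) => //; rewrite !lerN2 zy.
- move=> x fx; apply: continuous_comp; last exact: cf.
  exact: opp_continuous.
- move=> x fx; rewrite -[reflect_law f x]add0r.
  apply: (@derD _ (fun=> 1) (fun y => - cdf_of f (- y))).
  rewrite -[reflect_law f x]opprK; apply: (@derN _ (fun y => cdf_of f (- y))).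
  by apply: derNx; exact: cdf_of_der.
- by move=> x fx; have := cdf_of_itv Df fx; lra.
- move=> z z01; have z01' : 0 < 1 - z < 1 by lra.
  exists (- quantile f (1 - z)); rewrite /reflect_law opprK.
    exact: quantile_supp.
  by rewrite cdf_of_quantile// subKr.
have [|x fx|x fx|x fx|CN NE] :=
  @Ck_on2 R _ (reflect_law f) (reflect_law f) (fun x => - f^`() (- x))
    (fun x => f^`(2) (- x)) oN.
- by [].
- by apply: derNx; exact: (Ck_on_is_derive (k := 0) f2).
- rewrite -[f^`(2) (- x)]opprK; apply: (@derN _ (fun y => f^`() (- y))).
  apply: derNx.
  exact: (Ck_on_is_derive (k := 1) f2).
- apply: continuous_comp; first exact: opp_continuous.
  exact: (Ck_on_continuous f2).
by split.
Qed.

Lemma quantile_reflect f z : Dplus2 f -> 0 < z < 1 ->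
  quantile (reflect_law f) z = - quantile f (1 - z).
Proof.
move=> Df2 z01; have [DN FN _] := reflect_law_Dplus2 Df2.
have z01' : 0 < 1 - z < 1 by lra.
have [Df _] := Df2; have fQ := quantile_supp Df z01'.
rewrite -[in LHS](subKr 1 z) -[in LHS](cdf_of_quantile Df z01').
have fN : 0 < f (- - quantile f (1 - z)) by rewrite opprK.
rewrite -{1}(opprK (quantile f (1 - z))) -FN// quantile_cdf//.
by case: DN.
Qed.

Lemma rank_profile_reflect f z : Dplus2 f -> 0 < z < 1 ->
  rank_profile (reflect_law f) z = rank_profile f (1 - z).
Proof.
by move=> Df2 z01; rewrite /rank_profile quantile_reflect// /reflect_law opprK.
Qed.

Lemma hill_potential_reflect f z : Dplus2 f -> 0 < z < 1 ->
  hill_potential (reflect_law f) z = hill_potential f (1 - z).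
Proof.
move=> Df2 z01; have [DN _ derN] := reflect_law_Dplus2 Df2.
have z01' : 0 < 1 - z < 1 by lra.
have [_ /(_ _ z01)[r1 r2]] := rank_profile_Ck DN.
have [_ /(_ _ z01')[s1 s2]] := rank_profile_Ck Df2.
have [Df _] := Df2; have fQ := quantile_supp Df z01'.
rewrite !hill_potentialE// r1 r2 s1 s2 rank_profile_reflect// quantile_reflect//.
have [] := derN (- quantile f (1 - z)); rewrite opprK// => -> ->.
rewrite /reflect_law /rank_profile opprK; field.
by rewrite lt0r_neq0.
Qed.

Lemma left_weight_reflect f c : Dplus2 f ->
  left_weight (hill_potential f) c <->
  right_weight (hill_potential (reflect_law f)) c.
Proof.
move=> Df2; split=> [/left_weightE|rw]; last apply/left_weightE.
  by apply: right_weight_eq => z z01; rewrite hill_potential_reflect.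
by move: rw; apply: right_weight_eq => z z01; rewrite hill_potential_reflect.
Qed.

Lemma left_profile_reflect f beta L : Dplus2 f ->
  left_profile f beta L <-> right_profile (reflect_law f) beta L.
Proof.
move=> Df2; split=> -[sL rL]; split=> //.
- move/near_left_right : rL => rL; near=> z.
  have z01 : 0 < z < 1 by near: z; exact: near_left1_in01.
  by rewrite rank_profile_reflect//; near: z.
- apply/near_left_right; near=> z.
  have z01 : 0 < z < 1 by near: z; exact: near_left1_in01.
  by rewrite -rank_profile_reflect//; near: z.
Unshelve. all: end_near. Qed.

End reflection.

(** * The weight of a regularly varying rank profile *)

Section weight_of_profile.
Context {R : realType}.
Implicit Types (f g L : R -> R) (x y z s beta : R) (D : set R).

Lemma der2_open D g g0 g1 g2 x : open D -> (forall y, D y -> g0 y = g y) ->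
  (forall y, D y -> is_derive y 1 g0 (g1 y)) ->
  (forall y, D y -> is_derive y 1 g1 (g2 y)) -> D x ->
  g^`() x = g1 x /\ g^`(2) x = g2 x.
Proof.
move=> oD gE d0 d1 Dx.
have gE1 y : D y -> g1 y = g^`() y.
  by move=> Dy; apply/esym/der1E; exact: (der_open oD gE Dy (d0 y Dy)).
by split; [rewrite gE1 | apply: der1E; exact: (der_open oD gE1 Dx (d1 x Dx))].
Qed.

Lemma powR_pred x b : 0 < x -> x `^ (b - 1) = x `^ b / x.
Proof.
move=> x0; rewrite -powR_inv1 ?ltW// -powRD//.
by apply/implyP => _; rewrite gt_eqF.
Qed.

Lemma near_left1_pinfty (P : set R) : (\forall s \near +oo, P s) ->
  \forall z \near (1 : R)^'-, P (1 - z)^-1.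
Proof.
move=> [M [_ MP]]; apply/near_left1P; exists (1 - (Num.max M 1)^-1).
  have M1 : 1 <= Num.max M 1 by rewrite le_max lexx orbT.
  have M0 : 0 < Num.max M 1 by exact: lt_le_trans M1.
  have : 0 < (Num.max M 1)^-1 by rewrite invr_gt0.
  have : (Num.max M 1)^-1 <= 1 by rewrite invf_le1.
  by lra.
move=> z /andP[Mz z1]; apply: MP; apply: (@le_lt_trans _ _ (Num.max M 1)).
  by rewrite le_max lexx.
have M0 : 0 < Num.max M 1 by rewrite lt_max ltr01 orbT.
by rewrite -[X in X < _]invrK ltf_pV2 ?posrE ?invr_gt0; lra.
Qed.

Lemma cvg_left1_pinfty g (l : R) : g s @[s --> +oo] --> l ->
  g (1 - z)^-1 @[z --> (1 : R)^'-] --> l.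
Proof.
move=> /cvgrPdist_lt gl; apply/cvgrPdist_lt => e e0.
exact: near_left1_pinfty (gl e e0).
Qed.

(** With s = 1 / (1 - z), l1 = s L' / L and l2 = s^2 L'' / L, the quotient
    (1 - z) r' / r is - b + l1 and (1 - z)^2 r'' / r is
    b^2 - b + (2 - 2 b) l1 + l2. *)
Lemma right_weight_of_profile f beta L : Dplus2 f -> right_profile f beta L ->
  right_weight (hill_potential f) (2 * beta * (1 - beta)).
Proof.
move=> Df2 [[[L0 _] [M L2] Ll] rL].
pose b := 2 * beta; pose s z : R := (1 - z)^-1.
pose l1 z : R := s z * L^`() (s z) / L (s z).
pose l2 z : R := s z ^+ 2 * L^`(2) (s z) / L (s z).
have c1 : l1 z @[z --> (1 : R)^'-] --> (0 : R).
  have := Ll 1%N isT; under eq_fun do rewrite expr1.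
  exact: (@cvg_left1_pinfty (fun s => s * L^`() s / L s)).
have c2 : l2 z @[z --> (1 : R)^'-] --> (0 : R).
  exact: (@cvg_left1_pinfty (fun s => s ^+ 2 * L^`(2) s / L s)) (Ll 2%N isT).
have L0z := near_left1_pinfty L0.
have LM : \forall s \near +oo, M < s by apply: nbhs_pinfty_gt; exact: num_real.
have /near_left1P[a /andP[a0 a1] aP] : \forall z \near (1 : R)^'-,
    [/\ rank_profile f z = (1 - z) `^ b * L (s z), 0 < L (s z) & M < s z].
  near=> z; split.
  - by rewrite -[X in L X]div1r; near: z.
  - by near: z.
  - by near: z; exact: near_left1_pinfty LM.
have : - ((b ^+ 2 - b) + (2 - 2 * b) * l1 z + l2 z)
         + (- b + l1 z) * (- b + l1 z) / 2 @[z --> (1 : R)^'-] -->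
       - ((b ^+ 2 - b) + (2 - 2 * b) * 0 + 0) + (- b + 0) * (- b + 0) / 2.
  apply: cvgD.
    apply: cvgN; apply: cvgD => //; apply: cvgD; first exact: cvg_cst.
    by apply: cvgM => //; exact: cvg_cst.
  have cb : - b + l1 z @[z --> (1 : R)^'-] --> - b + 0.
    by apply: cvgD => //; exact: cvg_cst.
  by apply: cvgM; [exact: cvgM | exact: cvg_cst].
rewrite (_ : - _ + _ = 2 * beta * (1 - beta)); last by rewrite /b; field.
apply: cvg_trans; apply: near_eq_cvg; near=> z.
have az1 : a < z < 1.
  by near: z; apply/near_left1P; exists a; rewrite ?a0 ?a1.
rewrite hill_potentialE//; last by lra.
pose P z : R := (1 - z) `^ b.
pose g1 z : R := P z * (s z ^+ 2 * L^`() (s z) - b * s z * L (s z)).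
pose g2 z : R := P z * ((b ^+ 2 - b) * s z ^+ 2 * L (s z)
  + (2 - 2 * b) * s z ^+ 3 * L^`() (s z) + s z ^+ 4 * L^`(2) (s z)).
have P0 y : a < y < 1 -> 0 < P y by move=> ay; apply: powR_gt0; lra.
have dP y : a < y < 1 -> is_derive y 1 P (- b * P y * s y).
  move=> ay; rewrite /P /s; derive_by ltac:(lra).
  rewrite powR_pred; last lra.
  by field; lra.
have dL y : a < y < 1 -> is_derive (s y) 1 L (L^`() (s y)).
  move=> /aP[_ _ My]; apply: (Ck_on_is_derive (k := 0) L2) => //=.
  by rewrite in_itv/= My.
have dL1 y : a < y < 1 -> is_derive (s y) 1 L^`() (L^`(2) (s y)).
  move=> /aP[_ _ My]; apply: (Ck_on_is_derive (k := 1) L2) => //=.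
  by rewrite in_itv/= My.
have ds y : a < y < 1 -> is_derive y 1 s (s y ^+ 2).
  by move=> ay; rewrite /s; derive_by ltac:(lra); field; lra.
have [-> ->] : (rank_profile f)^`() z = g1 z /\ (rank_profile f)^`(2) z = g2 z.
  have E y : `]a, 1[%classic y <-> a < y < 1 by rewrite /= in_itv.
  apply: (@der2_open `]a, 1[ _ (fun z => P z * L (s z)) g1 g2) => [|y|y|y|].
  - exact: interval_open.
  - by move=> /E /aP[->].
  - move=> /E ay; rewrite /g1; derive_by ltac:(solve [eauto]); ring.
  - move=> /E ay; rewrite /g1 /g2; derive_by ltac:(solve [eauto]).
    by rewrite /=; ring.
  - exact/E.
have [-> Lz _] := aP _ az1.
rewrite /g1 /g2 -/(P z) /l1 /l2 /s.
have Pz : P z != 0 by rewrite gt_eqF ?P0.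
by field; rewrite Pz (gt_eqF Lz)/=; lra.
Unshelve. all: end_near. Qed.

End weight_of_profile.

(** * The upper bound for the weights *)

Section weight_bound.
Context {R : realType}.
Implicit Types (f : R -> R) (c z : R).

(** A comparison of the Riccati equation h' = - U - h^2 / 2 for h = r' / r with
    its constant-coefficient model: if (1 - z)^2 U >= c > 1/2, the quantity
    k = (1 - z) h + 1 satisfies k' <= - (k^2 + w^2) / (2 (1 - z)) where
    w^2 = 2 c - 1 > 0.  So atan (k / w) decreases at least as fast as
    (w / 2) ln (1 - z), which is impossible for a bounded function. *)
Lemma hill_potential_bound f c : Dplus2 f -> 1 / 2 < c ->
  ~ (\forall z \near (1 : R)^'-, c / (1 - z) ^+ 2 <= hill_potential f z).
Proof.
move=> Df2 c12 /near_left1P[a /andP[a0 a1] aP].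
have [r2 _] := rank_profile_Ck Df2; have [Df _] := Df2.
pose w := Num.sqrt (2 * c - 1).
have w0 : 0 < w by rewrite sqrtr_gt0; lra.
have w2 : w ^+ 2 = 2 * c - 1 by rewrite sqr_sqrtr; lra.
have r0 z : a < z < 1 -> rank_profile f z != 0.
  by move=> az; rewrite lt0r_neq0//; apply: quantile_supp => //; lra.
have d0 z : a < z < 1 ->
    is_derive z 1 (rank_profile f) ((rank_profile f)^`() z).
  move=> az; apply: (Ck_on_is_derive (k := 0) r2) => //=.
  by rewrite in_itv/=; lra.
have d1 z : a < z < 1 ->
    is_derive z 1 (rank_profile f)^`() ((rank_profile f)^`(2) z).
  move=> az; apply: (Ck_on_is_derive (k := 1) r2) => //=.
  by rewrite in_itv/=; lra.
have rU z : a < z < 1 -> c / (1 - z) ^+ 2 <=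
    - ((rank_profile f)^`(2) z / rank_profile f z)
    + ((rank_profile f)^`() z / rank_profile f z) ^+ 2 / 2.
  move=> az; rewrite -hill_potentialE//; last lra.
  exact: aP.
move: (rank_profile f) ((rank_profile f)^`()) ((rank_profile f)^`(2))
  r0 d0 d1 rU => r s t r0 d0 d1 rU.
pose k z := (1 - z) * (s z / r z) + 1.
pose G z := atan (k z / w) - w / 2 * ln (1 - z).
pose G' z := (1 + (k z / w) ^+ 2)^-1 *
  ((- (s z / r z) + (1 - z) * (t z / r z - (s z / r z) ^+ 2)) / w)
  + w / 2 / (1 - z).
have dG z : a < z < 1 -> is_derive z 1 G (G' z).
  move=> az; have rz := r0 z az.
  rewrite /G /k; derive_by ltac:(first [by rewrite subr_gt0; lra | solve [eauto]]).
  rewrite /G' /k; set A := (1 + _)^-1; field.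
  by rewrite rz (gt_eqF w0)/=; lra.
have G'0 z : a < z < 1 -> G' z <= 0.
  move=> az; have := rU z az; rewrite /G' /k.
  set h := s z / r z; set v := t z / r z => hv.
  have x0 : 0 < 1 - z by lra.
  move: (1 - z) x0 hv => x x0 hv.
  have xv : x * v <= x * h ^+ 2 / 2 - c / x.
    have : c / x <= x * (- v + h ^+ 2 / 2).
      by rewrite -(ler_pM2l x0) in hv; apply: le_trans hv; rewrite le_eqVlt;
        apply/orP; left; apply/eqP; field; lra.
    by lra.
  have kk : - h + x * (v - h ^+ 2) <= - (((x * h + 1) ^+ 2 + w ^+ 2) / (2 * x)).
    have -> : - (((x * h + 1) ^+ 2 + w ^+ 2) / (2 * x)) =
        - h - x * h ^+ 2 / 2 - c / x.
      by rewrite w2; field; lra.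
    by lra.
  have kw0 : 0 < (x * h + 1) ^+ 2 + w ^+ 2.
    by rewrite ltr_wpDl ?sqr_ge0// exprn_gt0.
  have -> : 1 + ((x * h + 1) / w) ^+ 2 = ((x * h + 1) ^+ 2 + w ^+ 2) / w ^+ 2.
    by field; rewrite gt_eqF.
  move: ((x * h + 1) ^+ 2 + w ^+ 2) kw0 kk => K K0 kk.
  rewrite invf_div -[leRHS](_ : w ^+ 2 / K * (- (K / (2 * x)) / w) + w / 2 / x = 0).
    rewrite lerD2r ler_pM2l; last by rewrite divr_gt0// exprn_gt0.
    by rewrite ler_pM2r// invr_gt0.
  by field; rewrite (gt_eqF w0) (gt_eqF K0) (gt_eqF x0).
pose z0 := (a + 1) / 2.
have z0a : a < z0 < 1 by rewrite /z0; lra.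
pose N := `|(G z0 + pi / 2) * 2 / w| + `|ln (1 - z0)| + 1.
pose z1 := 1 - expR (- N).
have z01 : z0 < z1.
  rewrite ltrBrDr -ltrBrDl -[ltRHS]lnK ?posrE; last lra.
  rewrite ltr_expR /N; have := ler_norm (- ln (1 - z0)).
  have := normr_ge0 ((G z0 + pi / 2) * 2 / w); rewrite normrN; lra.
have z11 : z1 < 1 by rewrite /z1 ltrBlDr ltrDl expR_gt0.
have GG : G z1 <= G z0.
  rewrite -lerN2; apply: (der_ge0_le (ltW z01) (f := fun z => - G z)
    (f' := fun z => - G' z)) => x xz; last by rewrite oppr_ge0 G'0//; lra.
  by apply: derN; apply: dG; lra.
have GN : G z1 = atan (k z1 / w) + w / 2 * N.
  by rewrite /G /z1 subKr expRK mulrN opprK.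
have wN : G z0 + pi / 2 < w / 2 * N.
  have -> : G z0 + pi / 2 = w / 2 * ((G z0 + pi / 2) * 2 / w).
    by field; rewrite gt_eqF.
  rewrite ltr_pM2l ?divr_gt0// /N.
  have := ler_norm ((G z0 + pi / 2) * 2 / w).
  have := normr_ge0 (ln (1 - z0)); lra.
have := atan_gtNpi2 (k z1 / w); lra.
Qed.

(** A limit c > 1/2 would keep (1 - z)^2 U above a constant between 1/2 and
    c. *)
Lemma right_weight_le f c : Dplus2 f -> right_weight (hill_potential f) c ->
  c <= 1 / 2.
Proof.
move=> Df2 fc; rewrite leNgt; apply/negP => c12.
pose c' := (c + 1 / 2) / 2.
have c'12 : 1 / 2 < c' by rewrite /c'; lra.
apply: (hill_potential_bound Df2 c'12); near=> z.
have z01 : 0 < z < 1 by near: z; exact: near_left1_in01.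
rewrite ler_pdivrMr ?exprn_gt0//; last lra.
rewrite mulrC ltW//; near: z.
by apply: (cvgr_gt _ fc); rewrite /c'; lra.
Unshelve. all: end_near. Qed.

End weight_bound.

(** * Slow variation from logarithmic derivatives *)

Section slow_variation.
Context {R : realType}.
Implicit Types (f h L : R -> R) (a b x y z s : R).

Lemma der_lipschitz h (h' : R -> R) (K : R) (D : set R) x y : is_interval D ->
  (forall t, D t -> is_derive t 1 h (h' t)) ->
  (forall t, D t -> `|h' t| <= K) -> D x -> D y ->
  `|h y - h x| <= K * `|y - x|.
Proof.
move=> itvD dh hK; wlog : x y / x <= y.
  move=> wl Dx Dy; case: (leP x y) => [xy|/ltW yx]; first exact: wl.
  by rewrite distrC [X in _ * X]distrC; exact: wl.
rewrite le_eqVlt => /predU1P[-> _ _|xy Dx Dy].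
  by rewrite !subrr normr0 mulr0.
have Dt t : x <= t <= y -> D t by exact: itvD.
have [c /andP[xc cy] ->] := mean_value xy (fun t xty => dh t (Dt t xty)).
by rewrite normrM ler_wpM2r// hK//; apply: Dt; rewrite !ltW.
Qed.

(** On a logarithmic scale s = e^t the derivative of ln L is s L' / L, so the
    mean value theorem turns s L' / L --> 0 into slow variation. *)
Lemma slowly_varying_of_index L M :
  (forall s, M < s -> 0 < L s /\ derivable L s 1) ->
  s * L^`() s / L s @[s --> +oo] --> (0 : R) -> slowly_varying L.
Proof.
move=> LM Lindex; split.
  by near=> s; apply LM; near: s; apply: nbhs_pinfty_gt; exact: num_real.
move=> a a0.
pose h t := ln (L (expR t)).
pose h' t := expR t * L^`() (expR t) / L (expR t).
have dh t : M < expR t -> is_derive t 1 h (h' t).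
  move=> /LM[L0 dL]; have dL' := der1P dL.
  rewrite /h /h'; derive_by ltac:(solve [eauto]).
  by field; rewrite gt_eqF.
have lnL : ln (L (a * s)) - ln (L s) @[s --> +oo] --> (0 : R).
  apply/cvgrPdist_le => e e0.
  have [e' e'0 e'E] : exists2 e', 0 < e' & e' * (1 + `|ln a|) <= e.
    have l1 : 0 < 1 + `|ln a| by rewrite ltr_wpDr.
    by exists (e / (1 + `|ln a|)); [rewrite divr_gt0 | rewrite divfK ?gt_eqF].
  have [N [_ NP]] : \forall s \near +oo, `|s * L^`() s / L s| <= e' /\ M < s.
    near=> s; split; last by near: s; apply: nbhs_pinfty_gt; exact: num_real.
    by near: s; apply: (cvgr0_norm_le _ Lindex).
  pose N' := Num.max N 1.
  have N'0 : 0 < N' by rewrite lt_max ltr01 orbT.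
  pose D : set R := [set t | ln N' < t].
  have DP t : D t -> N < expR t.
    rewrite /D/= -ltr_expR lnK ?posrE// => /(le_lt_trans _); apply.
    by rewrite le_max lexx.
  near=> s.
  have sN : N' < s by near: s; apply: nbhs_pinfty_gt; exact: num_real.
  have asN : N' < a * s.
    rewrite -ltr_pdivrMl//; near: s; apply: nbhs_pinfty_gt; exact: num_real.
  have s0 : 0 < s by exact: lt_trans sN.
  have as0 : 0 < a * s by rewrite mulr_gt0.
  rewrite sub0r normrN.
  have := @der_lipschitz h h' e' D (ln s) (ln (a * s)).
  rewrite /h !lnK ?posrE// => lip.
  apply: le_trans (lip _ _ _ _ _) _.
  - by move=> u v Du Dv w /andP[uw _]; exact: lt_le_trans uw.
  - by move=> t /DP/NP[_]; exact: dh.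
  - by move=> t /DP/NP[].
  - by rewrite /D/= ltr_ln ?posrE.
  - by rewrite /D/= ltr_ln ?posrE.
  rewrite lnM ?posrE// addrK; apply: le_trans e'E.
  by rewrite ler_pM2l// lerDr.
have : expR (ln (L (a * s)) - ln (L s)) @[s --> +oo] --> expR (0 : R).
  exact: (cvg_comp _ _ lnL (@continuous_expR R 0)).
rewrite expR0; apply: cvg_trans; apply: near_eq_cvg; near=> s.
have [Ls _] : 0 < L s /\ derivable L s 1.
  by apply: LM; near: s; apply: nbhs_pinfty_gt; exact: num_real.
have [Las _] : 0 < L (a * s) /\ derivable L (a * s) 1.
  apply: LM; rewrite -ltr_pdivrMl//.
  by near: s; apply: nbhs_pinfty_gt; exact: num_real.
by rewrite expRB !lnK.
Unshelve. all: end_near. Qed.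

Lemma near_pinfty_left1 (P : set R) : (\forall z \near (1 : R)^'-, P z) ->
  \forall s \near +oo, P (1 - s^-1).
Proof.
move=> /near_left1P[a /andP[a0 a1] aP]; exists (1 - a)^-1; split.
  exact: num_real.
move=> s as_; apply: aP.
have a0' : 0 < (1 - a)^-1 by rewrite invr_gt0; lra.
have s0 : 0 < s by exact: lt_trans as_.
have : s^-1 < 1 - a by rewrite -[ltRHS]invrK ltf_pV2 ?posrE.
have : 0 < s^-1 by rewrite invr_gt0.
by lra.
Qed.

Lemma cvg_pinfty_left1 (g : R -> R) (l : R) :
  g z @[z --> (1 : R)^'-] --> l -> g (1 - s^-1) @[s --> +oo] --> l.
Proof.
move=> /cvgrPdist_lt gl; apply/cvgrPdist_lt => e e0.
exact: near_pinfty_left1 (gl e e0).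
Qed.

(** Conversely to the computation of the weight, limits of the first two
    logarithmic derivatives of the rank profile at the values of an exact power
    make L (s) = r (1 - 1/s) s^b smoothly slowly varying. *)
Lemma right_profile_of_index f b : Dplus2 f ->
  (1 - z) * (rank_profile f)^`() z / rank_profile f z
    @[z --> (1 : R)^'-] --> - b ->
  (1 - z) ^+ 2 * (rank_profile f)^`(2) z / rank_profile f z
    @[z --> (1 : R)^'-] --> b ^+ 2 - b ->
  exists L, right_profile f (b / 2) L.
Proof.
move=> Df2 /(cvg_pinfty_left1 (g := fun z => _)) c1.
move=> /(cvg_pinfty_left1 (g := fun z => _)) c2.
have [r2 _] := rank_profile_Ck Df2; have [Df _] := Df2.
have s01 s : 1 < s -> 0 < 1 - s^-1 < 1.
  move=> s1; have s0 : 0 < s by exact: lt_trans s1.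
  have : s^-1 < 1 by rewrite invf_lt1.
  have : 0 < s^-1 by rewrite invr_gt0.
by lra.
have r0 s : 1 < s -> 0 < rank_profile f (1 - s^-1).
  by move=> /s01; exact: quantile_supp.
have d0 s : 1 < s -> is_derive (1 - s^-1) 1 (rank_profile f)
    ((rank_profile f)^`() (1 - s^-1)).
  by move=> /s01 s1; apply: (Ck_on_is_derive (k := 0) r2).
have d1 s : 1 < s -> is_derive (1 - s^-1) 1 (rank_profile f)^`()
    ((rank_profile f)^`(2) (1 - s^-1)).
  by move=> /s01 s1; apply: (Ck_on_is_derive (k := 1) r2).
have d2 s : 1 < s -> {for 1 - s^-1, continuous (rank_profile f)^`(2)}.
  by move=> /s01 s1; apply: (Ck_on_continuous r2).
rewrite /right_profile.
move: (rank_profile f) ((rank_profile f)^`()) ((rank_profile f)^`(2))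
  c1 c2 r0 d0 d1 d2 => r r1 r2' c1 c2 r0 d0 d1 d2.
pose w s : R := 1 - s^-1; pose P s : R := s `^ b.
have dw s : 1 < s -> is_derive s 1 w (s^-1 ^+ 2).
  by move=> s1; rewrite /w; derive_by ltac:(lra); field; lra.
have di s : 1 < s -> is_derive s 1 (fun s => s^-1) (- s^-1 ^+ 2).
  by move=> s1; derive_by ltac:(lra); field; lra.
have P0 s : 1 < s -> 0 < P s by move=> s1; apply: powR_gt0; lra.
have dP s : 1 < s -> is_derive s 1 P (b * P s * s^-1).
  move=> s1; rewrite /P; derive_by ltac:(lra).
  by rewrite powR_pred; lra.
pose L s : R := r (w s) * P s.
pose L1 s : R := P s * (r1 (w s) * s^-1 ^+ 2 + b * s^-1 * r (w s)).
pose L2 s : R := P s * (r2' (w s) * s^-1 ^+ 4 +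
  (2 * b - 2) * s^-1 ^+ 3 * r1 (w s) + (b ^+ 2 - b) * s^-1 ^+ 2 * r (w s)).
have E s : `]1, +oo[%classic s <-> 1 < s by rewrite /= in_itv/= andbT.
have [||s /E s1|s /E s1|s /E s1|CL LE] :=
  @Ck_on2 R `]1, +oo[%classic L L L1 L2.
- exact: interval_open.
- by [].
- have := d0 s s1; rewrite -/(w s) => dr0.
  by rewrite /L /L1; derive_by ltac:(solve [eauto]); ring.
- have := d0 s s1; rewrite -/(w s) => dr0.
  have := d1 s s1; rewrite -/(w s) => dr1.
  have s0 : s != 0 by lra.
  by rewrite /L1 /L2; derive_by ltac:(solve [eauto]); rewrite /=; field.
- have cw := der_cont (dw s s1); have ci := der_cont (di s s1).
  have cr (h : R -> R) : {for w s, continuous h} ->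
    h (w y) @[y --> s] --> h (w s) by move=> ch; apply: continuous_comp.
  have c0 := cr _ (der_cont (d0 s s1)).
  have c1' := cr _ (der_cont (d1 s s1)).
  have c2' := cr _ (d2 s s1).
  have cX n : y^-1 ^+ n @[y --> s] --> s^-1 ^+ n.
    exact: (cvg_comp _ _ ci (@exprn_continuous _ n _)).
  apply: cvgM; first exact: der_cont (dP s s1).
  apply: cvgD; first apply: cvgD; apply: cvgM => //.
  + by apply: cvgM => //; exact: cvg_cst.
  + by apply: cvgM => //; exact: cvg_cst.
have rw0 s : 1 < s -> r (w s) != 0 by move=> /r0/lt0r_neq0.
have l1 : s * L^`() s / L s @[s --> +oo] --> (0 : R).
  have : (1 - (1 - s^-1)) * r1 (1 - s^-1) / r (1 - s^-1) + b
      @[s --> +oo] --> - b + b by apply: cvgD => //; exact: cvg_cst.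
  rewrite addNr; apply: cvg_trans; apply: near_eq_cvg; near=> s.
  have s1 : 1 < s by near: s; apply: nbhs_pinfty_gt; exact: num_real.
  have [-> _] := LE s (proj2 (E s) s1); rewrite /L1 /L -/(w s) subKr.
  by field; rewrite (gt_eqF (P0 s s1)) rw0//=; lra.
have l2 : s ^+ 2 * L^`(2) s / L s @[s --> +oo] --> (0 : R).
  have : (1 - (1 - s^-1)) ^+ 2 * r2' (1 - s^-1) / r (1 - s^-1)
      + (2 * b - 2) * ((1 - (1 - s^-1)) * r1 (1 - s^-1) / r (1 - s^-1))
      + (b ^+ 2 - b) @[s --> +oo] -->
      (b ^+ 2 - b) + (2 * b - 2) * (- b) + (b ^+ 2 - b).
    apply: cvgD; last exact: cvg_cst.
    by apply: cvgD => //; apply: cvgM => //; exact: cvg_cst.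
  rewrite [X in _ --> X](_ : _ = 0); last by ring.
  apply: cvg_trans; apply: near_eq_cvg; near=> s.
  have s1 : 1 < s by near: s; apply: nbhs_pinfty_gt; exact: num_real.
  have [_ ->] := LE s (proj2 (E s) s1); rewrite /L2 /L -/(w s) subKr.
  by field; rewrite (gt_eqF (P0 s s1)) rw0//=; lra.
exists L; split.
  split; [|by exists 1|].
    apply: (@slowly_varying_of_index L 1) => // s s1; split.
      by rewrite mulr_gt0 ?P0//; exact: r0.
    exact: ((CL s (proj2 (E s) s1)).1 0%N isT).
  move=> k k12; have [->|->] : k = 1%N \/ k = 2%N.
    by move: k k12 {dw di dP} => [|[|[|]]]; [|left|right|].
  - by rewrite derive1n1; under eq_fun do rewrite expr1.
  - exact: l2.
near=> z.
have z01 : 0 < z < 1 by near: z; exact: near_left1_in01.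
rewrite /L /w /P div1r invrK subKr [2 * _]mulrC divfK//.
rewrite mulrCA -powRM; [|lra|by rewrite invr_ge0; lra].
by rewrite divff ?powR1 ?mulr1//; lra.
Unshelve. all: end_near. Qed.

End slow_variation.

(** * The von Mises condition, power and exponential tails *)

Section von_mises.
Context {R : realType}.
Implicit Types (f : R -> R) (m p c x y z : R).

Lemma near_pinftyP (P : set R) : (\forall x \near +oo, P x) ->
  exists a, forall x, a < x -> P x.
Proof. by move=> [a [_ aP]]; exists a. Qed.

Lemma near_pinfty_gt a : \forall x \near +oo, (a : R) < x.
Proof. by apply: nbhs_pinfty_gt; exact: num_real. Qed.

Lemma cvg_ccdf f : prob_density f -> 1 - cdf_of f x @[x --> +oo] --> (0 : R).
Proof.
move=> df; apply/cvgrPdist_lt => e e0.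
have [|a aP] := cdf_of_gt df (z := 1 - e); first by lra.
near=> x; have ax : a <= x by apply: ltW; near: x; exact: near_pinfty_gt.
have := cdf_of_nd df ax; have := cdf_of_le1 x df => Fx1 Fx.
by rewrite sub0r normrN ger0_norm; lra.
Unshelve. all: end_near. Qed.

(** A density with unbounded support on the right cannot dominate e / (x + C),
    whose primitive is unbounded. *)
Lemma density_lt_harmonic f a e C : Dplus f -> 0 < e -> 0 < a + C ->
  (forall x, a <= x -> 0 < f x) -> exists2 x, a <= x & f x < e / (x + C).
Proof.
move=> Df e0 aC fa; apply: contrapT => nex.
have fe x : a <= x -> e / (x + C) <= f x.
  by move=> ax; rewrite leNgt; apply/negP => fx; apply: nex; exists x.
have [df _ _ _] := Dplus_support Df.
pose y := expR ((1 + e * ln (a + C)) / e) - C + `|a| + `|C| + 1.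
have e1 := expR_gt0 ((1 + e * ln (a + C)) / e).
have ay : a <= y.
  by rewrite /y; have := ler_norm a; have := ler_norm C; lra.
have : cdf_of f a - e * ln (a + C) <= cdf_of f y - e * ln (y + C).
  apply: (der_ge0_le ay (f := fun x => cdf_of f x - e * ln (x + C))
    (f' := fun x => f x - e / (x + C))) => x /andP[ax _].
    have dF := cdf_of_der Df (fa x ax).
    by derive_by ltac:(first [lra | solve [eauto]]); field; lra.
  by rewrite subr_ge0 fe.
have yC : expR ((1 + e * ln (a + C)) / e) < y + C.
  by rewrite /y; have := normr_ge0 a; have := ler_norm (- C); have := normr_ge0 C;
     lra.
have : (1 + e * ln (a + C)) / e < ln (y + C).
  by rewrite -ltr_expR lnK// posrE; exact: lt_trans yC.
rewrite ltr_pdivrMr// [ln _ * e]mulrC.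
by have := cdf_of_ge0 a df; have := cdf_of_le1 y df; lra.
Qed.

Section asymptotics.
Variables (f : R -> R) (m : R).
Hypothesis Df2 : Dplus2 f.
Hypothesis m02 : 0 < m < 2.
Hypothesis fm : f x * f^`(2) x / f^`() x ^+ 2 @[x --> +oo] --> m.

Let Df : Dplus f := Df2.1.
Let df : prob_density f := Df2.1.1.

(** A positive limit forces f'' > 0.  So f' is increasing, and if it were
    positive somewhere then f would be bounded below by a positive constant. *)
Lemma von_mises_signs : exists a, forall x, a < x ->
  [/\ 0 < f x, f^`() x < 0 & f x * f^`(2) x / f^`() x ^+ 2 < 2].
Proof.
have /andP[m0 m2] := m02.
have /near_pinftyP[a aP] : \forall x \near +oo,
    0 < f x * f^`(2) x / f^`() x ^+ 2 < 2.
  near=> x; apply/andP; split; near: x.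
  - exact: (cvgr_gt _ fm).
  - exact: (cvgr_lt _ fm).
have fpos x : a < x -> [/\ 0 < f x, f^`() x != 0 & 0 < f^`(2) x].
  move=> /aP/andP[q0 _].
  have f'0 : f^`() x != 0.
    by apply: contraTneq q0 => ->; rewrite expr0n/= invr0 mulr0 ltxx.
  have fx : 0 < f x.
    rewrite lt0r; apply/andP; split; last by case: df.
    by apply: contraTneq q0 => ->; rewrite !mul0r ltxx.
  split => //; move: q0; rewrite pmulr_lgt0 ?invr_gt0 ?exprn_even_gt0//.
  by rewrite pmulr_rgt0.
have d0 x : a < x -> is_derive x 1 f (f^`() x).
  by move=> /fpos[fx _ _]; exact: (Ck_on_is_derive (k := 0) Df2.2).
have d1 x : a < x -> is_derive x 1 f^`() (f^`(2) x).
  by move=> /fpos[fx _ _]; exact: (Ck_on_is_derive (k := 1) Df2.2).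
exists a => x ax; have /andP[_ q2] := aP x ax; have [fx f'x _] := fpos x ax.
split => //; rewrite lt_neqAle f'x/= leNgt; apply/negP => f'x0.
have incr y : x <= y -> f x <= f y.
  move=> xy; apply: (der_ge0_le xy) => t /andP[xt _].
    exact: d0 (lt_le_trans ax xt).
  apply: (le_trans (ltW f'x0)); apply: (der_ge0_le xt) => u /andP[xu _].
    exact: d1 (lt_le_trans ax xu).
  by have [_ _ /ltW] := fpos u (lt_le_trans ax xu).
have fy y : x <= y -> 0 < f y by move=> /incr; exact: lt_le_trans.
pose C := `|x| + 1.
have xC : 0 < x + C by rewrite /C; have := ler_norm (- x); rewrite normrN; lra.
have [y xy] := density_lt_harmonic Df (mulr_gt0 fx xC) xC fy.
rewrite ltNge => /negP; apply; apply: le_trans (incr y xy).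
by rewrite ler_pdivrMr ?ler_pM2l//; lra.
Unshelve. all: end_near. Qed.

Lemma von_mises_dT x : 0 < f x -> f^`() x < 0 ->
  is_derive x 1 (fun y => f y ^+ 2 / f^`() y)
    (f x * (2 - f x * f^`(2) x / f^`() x ^+ 2)).
Proof.
move=> fx f'x.
have d0 : is_derive x 1 f (f^`() x).
  exact: (Ck_on_is_derive (k := 0) Df2.2).
have d1 : is_derive x 1 f^`() (f^`(2) x).
  exact: (Ck_on_is_derive (k := 1) Df2.2).
have f'0 : f^`() x != 0 by rewrite lt_eqF.
move: (f^`()) (f^`(2)) d0 d1 f'0 => f1 f2 d0 d1 f'0.
by derive_by ltac:(solve [eauto]); rewrite /=; field.
Qed.

(** This function is negative and increasing.  If it stayed below - e, then
    (1 / f)' <= 1 / e, and f would dominate e / (x + C). *)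
Lemma von_mises_T0 : f x ^+ 2 / f^`() x @[x --> +oo] --> (0 : R).
Proof.
have [a aP] := von_mises_signs.
have dT x : a < x -> is_derive x 1 (fun y => f y ^+ 2 / f^`() y)
    (f x * (2 - f x * f^`(2) x / f^`() x ^+ 2)).
  by move=> /aP[fx f'x _]; exact: von_mises_dT.
have T0 x : a < x -> f x ^+ 2 / f^`() x < 0.
  by move=> /aP[fx f'x _]; rewrite pmulr_rlt0 ?exprn_gt0// invr_lt0.
have Tincr x y : a < x -> x <= y ->
    f x ^+ 2 / f^`() x <= f y ^+ 2 / f^`() y.
  move=> ax xy; apply: (der_ge0_le xy (f := fun y => f y ^+ 2 / f^`() y)) =>
    t /andP[xt _].
    exact: dT (lt_le_trans ax xt).
  have [ft _ q2] := aP t (lt_le_trans ax xt).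
  by rewrite mulr_ge0 ?ltW// subr_gt0.
apply/cvgrPdist_lt => e e0.
suff [b ab be] : exists2 b, a < b & - e < f b ^+ 2 / f^`() b.
  near=> x; have bx : b < x by near: x; exact: near_pinfty_gt.
  have Tx := T0 x (lt_trans ab bx); have Tbx := Tincr b x ab (ltW bx).
  by rewrite sub0r normrN ltr0_norm; lra.
apply: contrapT => nb.
pose b := a + 1; have ab : a < b by rewrite /b; lra.
have Te x : b <= x -> f x ^+ 2 / f^`() x <= - e.
  move=> bx; rewrite leNgt; apply/negP => Tx; apply: nb.
  by exists x => //; exact: lt_le_trans bx.
have fb : 0 < f b by have [] := aP b ab.
have fpos x : b <= x -> 0 < f x.
  by move=> bx; have [] := aP x (lt_le_trans ab bx).
pose C := e / f b - b.
have bC : 0 < b + C by rewrite /C addrC subrK divr_gt0.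
have [x bx] := density_lt_harmonic Df e0 bC fpos.
rewrite ltNge => /negP; apply.
have xC : 0 < x + C by lra.
have : (f x)^-1 - x / e <= (f b)^-1 - b / e.
  rewrite -lerN2; apply: (der_ge0_le bx (f := fun y => - ((f y)^-1 - y / e))
    (f' := fun y => f^`() y / f y ^+ 2 + e^-1)) => t /andP[bt _].
    have ft : f t != 0 by rewrite lt0r_neq0// fpos.
    have d0 : is_derive t 1 f (f^`() t).
      by apply: (Ck_on_is_derive (k := 0) Df2.2) => //; exact: fpos.
    by derive_by ltac:(solve [eauto]); field; rewrite ft gt_eqF.
  have [ft f't _] := aP t (lt_le_trans ab bt).
  have Te' : e <= - (f t ^+ 2 / f^`() t) by have := Te t bt; lra.
  move: Te'; rewrite -lef_pV2 ?posrE ?oppr_gt0 ?T0 ?(lt_le_trans ab)//.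
  by rewrite invrN invf_div; lra.
have -> : (f b)^-1 = (b + C) / e.
  by rewrite /C addrC subrK mulrC mulKf// gt_eqF.
rewrite lerBlDr -addrA [X in _ + X](_ : _ = (x - b) / e); last by ring.
rewrite -mulrDl [X in X / e](_ : _ = x + C); last by ring.
by rewrite -[leRHS]invrK lef_pV2 ?posrE ?invr_gt0 ?divr_gt0 ?fpos// invf_div.
Unshelve. all: end_near. Qed.

(** A monotone form of l'Hopital's rule: the derivatives of f^2 / f' and of
    1 - F have the quotient - (2 - f f'' / f'^2), and both functions vanish at
    infinity. *)
Lemma von_mises_ccdf :
  (1 - cdf_of f x) * f^`() x / f x ^+ 2 @[x --> +oo] --> - (2 - m)^-1.
Proof.
have /andP[m0 m2] := m02; have [a aP] := von_mises_signs.
have dT x : a < x -> is_derive x 1 (fun y => f y ^+ 2 / f^`() y)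
    (f x * (2 - f x * f^`(2) x / f^`() x ^+ 2)).
  by move=> /aP[fx f'x _]; exact: von_mises_dT.
have F1 x : a < x -> 0 < 1 - cdf_of f x.
  by move=> /aP[fx _ _]; have := cdf_of_itv Df fx; lra.
pose V x : R := - (f x ^+ 2 / f^`() x) / (1 - cdf_of f x).
have Vm : V x @[x --> +oo] --> 2 - m.
  apply/cvgrPdist_le => e e0.
  have /near_pinftyP[b bP] : \forall x \near +oo,
      `|m - f x * f^`(2) x / f^`() x ^+ 2| <= e /\ a < x.
    near=> x; split; last by near: x; exact: near_pinfty_gt.
    by near: x; move/cvgrPdist_le : fm; exact.
  (* s T + k (1 - F), with T = f^2 / f', is nondecreasing with limit 0, hence
     nonpositive; s = 1 and s = - 1 give the two bounds on V *)
  have tozero (s k : R) : (forall x, b < x ->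
      0 <= s * (f x * (2 - f x * f^`(2) x / f^`() x ^+ 2)) - k * f x) ->
    forall x, b < x -> s * (f x ^+ 2 / f^`() x) + k * (1 - cdf_of f x) <= 0.
    move=> sk x bx.
    have lim0 : s * (f x ^+ 2 / f^`() x) + k * (1 - cdf_of f x)
        @[x --> +oo] --> s * 0 + k * 0.
      apply: cvgD.
        by apply: cvgM; [exact: cvg_cst | exact: von_mises_T0].
      by apply: cvgM; [exact: cvg_cst | exact: cvg_ccdf df].
    rewrite !mulr0 addr0 in lim0; rewrite -(cvg_lim _ lim0)//.
    apply: limr_ge; first by apply/cvg_ex; exists 0.
    near=> y; have xy : x <= y by apply: ltW; near: y; exact: near_pinfty_gt.
    apply: (der_ge0_le xy (f := fun x =>
      s * (f x ^+ 2 / f^`() x) + k * (1 - cdf_of f x)) (f' := fun x =>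
      s * (f x * (2 - f x * f^`(2) x / f^`() x ^+ 2)) - k * f x)) => t /andP[xt _].
      have bt : b < t by exact: lt_le_trans xt.
      have [_ a_t] := bP t bt; have [ft _ _] := aP t a_t.
      have dFt := cdf_of_der Df ft.
      have dsT T T' : is_derive t 1 T T' ->
          is_derive t 1 (fun x => s * T x + k * (1 - cdf_of f x)) (s * T' - k * f t).
        by move=> dTt; derive_by ltac:(solve [eauto]); ring.
      exact: dsT (dT t a_t).
    by apply: sk; exact: lt_le_trans xt.
  near=> x; have bx : b < x by near: x; exact: near_pinfty_gt.
  have [_ ax] := bP x bx; have F1x := F1 x ax.
  have up : (- 1) * (f x ^+ 2 / f^`() x) + (- (2 - m + e)) * (1 - cdf_of f x) <= 0.
    apply: tozero => // y by_; have [+ ay] := bP y by_.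
    have [fy _ _] := aP y ay.
    set q := f y * _ / _; rewrite ler_norml => /andP[q1 q2].
    rewrite [leRHS](_ : _ = f y * (q - (m - e))); last by ring.
    by apply: mulr_ge0; [exact: ltW | lra].
  have lo : 1 * (f x ^+ 2 / f^`() x) + (2 - m - e) * (1 - cdf_of f x) <= 0.
    apply: tozero => // y by_; have [+ ay] := bP y by_.
    have [fy _ _] := aP y ay.
    set q := f y * _ / _; rewrite ler_norml => /andP[q1 q2].
    rewrite [leRHS](_ : _ = f y * (m + e - q)); last by ring.
    by apply: mulr_ge0; [exact: ltW | lra].
  have V1 : V x <= 2 - m + e by rewrite /V ler_pdivrMr//; lra.
  have V2 : 2 - m - e <= V x by rewrite /V ler_pdivlMr//; lra.
  by rewrite ler_norml; lra.
have : - (V x)^-1 @[x --> +oo] --> - (2 - m)^-1.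
  by apply: cvgN; apply: cvgV => //; rewrite gt_eqF//; lra.
apply: cvg_trans; apply: near_eq_cvg; near=> x.
have ax : a < x by near: x; exact: near_pinfty_gt.
have [fx f'x _] := aP x ax; have F1x := F1 x ax.
rewrite /V; field.
by rewrite (gt_eqF fx) (lt_eqF f'x) (gt_eqF F1x).
Unshelve. all: end_near. Qed.

Lemma near_quantile (P : set R) : (\forall x \near +oo, P x) ->
  \forall z \near (1 : R)^'-, P (quantile f z).
Proof.
have [a aP] := von_mises_signs; move=> [M [_ MP]].
pose b := Num.max a M + 1.
have ab : a < b by rewrite /b ltr_pwDr// le_max lexx.
have Mb : M < b by rewrite /b ltr_pwDr// le_max lexx orbT.
have [fb _ _] := aP b ab; have /andP[F0 F1] := cdf_of_itv Df fb.
apply/near_left1P; exists (cdf_of f b); first by rewrite ltW.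
move=> z /andP[Fz z1]; apply: MP; apply: (lt_trans Mb).
have z01 : 0 < z < 1 by rewrite z1 (lt_trans F0).
rewrite ltNge; apply/negP => /(cdf_of_nd df).
by rewrite cdf_of_quantile// leNgt Fz.
Qed.

Lemma cvg_quantile (g : R -> R) (l : R) : g x @[x --> +oo] --> l ->
  g (quantile f z) @[z --> (1 : R)^'-] --> l.
Proof.
move=> /cvgrPdist_lt gl; apply/cvgrPdist_lt => e e0.
exact: near_quantile (gl e e0).
Qed.

(** With b = 1 / (2 - m), the quotient (1 - z)^2 r'' / r is the square of
    (1 - F) f' / f^2 times f f'' / f'^2 - 1, so it tends to
    b^2 (m - 1) = b^2 - b. *)
Lemma right_profile_of_von_mises :
  exists L, right_profile f ((2 - m)^-1 / 2) L.
Proof.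
have /andP[m0 m2] := m02; have [a aP] := von_mises_signs.
have Q1 := cvg_quantile von_mises_ccdf; have Qq := cvg_quantile fm.
have [_ rE] := rank_profile_Ck Df2.
apply: right_profile_of_index => //.
- move: Q1; apply: cvg_trans; apply: near_eq_cvg; near=> z.
  have z01 : 0 < z < 1 by near: z; exact: near_left1_in01.
  have [-> _] := rE z z01; rewrite cdf_of_quantile// /rank_profile.
  by field; rewrite lt0r_neq0//; exact: quantile_supp.
- have Qfpos : \forall z \near (1 : R)^'-,
      0 < f (quantile f z) /\ f^`() (quantile f z) < 0.
    apply: (near_quantile (P := fun x => 0 < f x /\ f^`() x < 0)).
    near=> x; have [|fx f'x _] := aP x; last by [].
    by near: x; exact: near_pinfty_gt.
  have : ((1 - cdf_of f (quantile f z)) * f^`() (quantile f z)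
       / f (quantile f z) ^+ 2) * ((1 - cdf_of f (quantile f z))
       * f^`() (quantile f z) / f (quantile f z) ^+ 2) *
      (f (quantile f z) * f^`(2) (quantile f z) / f^`() (quantile f z) ^+ 2 - 1)
    @[z --> (1 : R)^'-] --> - (2 - m)^-1 * - (2 - m)^-1 * (m - 1).
    by apply: cvgM; [exact: cvgM | apply: cvgB => //; exact: cvg_cst].
  rewrite [X in _ --> X](_ : _ = (2 - m)^-1 ^+ 2 - (2 - m)^-1); last first.
    by field; lra.
  apply: cvg_trans; apply: near_eq_cvg; near=> z.
  have z01 : 0 < z < 1 by near: z; exact: near_left1_in01.
  have [q0 f'0] : 0 < f (quantile f z) /\ f^`() (quantile f z) < 0.
    by near: z; exact: Qfpos.
  have [_ ->] := rE z z01; rewrite cdf_of_quantile// /rank_profile.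
  by field; rewrite (gt_eqF q0) (lt_eqF f'0).
Unshelve. all: end_near. Qed.

End asymptotics.

(** The three asymptotics of a power tail give the von Mises limit
    m = (p + 1) / p. *)
Lemma right_profile_power_tail f p c0 : Dplus2 f -> 1 < p -> 0 < c0 ->
  power_tail f p c0 -> exists L, right_profile f (p / (2 * (p - 1))) L.
Proof.
move=> Df2 p1 c00 pt.
have p0 : p != 0 by lra.
have m02 : 0 < (p + 1) / p < 2.
  by rewrite divr_gt0 ?ltr_pdivrMr//; lra.
have fm : f x * f^`(2) x / f^`() x ^+ 2 @[x --> +oo] --> (p + 1) / p.
  have t0 := pt 0%N isT; have t1 := pt 1%N isT; have t2 := pt 2%N isT.
  pose d j x := (- 1) ^+ j * rising p j * c0 * x `^ (- p - j%:R).
  have : (p + 1) / p * ((f^`(0) x / d 0%N x) * (f^`(2) x / d 2%N x) /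
      ((f^`(1) x / d 1%N x) * (f^`(1) x / d 1%N x))) @[x --> +oo]
      --> (p + 1) / p * (1 * 1 / (1 * 1)).
    apply: cvgM; first exact: cvg_cst.
    apply: cvgM; first exact: cvgM.
    by apply: cvgV; [rewrite mulr1 oner_neq0 | exact: cvgM].
  rewrite mulr1 divr1 mulr1; apply: cvg_trans; apply: near_eq_cvg; near=> x.
  have x0 : 0 < x by near: x; exact: near_pinfty_gt.
  have inv_div (u v : R) : (u / v * (u / v))^-1 = v ^+ 2 * (u ^+ 2)^-1.
    by rewrite -expr2 expr_div_n invf_div.
  rewrite inv_div derive1n0 derive1n1; move: (f^`() x ^+ 2)^-1 => i.
  rewrite /d /rising big_ord0 !big_ord_recr !big_ord0/=.
  rewrite (_ : - p - 2 = - p - 1 - 1); last by lra.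
  rewrite subr0 !powR_pred//.
  have := powR_gt0 (- p) x0; move: (x `^ (- p)) => X X0.
  by field; rewrite p0 (gt_eqF X0) (gt_eqF c00) (gt_eqF x0)/=; lra.
have [L] := right_profile_of_von_mises Df2 m02 fm.
have -> : (2 - (p + 1) / p)^-1 / 2 = p / (2 * (p - 1)) by field; lra.
by exists L.
Unshelve. all: end_near. Qed.

Lemma right_profile_exponential_tail f : Dplus2 f -> exponential_tail f ->
  exists L, right_profile f (1 / 2) L.
Proof.
move=> Df2 [_ fm].
have m02 : 0 < (1 : R) < 2 by lra.
have [L] := right_profile_of_von_mises Df2 m02 fm.
have -> : (2 - 1 : R)^-1 / 2 = 1 / 2 by field; lra.
by exists L.
Qed.

End von_mises.

(** * Distortions with bounded derivatives *)

Section tame_distortions.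
Context {R : realType}.
Implicit Types (f A B U : R -> R) (c x y z w : R).

(** What the invariance of the weights uses of a distortion, read off on the open
    interval only.  Both the distortions smooth up to the boundary and the maps
    generated by the flow of a kernel have these properties. *)
Definition tame A :=
  [/\ Ck_on 3 `]0, 1[ A,
      (forall z, 0 < z < 1 -> 0 < A z < 1),
      (forall w, 0 < w < 1 -> exists2 z, 0 < z < 1 & A z = w) &
      exists c C : R, 0 < c /\ forall z, 0 < z < 1 ->
        [/\ c <= A^`() z, `|A^`(2) z| <= C & `|A^`(3) z| <= C]].

Lemma in01E z : `]0, 1[%classic z <-> 0 < z < 1.
Proof. by rewrite /= in_itv. Qed.

Lemma tame_der A z : tame A -> 0 < z < 1 ->
  [/\ is_derive z 1 A (A^`() z), is_derive z 1 A^`() (A^`(2) z) &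
      is_derive z 1 A^`(2) (A^`(3) z)].
Proof.
move=> [CA _ _ _] /in01E z01; split.
- exact: (Ck_on_is_derive (k := 0) CA).
- exact: (Ck_on_is_derive (k := 1) CA).
- exact: (Ck_on_is_derive (k := 2) CA).
Qed.

Lemma tame_incr A y z : tame A -> 0 < y -> y < z -> z < 1 -> A y < A z.
Proof.
move=> tA y0 yz z1; have [_ _ _ [c [C [c0 cC]]]] := tA.
apply: (der_gt0_lt yz (f' := A^`())) => t tyz.
  by have [] := @tame_der A t tA; first by lra.
by have [|cA _ _] := cC t; [lra | exact: lt_le_trans cA].
Qed.

Lemma tame_near A (P : set R) : tame A ->
  (\forall z \near (1 : R)^'-, P (A z)) <-> \forall w \near (1 : R)^'-, P w.
Proof.
move=> tA; have [_ A01 Aonto _] := tA.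
split=> /near_left1P[a /andP[a0 a1] aP].
- pose b := (a + 1) / 2; have b01 : 0 < b < 1 by rewrite /b; lra.
  have /andP[Ab0 Ab1] := A01 b b01.
  apply/near_left1P; exists (A b); first by rewrite ltW.
  move=> w /andP[Aw w1]; have [|z z01 zw] := Aonto w; first by lra.
  rewrite -zw; apply: aP; have /andP[z0 ->] := z01; rewrite andbT.
  rewrite ltNge; apply/negP => za.
  have : A z < A b by apply: tame_incr => //; rewrite /b; lra.
  by rewrite zw; lra.
- pose b := (a + 1) / 2; have b01 : 0 < b < 1 by rewrite /b; lra.
  have [y y01 yb] := Aonto b b01.
  apply/near_left1P; exists y; first lra.
  move=> z /andP[yz z1]; apply: aP.
  have : A y < A z by apply: tame_incr => //; lra.
  have := A01 z; rewrite yb /b; lra.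
Qed.

Lemma cvg_left1_id : z @[z --> (1 : R)^'-] --> (1 : R).
Proof. by apply: cvg_at_left_filter; exact: cvg_id. Qed.

Lemma cvg_tame1 A : tame A -> A z @[z --> (1 : R)^'-] --> (1 : R).
Proof.
move=> tA; apply/cvgrPdist_lt => e e0.
apply/(tame_near (fun w => `|1 - w| < e) tA).
by move/cvgrPdist_lt : cvg_left1_id; exact.
Qed.

(** The two expansions of A at the right endpoint follow from the mean value
    theorem on [z, y] by letting y tend to 1. *)
Lemma tame_expansion A : tame A -> exists c C : R, 0 < c /\
  forall z, 0 < z < 1 -> c * (1 - z) <= 1 - A z /\
    `|1 - A z - A^`() z * (1 - z)| <= C * (1 - z) ^+ 2.
Proof.
move=> tA; have [_ A01 _ [c [C [c0 cC]]]] := tA.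
exists c, C; split=> // z z01.
have cy : y - z @[y --> (1 : R)^'-] --> 1 - z.
  by apply: cvgB; [exact: cvg_left1_id | exact: cvg_cst].
have cAy : A y - A z @[y --> (1 : R)^'-] --> 1 - A z.
  by apply: cvgB; [exact: cvg_tame1 | exact: cvg_cst].
have mv y : z < y < 1 -> exists2 x, z < x < y & A y - A z = A^`() x * (y - z).
  move=> /andP[zy y1].
  have d0 t : z <= t <= y -> is_derive t 1 A (A^`() t).
    by move=> tzy; have [|dA _ _] := @tame_der A t tA; first by lra.
  exact: (mean_value zy d0).
have zP : \forall y \near (1 : R)^'-, z < y < 1.
  by apply/near_left1P; exists z => //; lra.
have C0 : 0 <= C by have [_ A2C _] := cC z z01; exact: le_trans (normr_ge0 _) A2C.
split.
- apply: (@ler_cvg_to _ _ (at_left_proper_filter 1) R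
    (fun y => c * (y - z)) _ _ _ _ cAy).
    by apply: cvgM => //; exact: cvg_cst.
  near=> y; have zy : z < y < 1 by near: y.
  have [x xzy ->] := mv y zy; rewrite ler_pM2r ?subr_gt0; last by lra.
  by have [] := cC x; first by lra.
- apply: (@ler_cvg_to _ _ (at_left_proper_filter 1) R
    (fun y => `|A y - A z - A^`() z * (y - z)|)
    (fun y => C * (1 - z) * (y - z))).
  + apply: cvg_norm; apply: cvgB => //; apply: cvgM => //; exact: cvg_cst.
  + by rewrite expr2 mulrA; apply: cvgM => //; exact: cvg_cst.
  + near=> y; have zy : z < y < 1 by near: y.
    have [x xzy ->] := mv y zy; rewrite -mulrBl normrM.
    rewrite [`|y - z|]gtr0_norm; last by lra.
    rewrite ler_pM2r; last by lra.
    have /andP[zx xy] := xzy.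
    have [t ztx ->] : exists2 t, z < t < x &
        A^`() x - A^`() z = A^`(2) t * (x - z).
      have d1 t : z <= t <= x -> is_derive t 1 A^`() (A^`(2) t).
        by move=> tzx; have [|_ dA _] := @tame_der A t tA; first by lra.
      exact: (mean_value zx d1).
    have [|_ A2 _] := cC t; first by lra.
    rewrite normrM; apply: ler_pM => //.
    by rewrite gtr0_norm; lra.
Unshelve. all: end_near. Qed.

(** Up to a bounded Schwarzian term, the coadjoint action multiplies
    (1 - A z)^2 U (A z) by the square of (1 - z) A'(z) / (1 - A z), which tends
    to 1. *)
Lemma right_weight_coadjoint A U c : tame A ->
  right_weight (coadjoint A U) c <-> right_weight U c.
Proof.
move=> tA; have [_ A01 _ [k [K [k0 kK]]]] := tA.
have [c' [C [c'0 cC]]] := tame_expansion tA.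
pose rho z := (1 - z) * A^`() z / (1 - A z).
have cz : 1 - z @[z --> (1 : R)^'-] --> (0 : R).
  rewrite -[X in _ --> X](subrr (1 : R)).
  by apply: cvgB; [exact: cvg_cst | exact: cvg_left1_id].
have rho1 : rho z @[z --> (1 : R)^'-] --> (1 : R).
  apply/cvgrPdist_le => e e0.
  have ce : C / c' * (1 - z) @[z --> (1 : R)^'-] --> (0 : R).
    by rewrite -[X in _ --> X](mulr0 (C / c')); apply: cvgM => //; exact: cvg_cst.
  near=> z; have z01 : 0 < z < 1 by near: z; exact: near_left1_in01.
  have [cz1 Cz] := cC z z01; have Az := A01 z z01.
  have Az0 : 0 < 1 - A z by lra.
  have -> : 1 - rho z = (1 - A z - A^`() z * (1 - z)) / (1 - A z).
    by rewrite /rho; field; lra.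
  rewrite normrM normfV [X in _ / X]gtr0_norm// ler_pdivrMr//.
  apply: (le_trans Cz); apply: (@le_trans _ _ (e * (c' * (1 - z)))).
    have -> : C * (1 - z) ^+ 2 = (C / c' * (1 - z)) * (c' * (1 - z)).
      by field; rewrite gt_eqF.
    rewrite ler_pM2r ?mulr_gt0//; last by lra.
    by near: z; apply: (cvgr_le _ ce).
  by rewrite ler_pM2l.
pose S := K / k + 3 / 2 * (K / k) ^+ 2.
have bound (u v : R) : `|u| <= K / k -> `|v| <= K / k ->
    `|v - 3 / 2 * u ^+ 2| <= S.
  move=> uK vK; rewrite (le_trans (ler_normB _ _))// lerD//.
  rewrite normrM ger0_norm; last by lra.
  rewrite ler_pM2l; last by lra.
  by rewrite normrX lerXn2r ?nnegrE//; exact: le_trans uK.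
have Sz z : 0 < z < 1 -> `|schwarzian A z| <= S.
  move=> z01; have [kA A2 A3] := kK z z01.
  have A1 : 0 < A^`() z by exact: lt_le_trans kA.
  have div u : `|u| <= K -> `|u / A^`() z| <= K / k.
    move=> uK; rewrite normrM normfV [X in _ / X]gtr0_norm//.
    by apply: ler_pM; rewrite ?invr_ge0 ?(ltW A1)// lef_pV2 ?posrE.
  exact: bound (div _ A2) (div _ A3).
have eps0 : (1 - z) ^+ 2 * schwarzian A z @[z --> (1 : R)^'-] --> (0 : R).
  have cS : (1 - z) * (1 - z) * S @[z --> (1 : R)^'-] --> (0 : R).
    rewrite -[X in _ --> X](_ : 0 * 0 * S = 0); last by rewrite !mul0r.
    by apply: cvgM; [exact: cvgM | exact: cvg_cst].
  apply/cvgrPdist_le => e e0; near=> z.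
  have z01 : 0 < z < 1 by near: z; exact: near_left1_in01.
  rewrite sub0r normrN normrM ger0_norm ?sqr_ge0//.
  apply: (@le_trans _ _ ((1 - z) * (1 - z) * S)).
    by rewrite expr2 ler_wpM2l ?Sz// mulr_ge0//; lra.
  by near: z; apply: (cvgr_le _ cS).
have step : right_weight U c <->
    (1 - A z) ^+ 2 * U (A z) @[z --> (1 : R)^'-] --> c.
  split=> /cvgrPdist_lt cU; apply/cvgrPdist_lt => e e0.
    exact/(tame_near (fun w => `|c - (1 - w) ^+ 2 * U w| < e) tA)/cU.
  exact/(tame_near (fun w => `|c - (1 - w) ^+ 2 * U w| < e) tA)/cU.
have rho_neq0 z : 0 < z < 1 -> rho z != 0.
  move=> z01; have [kA _ _] := kK z z01; have := A01 z z01 => Az.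
  by rewrite lt0r_neq0// /rho divr_gt0 ?mulr_gt0//; lra.
rewrite step; split=> cU.
- have : ((1 - z) ^+ 2 * coadjoint A U z - (1 - z) ^+ 2 * schwarzian A z)
      / (rho z * rho z) @[z --> (1 : R)^'-] --> (c - 0) / (1 * 1).
    apply: cvgM; first exact: cvgB.
    by apply: cvgV; [rewrite mulr1 oner_neq0 | exact: cvgM].
  rewrite subr0 mulr1 divr1; apply: cvg_trans; apply: near_eq_cvg; near=> z.
  have z01 : 0 < z < 1 by near: z; exact: near_left1_in01.
  have := A01 z z01; have [kA _ _] := kK z z01 => Az.
  by rewrite /coadjoint /rho; field; lra.
- have : (1 - A z) ^+ 2 * U (A z) * (rho z * rho z)
      + (1 - z) ^+ 2 * schwarzian A z @[z --> (1 : R)^'-] --> c * (1 * 1) + 0.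
    by apply: cvgD => //; apply: cvgM => //; exact: cvgM.
  rewrite !mulr1 addr0; apply: cvg_trans; apply: near_eq_cvg; near=> z.
  have z01 : 0 < z < 1 by near: z; exact: near_left1_in01.
  have := A01 z z01 => Az.
  by rewrite /coadjoint /rho; field; lra.
Unshelve. all: end_near. Qed.

End tame_distortions.

(** * The action of distortions on laws *)

Section tame_action.
Context {R : realType}.
Implicit Types (f A B U h : R -> R) (c x y z w : R).

Lemma der_onem h a z : is_derive (1 - z) 1 h a ->
  is_derive z 1 (fun y => h (1 - y)) (- a).
Proof.
have d1 : is_derive z 1 (fun y : R => 1 - y) (- 1).
  by derive_by ltac:(fail); rewrite sub0r.
by move=> ha; rewrite -mulrN1; exact: (@der_comp _ h (fun y => 1 - y) _ _ _ ha d1).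
Qed.

Lemma tame_reflect A : tame A -> tame (fun z => 1 - A (1 - z)) /\
  forall U z, 0 < z < 1 ->
    coadjoint (fun z => 1 - A (1 - z)) (fun w => U (1 - w)) z =
    coadjoint A U (1 - z).
Proof.
move=> tA; have [CA A01 Aonto [k [K [k0 kK]]]] := tA.
have d z : 0 < z < 1 -> [/\ is_derive (1 - z) 1 A (A^`() (1 - z)),
    is_derive (1 - z) 1 A^`() (A^`(2) (1 - z)) &
    is_derive (1 - z) 1 A^`(2) (A^`(3) (1 - z))].
  by move=> z01; apply: tame_der => //; lra.
have c3 z : 0 < z < 1 -> {for 1 - z, continuous A^`(3)}.
  move=> z01; apply: (Ck_on_continuous CA (D := `]0, 1[%classic)) => //.
  by apply/in01E; lra.
rewrite /tame /coadjoint /schwarzian.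
move: (A^`()) (A^`(2)) (A^`(3)) kK d c3 {CA tA} => A1 A2 A3 kK d c3.
have [z /in01E/d[d0 _ _]|z /in01E/d[_ d1 _]|z /in01E/d[_ _ d2]|
      z /in01E/c3 cz|C E] :=
  @Ck_on3 R `]0, 1[%classic _ (fun z => 1 - A (1 - z)) (fun z => A1 (1 - z))
   (fun z => - A2 (1 - z)) (fun z => A3 (1 - z)) (@open01 R) (fun x _ => erefl).
- rewrite -[A1 _]opprK -[- - _]add0r.
  by apply: (@derD _ (fun=> 1) (fun z => - A (1 - z)));
    apply: (@derN _ (fun z => A (1 - z))); exact: der_onem.
- exact: der_onem.
- by rewrite -[A3 _]opprK; apply: (@derN _ (fun z => A2 (1 - z))); exact: der_onem.
- apply: continuous_comp; last exact: cz.
  by apply: cvgB; [exact: cvg_cst | exact: cvg_id].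
split; last by move=> U z /in01E/E[-> -> ->]; rewrite subKr; ring.
split=> //.
- by move=> z z01; have := A01 (1 - z); lra.
- move=> w w01; have [|z z01 zw] := Aonto (1 - w); first by lra.
  by exists (1 - z); [lra | rewrite subKr zw subKr].
- exists k, K; split=> // z z01; have /in01E/E[-> -> ->] := z01.
  by rewrite normrN; apply: kK; lra.
Qed.

Lemma left_weight_coadjoint A U c : tame A ->
  left_weight (coadjoint A U) c <-> left_weight U c.
Proof.
move=> tA; have [tA' coE] := tame_reflect tA.
rewrite !left_weightE -(right_weight_coadjoint (fun w => U (1 - w)) c tA').
by split; apply: right_weight_eq => z z01; rewrite coE.
Qed.

Lemma weights_coadjoint A U c : tame A ->
  (right_weight (coadjoint A U) c <-> right_weight U c) /\
  (left_weight (coadjoint A U) c <-> left_weight U c).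
Proof.
by move=> tA; split; [exact: right_weight_coadjoint | exact: left_weight_coadjoint].
Qed.

(** A o F is an antiderivative of A'(F) f. *)
Lemma act_law_Dplus2 A f : tame A -> Dplus2 f -> Dplus2 (act_law A f) /\
  forall x, 0 < f x ->
    0 < act_law A f x /\ cdf_of (act_law A f) x = A (cdf_of f x).
Proof.
move=> tA [Df f2]; have [_ A01 Aonto [k [K [k0 kK]]]] := tA.
have [df of_ itvf _] := Dplus_support Df.
have d x : 0 < f x -> [/\ is_derive (cdf_of f x) 1 A (A^`() (cdf_of f x)),
    is_derive (cdf_of f x) 1 A^`() (A^`(2) (cdf_of f x)),
    is_derive (cdf_of f x) 1 A^`(2) (A^`(3) (cdf_of f x)) &
    {for cdf_of f x, continuous A^`(3)}].
  move=> fx; have F01 := cdf_of_itv Df fx.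
  have [d0 d1 d2] := tame_der tA F01; have [CA _ _ _] := tA.
  split => //; apply: (Ck_on_continuous CA (D := `]0, 1[%classic)) => //.
have e x : 0 < f x -> [/\ is_derive x 1 f (f^`() x),
    is_derive x 1 f^`() (f^`(2) x) & {for x, continuous f^`(2)}].
  move=> fx; split.
  - exact: (Ck_on_is_derive (k := 0) f2).
  - exact: (Ck_on_is_derive (k := 1) f2).
  - exact: (Ck_on_continuous f2).
have dF x : 0 < f x -> is_derive x 1 (cdf_of f) (f x) by exact: cdf_of_der.
have A1pos x : 0 < f x -> 0 < A^`() (cdf_of f x).
  by move=> fx; have [kA _ _] := kK _ (cdf_of_itv Df fx); exact: lt_le_trans kA.
have suppE x : (0 < A^`() (cdf_of f x) * f x) = (0 < f x).
  have [fx|fx] := boolP (0 < f x); first by rewrite mulr_gt0// A1pos.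
  by rewrite (density_eq0 df (negP fx)) mulr0 ltxx.
rewrite /Dplus2 /act_law.
move: (A^`()) (A^`(2)) (A^`(3)) (f^`()) (f^`(2)) d e A1pos suppE {f2 kK tA} =>
  A1 A2 A3 f1 f2 d e A1pos suppE.
have setE : [set x | 0 < A1 (cdf_of f x) * f x] = [set x | 0 < f x].
  by apply/seteqP; split=> x /=; rewrite suppE.
pose g1 x : R := A2 (cdf_of f x) * f x ^+ 2 + A1 (cdf_of f x) * f1 x.
pose g2 x : R := A3 (cdf_of f x) * f x ^+ 3
  + 3 * A2 (cdf_of f x) * f x * f1 x + A1 (cdf_of f x) * f2 x.
have d0 x : 0 < f x ->
    is_derive x 1 (fun x => A1 (cdf_of f x) * f x) (g1 x).
  move=> fx; have [_ a1 _ _] := d x fx; have [e0 _ _] := e x fx.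
  have dFx := dF x fx.
  by rewrite /g1; derive_by ltac:(solve [eauto]); ring.
have d1 x : 0 < f x -> is_derive x 1 g1 (g2 x).
  move=> fx; have [_ a1 a2 _] := d x fx; have [e0 e1 _] := e x fx.
  have dFx := dF x fx.
  by rewrite /g1 /g2; derive_by ltac:(solve [eauto]); rewrite /=; ring.
have c2 x : 0 < f x -> {for x, continuous g2}.
  move=> fx; have [_ a1 a2 a3] := d x fx; have [e0 e1 e2] := e x fx.
  have cF := der_cont (dF x fx).
  have cA (h : R -> R) : {for cdf_of f x, continuous h} ->
      h (cdf_of f y) @[y --> x] --> h (cdf_of f x).
    by move=> ch; apply: continuous_comp.
  have cf := der_cont e0; have cf1 := der_cont e1.
  apply: cvgD; first apply: cvgD.
  + apply: cvgM; first exact: cA.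
    exact: (cvg_comp _ _ cf (@exprn_continuous _ 3 _)).
  + apply: cvgM => //; apply: cvgM => //.
    by apply: cvgM; [exact: cvg_cst | exact: cA (der_cont a2)].
  + by apply: cvgM => //; exact: cA (der_cont a1).
have [||||x|||DA FA] := @density_of_antiderivative R
  (fun x => A1 (cdf_of f x) * f x) (fun x => A (cdf_of f x)).
- move=> x; have [fx|fx] := boolP (0 < f x).
    by rewrite mulr_ge0 ?ltW ?A1pos.
  by rewrite (density_eq0 df (negP fx)) mulr0.
- by rewrite setE.
- by rewrite setE.
- by move=> x; rewrite suppE => /d0/der_cont.
- rewrite suppE => fx; have [a0 _ _ _] := d x fx.
  exact: (@der_comp _ A (cdf_of f) _ _ _ a0 (dF x fx)).
- by move=> x; rewrite suppE => fx; apply: A01; exact: cdf_of_itv.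
- move=> z /Aonto[w w01 <-]; exists (quantile f w).
    by rewrite suppE; exact: quantile_supp.
  by rewrite cdf_of_quantile.
split; last by move=> x fx; rewrite FA suppE.
split=> //; rewrite setE.
have [//|] := @Ck_on2 R _ _ (fun x => A1 (cdf_of f x) * f x) g1 g2 of_
  (fun x _ => erefl).
by move=> C _.
Qed.

(** The quantile functions satisfy Q_f = Q_g o A for g = act_law A f. *)
Lemma hill_potential_act A f z : tame A -> Dplus2 f -> 0 < z < 1 ->
  hill_potential f z = coadjoint A (hill_potential (act_law A f)) z.
Proof.
move=> tA Df2 z01; have [DA FA] := act_law_Dplus2 tA Df2.
have [CA A01 _ [k [K [k0 kK]]]] := tA.
have [CQ _] := quantile_Ck Df2; have [CQA QAE] := quantile_Ck DA.
have QE y : 0 < y < 1 -> (quantile (act_law A f) \o A) y = quantile f y.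
  move=> y01; have fQ := quantile_supp Df2.1 y01.
  have [gQ] := FA _ fQ; rewrite cdf_of_quantile//=; last exact: Df2.1.
  by move=> <-; rewrite quantile_cdf//; case: DA.
have A1 : A^`() z != 0.
  by have [kA _ _] := kK z z01; rewrite lt0r_neq0//; exact: lt_le_trans kA.
have Q1 : (quantile (act_law A f))^`() (A z) != 0.
  have [-> _ _] := QAE (A z) (A01 z z01).
  by rewrite invr_eq0 lt0r_neq0//; apply: quantile_supp (A01 z z01); case: DA.
have AE y : `]0, 1[%classic y -> `]0, 1[%classic (A y).
  by move=> /in01E/A01 Ay; exact/in01E.
have [C S] := schwarzian_comp (@open01 R) (@open01 R) AE CA CQA
  (proj2 (in01E z) z01) A1 Q1.
rewrite /hill_potential /coadjoint -S /schwarzian.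
have [_ E] := Ck_on_eq (@open01 R) (fun y y01 => QE y (proj1 (in01E y) y01)) C.
have z01' := proj2 (in01E z) z01.
have E1 : (quantile f)^`() z = (quantile (act_law A f) \o A)^`() z.
  exact: (E 1%N z isT z01').
by rewrite (E 3%N z isT z01') (E 2%N z isT z01') E1.
Qed.

Lemma weights_act_law A f : tame A -> Dplus2 f ->
  Dplus2 (act_law A f) /\ forall c,
  (right_weight (hill_potential (act_law A f)) c <->
   right_weight (hill_potential f) c) /\
  (left_weight (hill_potential (act_law A f)) c <->
   left_weight (hill_potential f) c).
Proof.
move=> tA Df2; split; first by have [] := act_law_Dplus2 tA Df2.
move=> c; have [rw lw] := weights_coadjoint (hill_potential (act_law A f)) c tA.
split.
- apply: (iff_trans (iff_sym rw)); split.
  + by apply: right_weight_eq => z z01; rewrite (hill_potential_act tA Df2).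
  + by apply: right_weight_eq => z z01; rewrite -(hill_potential_act tA Df2).
- apply: (iff_trans (iff_sym lw)); split.
  + rewrite !left_weightE; apply: right_weight_eq => z z01.
    by rewrite [RHS](hill_potential_act tA Df2)//; lra.
  + rewrite !left_weightE; apply: right_weight_eq => z z01.
    by rewrite [LHS](hill_potential_act tA Df2)//; lra.
Qed.

End tame_action.

(** * Integrals depending on a parameter *)

Section integrals_with_parameter.
Context {R : realType}.
Implicit Types (h : R -> R) (k : R -> R -> R) (s t z M T : R).
Local Notation mu := (@lebesgue_measure R).

Lemma continuous_bounded01 h : continuous h ->
  exists M : R, forall z, 0 <= z <= 1 -> `|h z| <= M.
Proof.
move=> ch; have cn : {within `[0, 1], continuous (fun z => `|h z|)}.
  by apply: continuous_subspaceT => z; apply: cvg_norm; exact: ch.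
have [c _ cM] := EVT_max ler01 cn.
by exists `|h c| => z z01; apply: cM; rewrite in_itv.
Qed.

Lemma continuous_integrable h a b : continuous h ->
  mu.-integrable `[a, b] (EFin \o h).
Proof.
move=> ch; apply: continuous_compact_integrable; first exact: segment_compact.
exact: continuous_subspaceT.
Qed.

Lemma cst_integrable M a b : mu.-integrable `[a, b] (EFin \o (fun=> M)).
Proof. by apply: continuous_integrable => z; exact: cvg_cst. Qed.

(** Integrating from - 1 makes the primitive differentiable at 0 too. *)
Lemma primitive_der h : continuous h -> exists P : R -> R,
  (forall t, - 1 < t -> is_derive t 1 P (h t)) /\
  forall t, 0 <= t -> (\int[mu]_(s in `[0, t]) h s)%R = P t - P 0.
Proof.
move=> ch; exists (fun t => \int[mu]_(s in `[- 1, t]) h s)%R; split=> t t0.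
  have [|||dP PE] := @continuous_FTC1_closed R h (- 1) t (t + 1) _ _ _ (ch t).
  - by rewrite ltrDl.
  - exact: continuous_integrable.
  - by [].
  - exact: is_derive_eq (der1P dP) PE.
rewrite Rintegral_itvB.
- rewrite Rintegral_itv_obnd_cbnd//.
  apply: (@integrableS _ _ _ mu `[0, t]%classic) => //.
    by move=> s /=; rewrite !in_itv/= => /andP[/ltW -> ->].
  exact: continuous_integrable.
- exact: continuous_integrable.
- by rewrite bnd_simp; lra.
- by rewrite bnd_simp.
Qed.

Lemma max0_continuous : continuous (fun t : R => Num.max t 0).
Proof.
move=> t; apply: (@continuous_max _ _ (fun t : R => t) (fun=> 0)).
  exact: cvg_id.
exact: cvg_cst.
Qed.

Lemma primitive_continuous h : continuous h ->
  continuous (fun t => (\int[mu]_(s in `[0%R, Num.max t 0]) h s)%R).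
Proof.
move=> /primitive_der[P [dP PE]] t.
rewrite (_ : (fun t => _) = fun t => P (Num.max t 0) - P 0); last first.
  by apply/funext => s; rewrite PE// le_max lexx orbT.
apply: cvgB; last exact: cvg_cst.
apply: continuous_comp; first exact: max0_continuous.
apply: der_cont (dP _ _).
by rewrite (@lt_le_trans _ _ 0)// le_max lexx orbT.
Qed.

Lemma Rintegral_norm_le h M T : continuous h -> 0 <= T ->
  (forall s, 0 <= s <= T -> `|h s| <= M) ->
  `|(\int[mu]_(s in `[0, T]) h s)%R| <= M * T.
Proof.
move=> ch T0 hM.
apply: (le_trans (le_normr_Rintegral _ _)) => //; first exact: continuous_integrable.
have -> : M * T = (\int[mu]_(s in `[0, T]) M)%R.
  rewrite Rintegral_cst//= lebesgue_measure_itv/= lte_fin.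
  by case: ltP => [_|T0']; rewrite /= ?subr0//;
    have -> : T = 0 by apply/eqP; rewrite eq_le T0 T0'.
apply: le_Rintegral => //.
- apply: continuous_integrable => s; apply: cvg_norm; exact: ch.
- exact: cst_integrable.
Qed.

Section parameter.
Variables (T M : R) (k : R -> R -> R).
Hypothesis T0 : 0 <= T.
Hypothesis ks : forall z, 0 < z < 1 -> continuous (k^~ z).

Lemma parameter_continuous z :
  (forall s z, 0 <= s <= T -> 0 < z < 1 -> `|k s z| <= M) ->
  (forall s z, 0 <= s <= T -> 0 < z < 1 -> {for z, continuous (k s)}) ->
  0 < z < 1 ->
  {for z, continuous (fun z => (\int[mu]_(s in `[0, T]) k s z)%R)}.
Proof.
move=> kM kc z01.
apply: (@continuity_under_integral R _ _ mu (fun z s => k s z) `[0, T]%classic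
  _ 0 1 _ _ (fun=> M)) => //.
- by move=> x /in01E x01; apply: continuous_integrable; exact: ks.
- apply: aeW => s /=; rewrite in_itv/= => sT x; rewrite inE => /in01E x01.
  exact: kc.
- exact: cst_integrable.
- by move=> x /in01E x01; apply: aeW => s /=; rewrite in_itv/= => sT; exact: kM.
- by rewrite inE; exact/in01E.
Qed.

Lemma parameter_der (k1 : R -> R -> R) z :
  (forall s z, 0 <= s <= T -> 0 < z < 1 -> is_derive z 1 (k s) (k1 s z)) ->
  (forall s z, 0 <= s <= T -> 0 < z < 1 -> `|k1 s z| <= M) ->
  0 < z < 1 ->
  is_derive z 1 (fun z => (\int[mu]_(s in `[0, T]) k s z)%R)
    (\int[mu]_(s in `[0, T]) k1 s z)%R.
Proof.
move=> kd k1M z01.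
have M0 : 0 <= M.
  by apply: le_trans (k1M 0 z _ z01) => //; rewrite lexx.
pose f z s := k s z.
have mT : measurable (`[0, T]%classic : set (measurableTypeR R)) by [].
have intf x : `]0, 1[%classic x -> mu.-integrable `[0, T] (EFin \o f x).
  by move=> /in01E x01; apply: continuous_integrable; exact: ks.
have derf x s : `]0, 1[%classic x -> `[0, T]%classic s -> derivable (f ^~ s) x 1.
  move=> /in01E x01 /=; rewrite in_itv/= => sT.
  by have [] := kd s x sT x01.
have fE x s : `]0, 1[%classic x -> `[0, T]%classic s ->
    partial1of2 f x s = k1 s x.
  move=> /in01E x01 /=; rewrite in_itv/= => sT.
  exact: der1E (kd s x sT x01).
have f_ub x s : `]0, 1[%classic x -> `[0, T]%classic s ->
    `|partial1of2 f x s| <= M.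
  move=> x01 sT; rewrite fE//; apply: k1M; first by move: sT; rewrite /= in_itv.
  exact/in01E.
have z01' : `]0, 1[%classic z by exact/in01E.
have dF := @derivable_under_integral R _ _ mu f _ mT z 0 1 z01' intf derf _
  (fun=> M0) (cst_integrable M 0 T) f_ub.
have FE := @differentiation_under_integral R _ _ mu f _ mT z 0 1 z01' intf derf _
  (fun=> M0) (cst_integrable M 0 T) f_ub.
apply: is_derive_eq (der1P dF) _; rewrite FE.
by apply: eq_Rintegral => s; rewrite inE => sT; exact: fE.
Qed.

End parameter.
End integrals_with_parameter.

(** * Flows of kernels *)

Section kernel_flows.
Context {R : realType}.
Implicit Types (r s t x y z : R).
Variables (h h1 h2 : R -> R) (f : R -> R -> R) (K : R).
Local Notation mu := (@lebesgue_measure R).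

Hypothesis h_der : forall z, is_derive z 1 h (h1 z).
Hypothesis h1_der : forall z, is_derive z 1 h1 (h2 z).
Hypothesis h2_continuous : continuous h2.
Hypothesis hK : forall z, 0 <= z <= 1 ->
  [/\ `|h z| <= K, `|h1 z| <= K & `|h2 z| <= K].
Hypothesis fd : forall t, 0 <= t -> prob_density (f t).
Hypothesis f_init : forall x, f t x @[t --> (0 : R)^'+] --> f 0 x.
Hypothesis f_der : forall x t, 0 < t ->
  is_derive t 1 (f^~ x) ((h (cdf_of (f t) x) - 1) * f t x).
Hypothesis D0 : Dplus2 (f 0).

(** Times are truncated at 0, which makes the functions of time below continuous
    on the whole line. *)
Let pos (t : R) : R := Num.max t 0.

Let pos_ge0 t : 0 <= pos t. Proof. by rewrite le_max lexx orbT. Qed.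

Let posE t : 0 <= t -> pos t = t. Proof. by move=> t0; exact/max_l. Qed.

Let K_ge0 : 0 <= K.
Proof.
have [|hK0 _ _] := hK (z := 0); first by rewrite lexx ler01.
exact: le_trans (normr_ge0 _) hK0.
Qed.

(** Gronwall's inequality: the relative rate h (F) - 1 is at most K + 1 in
    absolute value. *)
Lemma flow_growth t x : 0 <= t ->
  expR (- ((K + 1) * t)) * f 0 x <= f t x <= expR ((K + 1) * t) * f 0 x.
Proof.
rewrite le_eqVlt => /predU1P[<-|t0].
  by rewrite mulr0 oppr0 expR0 mul1r lexx.
have F01 s : 0 < s -> `|h (cdf_of (f s) x)| <= K.
  move=> s0; have ds := fd (ltW s0).
  by have [|] := hK (z := cdf_of (f s) x); rewrite ?cdf_of_ge0 ?cdf_of_le1.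
have fge0 s : 0 < s -> 0 <= f s x by move=> /ltW/fd[].
have lim (c : R) : expR (c * s) * f s x @[s --> (0 : R)^'+] --> f 0 x.
  rewrite -[X in _ --> X]mul1r -expR0 -[X in expR X](mulr0 c).
  apply: cvgM; last exact: f_init.
  apply: continuous_cvg; first exact: continuous_expR.
  by apply: cvgM; [exact: cvg_cst | exact: cvg_right0_id].
have der (c s : R) : 0 < s -> is_derive s 1 (fun s => expR (c * s) * f s x)
    (expR (c * s) * (f s x * (c + (h (cdf_of (f s) x) - 1)))).
  move=> s0; have dfs := f_der x s0.
  have de : is_derive s 1 (fun s => expR (c * s)) (expR (c * s) * c).
    by derive_by ltac:(fail); ring.
  by apply: is_derive_eq (derM de dfs) _; ring.
have up : expR (- (K + 1) * t) * f t x <= f 0 x.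
  apply: (ler_cvg_to (cvg_cst _) (lim (- (K + 1)))).
  near=> s; have /andP[s0 st] : 0 < s < t by near: s; exact: near_right0_lt.
  have d r : s <= r <= t ->
      is_derive r 1 (fun s => - (expR (- (K + 1) * s) * f s x))
        (- (expR (- (K + 1) * r) *
            (f r x * (- (K + 1) + (h (cdf_of (f r) x) - 1))))).
    by move=> /andP[sr _]; exact: (derN (der _ _ (lt_le_trans s0 sr))).
  rewrite -lerN2; apply: (der_ge0_le (ltW st) d) => r /andP[sr _].
  have r0 : 0 < r by exact: lt_le_trans sr.
  rewrite oppr_ge0 pmulr_rle0 ?expR_gt0// mulr_ge0_le0 ?fge0//.
  by have := F01 r r0; rewrite ler_norml; lra.
have lo : f 0 x <= expR ((K + 1) * t) * f t x.
  apply: (ler_cvg_to (lim (K + 1)) (cvg_cst _)).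
  near=> s; have /andP[s0 st] : 0 < s < t by near: s; exact: near_right0_lt.
  have d r : s <= r <= t -> is_derive r 1 (fun s => expR ((K + 1) * s) * f s x)
        (expR ((K + 1) * r) * (f r x * (K + 1 + (h (cdf_of (f r) x) - 1)))).
    by move=> /andP[sr _]; exact: (der _ _ (lt_le_trans s0 sr)).
  apply: (der_ge0_le (ltW st) d) => r /andP[sr _].
  have r0 : 0 < r by exact: lt_le_trans sr.
  rewrite pmulr_rge0 ?expR_gt0// mulr_ge0 ?fge0//.
  by have := F01 r r0; rewrite ler_norml; lra.
apply/andP; split.
- by rewrite expRN -ler_pdivlMl ?invr_gt0 ?expR_gt0// invrK.
- by rewrite -ler_pdivrMl ?expR_gt0// -expRN -mulNr.
Unshelve. all: end_near. Qed.

Lemma flow_continuous_time x : continuous (fun t => f (pos t) x).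
Proof.
move=> t; have [t0|t0|t0] := ltgtP t 0.
- have E : f (pos t) x = f 0 x by rewrite /pos max_r// ltW.
  rewrite /continuous_at E.
  have : f 0 x @[s --> t] --> f 0 x by exact: cvg_cst.
  apply: cvg_trans; apply: near_eq_cvg; near=> s.
  rewrite /pos max_r// ltW//; near: s; exact: lt_nbhsl.
- rewrite /continuous_at posE ?ltW//.
  have c : f s x @[s --> t] --> f t x := der_cont (f_der x t0).
  move: c; apply: cvg_trans; apply: near_eq_cvg; near=> s.
  rewrite posE// ltW//; near: s; exact: lt_nbhsr.
- subst t; rewrite /continuous_at posE//; apply/cvgrPdist_lt => e e0.
  have /cvgrPdist_lt/(_ e e0)[d /= d0 fdx] := f_init (x := x).
  exists d => //= s sd; have [s0|s0] := leP s 0.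
    by rewrite /pos max_r// subrr normr0.
  by rewrite posE ?ltW//; exact: fdx.
Unshelve. all: end_near. Qed.

(** Dominated convergence; [flow_growth] makes a multiple of f 0 a dominating
    function on bounded time intervals. *)
Lemma cdf_continuous_time x : continuous (fun t => cdf_of (f (pos t)) x).
Proof.
move=> t; pose T := `|t| + 1.
have posT s : t - 1 < s < t + 1 -> pos s <= T.
  move=> st; rewrite /pos ge_max /T; have := ler_norm t.
  by have := normr_ge0 t; lra.
apply: (@continuity_under_integral R _ _ mu (fun s y => f (pos s) y)
  `]-oo, x]%classic _ (t - 1) (t + 1) _ _ (fun y => expR ((K + 1) * T) * f 0 y)).
- by [].
- by move=> s _; apply: density_integrable => //; exact: fd.
- by apply: aeW => y _ s _; exact: flow_continuous_time.
- rewrite (_ : EFin \o _ = (fun y =>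
    (expR ((K + 1) * T))%:E * (EFin \o f 0) y)%E) //.
  apply: integrableZl => //; apply: density_integrable => //.
  by case: D0 => -[].
- move=> s /=; rewrite in_itv/= => sT; apply: aeW => y _.
  have [_ f0 _] := fd (pos_ge0 s); rewrite ger0_norm//.
  have /andP[_ /le_trans] := flow_growth y (pos_ge0 s); apply.
  apply: ler_wpM2r; first by case: D0 => -[[]].
  by rewrite ler_expR ler_wpM2l ?posT//; have := K_ge0; lra.
- by rewrite inE/= in_itv/=; lra.
Qed.

Lemma h_cdf_continuous_time x : continuous (fun s => h (cdf_of (f (pos s)) x)).
Proof.
move=> s; apply: continuous_comp; first exact: cdf_continuous_time.
exact: der_cont (h_der _).
Qed.

(** The linear equation satisfied by t |-> f t x is solved by an exponential;
    in this form the regularity of f t is that of its exponent. *)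
Lemma flow_solution t x : 0 <= t -> f t x = f 0 x *
  expR ((\int[mu]_(s in `[0, t]) h (cdf_of (f (pos s)) x))%R - t).
Proof.
have [P [dP PE]] := primitive_der (h_cdf_continuous_time (x := x)).
move=> t0; rewrite PE//; move: t0; rewrite le_eqVlt => /predU1P[<-|t0].
  by rewrite subrr subrr expR0 mulr1.
pose phi s := f s x * expR (- (P s - P 0 - s)).
have dphi s : 0 < s -> is_derive s 1 phi 0.
  move=> s0; have dfs := f_der x s0; have dPs := dP s (lt_trans (ltrN10 _) s0).
  rewrite posE ?ltW// in dPs.
  have de : is_derive s 1 (fun s => expR (- (P s - P 0 - s)))
      (expR (- (P s - P 0 - s)) * (1 - h (cdf_of (f s) x))).
    by derive_by ltac:(solve [eauto]); ring.
  by apply: is_derive_eq (derM dfs de) _; rewrite /=; ring.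
have lim1 : phi s @[s --> (0 : R)^'+] --> phi t.
  have : phi t @[s --> (0 : R)^'+] --> phi t by exact: cvg_cst.
  apply: cvg_trans; apply: near_eq_cvg; near=> s.
  have /andP[s0 st] : 0 < s < t by near: s; exact: near_right0_lt.
  have [r _ ] := mean_value (f' := fun=> 0) st
    (fun r rs => dphi r (lt_le_trans s0 (proj1 (andP rs)))).
  by rewrite mul0r => /eqP; rewrite subr_eq0 => /eqP.
have lim2 : phi s @[s --> (0 : R)^'+] --> f 0 x * expR (- (P 0 - P 0 - 0)).
  apply: cvgM; first exact: f_init.
  apply: continuous_cvg; first exact: continuous_expR.
  apply: cvgN; apply: cvgB; last exact: cvg_right0_id.
  apply: cvgB; last exact: cvg_cst.
  by apply: cvg_at_right_filter; exact: der_cont (dP 0 (ltrN10 _)).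
have := cvg_unique _ lim1 lim2.
rewrite subrr subrr oppr0 expR0 mulr1 => <- //.
by rewrite /phi -mulrA -expRD addNr expR0 mulr1.
Unshelve. all: end_near. Qed.

(** Integrating [flow_growth] compares the laws at times 0 and t, hence their
    distribution functions. *)
Lemma flow_mass t (A : set R) : 0 <= t -> measurable A ->
  expR (- ((K + 1) * t)) * (\int[mu]_(x in A) f 0 x)%R <=
  (\int[mu]_(x in A) f t x)%R <=
  expR ((K + 1) * t) * (\int[mu]_(x in A) f 0 x)%R.
Proof.
move=> t0 mA; have d0 : prob_density (f 0) by case: D0 => -[].
have i0 := density_integrable d0 mA.
have it := density_integrable (fd t0) mA.
have ic c : mu.-integrable A (EFin \o (fun x => c * f 0 x)).
  rewrite (_ : EFin \o _ = (fun y => c%:E * (EFin \o f 0) y)%E) //.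
  exact: integrableZl.
rewrite -!RintegralZl//; apply/andP; split.
- apply: le_Rintegral => //.
  by move=> x _; have /andP[] := flow_growth x t0.
- apply: le_Rintegral => //.
  by move=> x _; have /andP[] := flow_growth x t0.
Qed.

(** The distortion carrying the law at time 0 to the law at time t, and its
    derivative. *)
Let Phi t z := cdf_of (f (pos t)) (quantile (f 0) z).
Let E t z := (\int[mu]_(s in `[0%R, pos t]) h (Phi s z))%R.
Let g t z := expR (E t z - pos t).
Let G t := expR ((K + 1) * pos t).

Let D00 : Dplus (f 0). Proof. by case: D0. Qed.

Let fQ z : 0 < z < 1 -> 0 < f 0 (quantile (f 0) z).
Proof. exact: quantile_supp. Qed.

Lemma flow_at_quantile t z : 0 < z < 1 ->
  f (pos t) (quantile (f 0) z) = f 0 (quantile (f 0) z) * g t z.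
Proof. by move=> z01; rewrite flow_solution. Qed.

Lemma flow_g_bounds t z : 0 < z < 1 -> (G t)^-1 <= g t z <= G t.
Proof.
move=> z01; have := flow_growth (quantile (f 0) z) (pos_ge0 t).
rewrite flow_at_quantile// [f 0 _ * g t z]mulrC !ler_pM2r ?fQ//.
by rewrite expRN.
Qed.

Lemma flow_g_continuous_time z : continuous (g^~ z).
Proof.
move=> t; apply: continuous_comp; last exact: continuous_expR.
apply: cvgB; last exact: max0_continuous.
apply: (primitive_continuous (h := fun s => h (Phi s z))).
exact: h_cdf_continuous_time.
Qed.

Lemma flow_Phi_itv t z : 0 < z < 1 ->
  (G t)^-1 * z <= Phi t z <= G t * z /\
  (G t)^-1 * (1 - z) <= 1 - Phi t z <= G t * (1 - z).
Proof.
move=> z01; have d0 : prob_density (f 0) by case: D00.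
pose q := quantile (f 0) z; have qz : cdf_of (f 0) q = z by exact: cdf_of_quantile.
have lower : expR (- ((K + 1) * pos t)) * cdf_of (f 0) q <= Phi t z <=
    expR ((K + 1) * pos t) * cdf_of (f 0) q.
  by apply: (flow_mass (A := `]-oo, q]%classic)).
have upper : expR (- ((K + 1) * pos t)) * (1 - cdf_of (f 0) q) <= 1 - Phi t z <=
    expR ((K + 1) * pos t) * (1 - cdf_of (f 0) q).
  rewrite (ccdf_of _ d0) (ccdf_of _ (fd (pos_ge0 t))).
  by apply: (flow_mass (A := `]q, +oo[%classic)).
by rewrite qz expRN in lower upper.
Qed.

Lemma flow_Phi_01 t z : 0 < z < 1 -> 0 < Phi t z < 1.
Proof.
move=> z01; have [/andP[P0 _] /andP[P1 _]] := flow_Phi_itv t z01.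
have G0 : 0 < (G t)^-1 by rewrite invr_gt0 expR_gt0.
have /andP[z0 z1] := z01; rewrite (lt_le_trans _ P0) ?mulr_gt0//=.
by rewrite -subr_gt0 (lt_le_trans _ P1)// mulr_gt0// subr_gt0.
Qed.

Lemma flow_Phi_lipschitz t y z : 0 < y < 1 -> 0 < z < 1 ->
  `|Phi t z - Phi t y| <= G t * `|z - y|.
Proof.
wlog yz : y z / y <= z.
  move=> wl y01 z01; have [yz|/ltW zy] := leP y z; first exact: wl.
  by rewrite distrC [X in _ * X]distrC; exact: wl.
move=> y01 z01; have d0 : prob_density (f 0) by case: D00.
have dt := fd (pos_ge0 t).
have Qyz : quantile (f 0) y <= quantile (f 0) z.
  rewrite leNgt; apply/negP => /(cdf_of_incr D00 (fQ z01) (fQ y01)).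
  by rewrite !cdf_of_quantile// ltNge yz.
rewrite !ger0_norm ?subr_ge0//; last exact: cdf_of_nd.
rewrite -{2}(cdf_of_quantile D00 z01) -{2}(cdf_of_quantile D00 y01).
rewrite /Phi !cdf_of_sub//.
by have /andP[] := flow_mass (pos_ge0 t)
  (measurable_itv `]quantile (f 0) y, quantile (f 0) z]).
Qed.

Lemma flow_Phi_continuous t z : 0 < z < 1 -> {for z, continuous (Phi t)}.
Proof.
move=> z01; apply/cvgrPdist_le => e e0; near=> y.
have y01 : 0 < y < 1.
  by apply/in01E; near: y; apply: open_nbhs_pred (@open01 R) _; exact/in01E.
apply: (le_trans (flow_Phi_lipschitz t y01 z01)).
rewrite -ler_pdivlMl ?expR_gt0//; near: y.
have /cvgrPdist_le : y @[y --> z] --> z by exact: cvg_id.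
by apply; rewrite mulr_gt0// invr_gt0 expR_gt0.
Unshelve. all: end_near. Qed.

Let h_continuous : continuous h.
Proof. by move=> z; exact: der_cont (h_der z). Qed.

Let h1_continuous : continuous h1.
Proof. by move=> z; exact: der_cont (h1_der z). Qed.

Let comp_Phi_time (k : R -> R) z : continuous k -> continuous (fun s => k (Phi s z)).
Proof.
move=> ck s; apply: (@continuous_comp _ _ _ (Phi^~ z) k); last exact: ck.
exact: cdf_continuous_time.
Qed.

Let comp_Phi (k : R -> R) t z : continuous k -> 0 < z < 1 ->
  {for z, continuous (fun z => k (Phi t z))}.
Proof.
move=> ck z01; apply: (@continuous_comp _ _ _ (Phi t) k); last exact: ck.
exact: flow_Phi_continuous.
Qed.

Let hPhi_le t z : 0 < z < 1 -> [/\ `|h (Phi t z)| <= K,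
  `|h1 (Phi t z)| <= K & `|h2 (Phi t z)| <= K].
Proof. by move=> /(flow_Phi_01 t)/andP[P0 P1]; apply: hK; rewrite !ltW. Qed.

Lemma flow_g_continuous t z : 0 < z < 1 -> {for z, continuous (g t)}.
Proof.
move=> z01.
apply: (@continuous_comp _ _ _ (fun z => E t z - pos t) expR);
  last exact: continuous_expR.
apply: cvgB; last exact: cvg_cst.
apply: (@parameter_continuous _ (pos t) K (fun s z => h (Phi s z))) => //.
- by move=> y _; exact: comp_Phi_time.
- by move=> s y _ /(hPhi_le s)[].
- by move=> s y _ y01; exact: comp_Phi.
Qed.

(** The Lipschitz bound makes the exponent E t continuous in the rank, so f t
    inherits the continuity of f 0; only then is F_t known to be
    differentiable. *)
Lemma flow_Dplus t : Dplus (f (pos t)).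
Proof.
have [d0 o0 itv0 c0] := Dplus_support D00.
split; first exact: fd.
exists [set x | 0 < f 0 x]; split => //; last first.
  by move=> x fx; rewrite flow_solution// (density_eq0 d0 fx) mul0r.
move=> x /= fx; split; first by rewrite flow_solution// mulr_gt0 ?expR_gt0.
have : f 0 y * g t (cdf_of (f 0) y) @[y --> x] --> f 0 x * g t (cdf_of (f 0) x).
  apply: cvgM; first exact: c0.
  apply: continuous_comp; first exact: der_cont (cdf_of_der D00 fx).
  by apply: flow_g_continuous; exact: cdf_of_itv.
have gE y : 0 < f 0 y -> f 0 y * g t (cdf_of (f 0) y) = f (pos t) y.
  move=> fy; rewrite -{1}(quantile_cdf D00 fy) -flow_at_quantile.
    by rewrite quantile_cdf.
  exact: cdf_of_itv.
rewrite gE// => c; rewrite /continuous_at; move: c.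
apply: cvg_trans; apply: near_eq_cvg; near=> y.
by rewrite gE//; near: y; exact: open_nbhs_pred o0 fx.
Unshelve. all: end_near. Qed.

(** By the chain rule the derivative of F_t o Q_0 is f_t (Q_0) / f_0 (Q_0). *)
Lemma flow_Phi_der t z : 0 < z < 1 -> is_derive z 1 (Phi t) (g t z).
Proof.
move=> z01; have ftQ : 0 < f (pos t) (quantile (f 0) z).
  by rewrite flow_at_quantile// mulr_gt0 ?fQ ?expR_gt0.
have := der_comp (cdf_of_der (flow_Dplus t) ftQ) (quantile_der D00 z01).
move=> d; apply: is_derive_eq d _.
rewrite flow_at_quantile// /rank_profile mulrAC divff ?mul1r//.
by rewrite lt0r_neq0// fQ.
Qed.

Let E1 t z := (\int[mu]_(s in `[0%R, pos t]) (h1 (Phi s z) * g s z))%R.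
Let E2 t z := (\int[mu]_(s in `[0%R, pos t])
  (h2 (Phi s z) * g s z * g s z + h1 (Phi s z) * (g s z * E1 s z)))%R.
Let N t := K * G t * pos t.

Let G_ge0 t : 0 <= G t. Proof. exact: expR_ge0. Qed.

Let N_ge0 t : 0 <= N t. Proof. by rewrite !mulr_ge0. Qed.

Let G_le s t : 0 <= s <= pos t -> G s <= G t.
Proof.
move=> /andP[s0 st]; rewrite ler_expR posE// ler_wpM2l//.
by have := K_ge0; lra.
Qed.

Let N_le s t : 0 <= s <= pos t -> N s <= N t.
Proof.
move=> st; have /andP[s0 st'] := st.
by rewrite /N [X in _ * X <= _]posE// ler_pM ?mulr_ge0// ler_wpM2l// G_le.
Qed.

Let g_le s t z : 0 <= s <= pos t -> 0 < z < 1 -> `|g s z| <= G t.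
Proof.
move=> st z01; rewrite ger0_norm ?expR_ge0//.
by have /andP[_ /le_trans] := flow_g_bounds s z01; apply; exact: G_le.
Qed.

Lemma flow_E_der t z : 0 < z < 1 -> is_derive z 1 (E t) (E1 t z).
Proof.
apply: (@parameter_der _ (pos t) (K * G t) (fun s z => h (Phi s z)) _ _
  (fun s z => h1 (Phi s z) * g s z)) => //.
- by move=> y _; exact: comp_Phi_time.
- move=> s y _ y01.
  exact: (@der_comp _ h (Phi s) _ _ _ (h_der _) (flow_Phi_der s y01)).
- move=> s y sT y01; rewrite normrM; apply: ler_pM => //; last exact: g_le.
  by have [] := hPhi_le s y01.
Qed.

Lemma flow_g_der t z : 0 < z < 1 -> is_derive z 1 (g t) (g t z * E1 t z).
Proof.
move=> z01; have dE := flow_E_der t z01.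
by rewrite /g; derive_by ltac:(exact: dE); ring.
Qed.

Let integrand1_continuous z : continuous (fun s => h1 (Phi s z) * g s z).
Proof.
move=> s; apply: cvgM; first exact: (comp_Phi_time h1_continuous).
exact: flow_g_continuous_time.
Qed.

Let E1_continuous_time z : continuous (E1^~ z).
Proof. exact: (primitive_continuous (@integrand1_continuous z)). Qed.

Let E1_le s t z : 0 <= s <= pos t -> 0 < z < 1 -> `|E1 s z| <= N t.
Proof.
move=> st z01; apply: le_trans (N_le st).
apply: (Rintegral_norm_le (@integrand1_continuous z)) => // r rs.
rewrite normrM; apply: ler_pM => //; last exact: g_le.
by have [] := hPhi_le r z01.
Qed.

Let integrand2_continuous z : continuous (fun s =>
  h2 (Phi s z) * g s z * g s z + h1 (Phi s z) * (g s z * E1 s z)).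
Proof.
move=> s; have cg := flow_g_continuous_time (z := z) (x := s).
apply: cvgD; apply: cvgM => //.
- by apply: cvgM => //; exact: (comp_Phi_time h2_continuous).
- exact: (comp_Phi_time h1_continuous).
- by apply: cvgM => //; exact: E1_continuous_time.
Qed.

Let M2 t := K * G t * G t + K * (G t * N t).

Let integrand2_le s t z : 0 <= s <= pos t -> 0 < z < 1 ->
  `|h2 (Phi s z) * g s z * g s z + h1 (Phi s z) * (g s z * E1 s z)| <= M2 t.
Proof.
move=> st z01; have [_ h1K h2K] := hPhi_le s z01.
have gG := g_le st z01; have EN := E1_le st z01.
apply: (le_trans (ler_normD _ _)); rewrite !normrM.
by apply: lerD; repeat (apply: ler_pM; rewrite ?mulr_ge0//).
Qed.

Lemma flow_E1_der t z : 0 < z < 1 -> is_derive z 1 (E1 t) (E2 t z).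
Proof.
apply: (@parameter_der _ (pos t) (M2 t) (fun s z => h1 (Phi s z) * g s z) _ _
  (fun s z => h2 (Phi s z) * g s z * g s z + h1 (Phi s z) * (g s z * E1 s z))) => //.
- move=> s y sT y01.
  have d1 := @der_comp _ h1 (Phi s) _ _ _ (h1_der _) (flow_Phi_der s y01).
  exact: (derM d1 (flow_g_der s y01)).
- by move=> s y sT y01; exact: integrand2_le.
Qed.

Let E2_continuous t z : 0 < z < 1 -> {for z, continuous (E2 t)}.
Proof.
apply: (@parameter_continuous _ (pos t) (M2 t) (fun s z =>
  h2 (Phi s z) * g s z * g s z + h1 (Phi s z) * (g s z * E1 s z))) => //.
- by move=> s y sT y01; exact: integrand2_le.
- move=> s y sT y01; have cg := flow_g_continuous (t := s) y01.
  apply: cvgD; apply: cvgM => //.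
  + by apply: cvgM => //; exact: comp_Phi.
  + exact: comp_Phi.
  + by apply: cvgM => //; exact: der_cont (flow_E1_der s y01).
Qed.

Let E2_le t z : 0 < z < 1 -> `|E2 t z| <= M2 t * pos t.
Proof.
move=> z01; apply: (Rintegral_norm_le (@integrand2_continuous z)) => // r rt.
exact: integrand2_le.
Qed.

(** Since Phi' = g, g' = g E1 and E1' = E2, the second and third derivatives are
    g E1 and g E1^2 + g E2. *)
Lemma flow_tame t : tame (Phi t) /\ forall z, 0 < z < 1 -> (Phi t)^`() z = g t z.
Proof.
have [||z /in01E z01|z /in01E z01|z /in01E z01|C D] :=
  @Ck_on3 R `]0, 1[%classic (Phi t) (Phi t) (g t)
  (fun z => g t z * E1 t z)
  (fun z => g t z * E1 t z * E1 t z + g t z * E2 t z) (@open01 R).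
- by [].
- by move=> z /in01E; exact: flow_Phi_der.
- exact: flow_g_der.
- by apply: derM; [exact: flow_g_der | exact: flow_E1_der].
- have cE1 := der_cont (flow_E1_der t z01).
  have cg := flow_g_continuous (t := t) z01.
  by apply: cvgD; apply: cvgM => //; [exact: cvgM | exact: E2_continuous].
split; last by move=> z /in01E/D[].
split=> //.
- by move=> z; exact: flow_Phi_01.
- move=> w /andP[w0 w1].
  have G0 : 0 < G t by exact: expR_gt0.
  have G1 : 1 <= G t.
    by rewrite -[leLHS]expR0 ler_expR mulr_ge0//; have := K_ge0; lra.
  pose a := w / (2 * G t); pose b := 1 - (1 - w) / (2 * G t).
  have a01 : 0 < a < 1.
    rewrite divr_gt0 ?mulr_gt0//= ltr_pdivrMr ?mulr_gt0//; lra.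
  have b01 : 0 < b < 1.
    rewrite /b ltrBlDr ltrDl divr_gt0 ?mulr_gt0//; last by lra.
    by rewrite subr_gt0 ltr_pdivrMr ?mulr_gt0//; lra.
  have Ga : G t * a = w / 2 by rewrite /a; field; rewrite gt_eqF.
  have Gb : G t * (1 - b) = (1 - w) / 2 by rewrite /b; field; rewrite gt_eqF.
  have [/andP[_ Pa] _] := flow_Phi_itv t a01.
  have [_ /andP[_ Pb]] := flow_Phi_itv t b01.
  have ab : a <= b.
    have : a <= w / 2 by rewrite -Ga ler_peMl//; lra.
    have : 1 - b <= (1 - w) / 2 by rewrite -Gb ler_peMl//; lra.
    lra.
  have cP : {within `[a, b], continuous (Phi t)}.
    apply: continuous_in_subspaceT => z; rewrite inE/= in_itv/= => zab.
    by apply: flow_Phi_continuous; lra.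
  have [|c] := IVT ab cP (v := w).
    rewrite ge_min le_max; apply/andP; split; apply/orP; [left|right].
      by rewrite (le_trans Pa) // Ga; lra.
    have := Pb; rewrite Gb; lra.
  by rewrite in_itv/= => cab Pc; exists c => //; lra.
- exists (G t)^-1, (G t * N t + (G t * N t * N t + G t * (M2 t * pos t))).
  split; first by rewrite invr_gt0 expR_gt0.
  move=> z z01; have /in01E/D[-> -> ->] := z01.
  have tt : 0 <= pos t <= pos t by rewrite pos_ge0 lexx.
  have posK : pos (pos t) = pos t by exact: posE.
  have gG : `|g t z| <= G t.
    by rewrite ger0_norm ?expR_ge0//; have /andP[] := flow_g_bounds t z01.
  have EN : `|E1 t z| <= N t.
    by have := E1_le tt z01; rewrite /E1 posK.
  have EM := E2_le t z01.
  have M20 : 0 <= M2 t * pos t by exact: le_trans EM.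
  split.
  + by have /andP[] := flow_g_bounds t z01.
  + apply: (@le_trans _ _ (G t * N t)); first by rewrite normrM ler_pM.
    rewrite lerDl; apply: addr_ge0; last exact: mulr_ge0.
    by apply: mulr_ge0 => //; exact: mulr_ge0.
  + apply: (@le_trans _ _ (G t * N t * N t + G t * (M2 t * pos t))).
      rewrite (le_trans (ler_normD _ _))// !normrM lerD//.
        by apply: ler_pM => //; exact: ler_pM.
      exact: ler_pM.
    by rewrite lerDr; exact: mulr_ge0.
Qed.

Lemma flow_act_law t : f (pos t) = act_law (Phi t) (f 0).
Proof.
have [_ PE] := flow_tame t; have [d0 _ _ _] := Dplus_support D00.
apply/funext => x; rewrite /act_law.
have [fx|fx] := pselect (0 < f 0 x).
  rewrite PE ?cdf_of_itv// -{1}(quantile_cdf D00 fx) flow_at_quantile ?cdf_of_itv//.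
  by rewrite quantile_cdf// mulrC.
by rewrite flow_solution// (density_eq0 d0 fx) mul0r mulr0.
Qed.

Lemma weights_flow t : 0 <= t ->
  Dplus2 (f t) /\ forall c,
  (right_weight (hill_potential (f t)) c <->
   right_weight (hill_potential (f 0)) c) /\
  (left_weight (hill_potential (f t)) c <->
   left_weight (hill_potential (f 0)) c).
Proof.
move=> t0; rewrite -(posE t0) flow_act_law.
by have [tP _] := flow_tame t; exact: weights_act_law.
Qed.

End kernel_flows.

(** * Distortions smooth up to the boundary *)

Section boundary_regular_distortions.
Context {R : realType}.
Implicit Types (A B h k : R -> R) (t x y z w : R).

(** The lower bound of A' is the reciprocal of a Lipschitz constant of the
    inverse. *)
Lemma tame_of_C3 A B :
  {in `[0, 1], forall z, A z \in `[0, 1] /\ B z \in `[0, 1]} ->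
  {in `[0, 1], cancel A B} -> {in `[0, 1], cancel B A} ->
  {in `[0, 1] &, {homo A : y z / y < z}} ->
  Ck_closed 3 A -> Ck_closed 3 B -> tame A.
Proof.
move=> AB01 AK BK incrA [h [Ah Ch]] [k [Bk Ck]].
have [CA AE] := Ck_on_eq (@open01 R)
  (fun x x01 => esym (Ah x (subset_itv_oo_cc x01))) (Ck_on_sub (@subsetT _ _) Ch).
have ch n : (n <= 3)%N -> continuous h^`(n).
  by move=> n3 z; exact: (Ck_on_continuous Ch).
have [M2 hM2] := continuous_bounded01 (ch 2%N isT).
have [M3 hM3] := continuous_bounded01 (ch 3%N isT).
have ck1 : continuous k^`().
  by move=> z; exact: (Ck_on_continuous (k := 1) Ck).
have [K kK] := continuous_bounded01 ck1.
have K0 : 0 <= K by apply: le_trans (kK 0 _); rewrite ?normr_ge0 ?lexx ?ler01.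
have in01 x : 0 <= x <= 1 -> x \in `[0, 1] by rewrite in_itv.
have A01 z : 0 < z < 1 -> 0 < A z < 1.
  move=> /andP[z0 z1].
  have [A0 _] := AB01 0 (in01 0 ltac:(lra)).
  have [A1 _] := AB01 1 (in01 1 ltac:(lra)).
  have := incrA 0 z (in01 0 ltac:(lra)) (in01 z ltac:(lra)) z0.
  have := incrA z 1 (in01 z ltac:(lra)) (in01 1 ltac:(lra)) z1.
  by move: A0 A1; rewrite !in_itv/=; lra.
have lip x y : 0 < x -> x < y -> y < 1 -> y - x <= K * (A y - A x).
  move=> x0 xy y1.
  have Axy : A x < A y by apply: incrA => //; apply: in01; lra.
  have xin := in01 x ltac:(lra); have yin := in01 y ltac:(lra).
  have /andP[Ax0 Ax1] := A01 x ltac:(lra).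
  have /andP[Ay0 Ay1] := A01 y ltac:(lra).
  have dk t : A x <= t <= A y -> is_derive t 1 k (k^`() t).
    by move=> _; exact: (Ck_on_is_derive (k := 0) Ck).
  have [c cxy kE] := mean_value Axy dk.
  rewrite -{1}(AK y yin) -{1}(AK x xin) !Bk ?kE; [|apply: in01; lra..].
  rewrite ler_pM2r ?subr_gt0//; apply: le_trans (ler_norm _) _.
  by apply: kK; lra.
have dA z : 0 < z < 1 -> is_derive z 1 A (A^`() z).
  by move=> /in01E z01; exact: (Ck_on_is_derive (k := 0) CA).
split=> //.
- move=> w w01; have win := in01 w ltac:(lra).
  have [_ Bw] := AB01 w win; have ABw := BK w win.
  have [A0 _] := AB01 0 (in01 0 ltac:(lra)).
  have [A1 _] := AB01 1 (in01 1 ltac:(lra)).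
  exists (B w) => //; move: Bw A0 A1 ABw; rewrite !in_itv/=.
  move=> /andP[B0 B1] A0 A1 ABw; rewrite !lt_neqAle B0 B1 !andbT.
  have [_ BA0] := AB01 0 (in01 0 ltac:(lra)).
  have [_ BA1] := AB01 1 (in01 1 ltac:(lra)).
  apply/andP; split; apply/eqP => Bw.
  + (* A 0 = w > 0 would leave the point 0 = A (B 0) below A 0 *)
    have := BK 0 (in01 0 ltac:(lra)); move: BA0; rewrite in_itv/= => /andP[].
    rewrite le_eqVlt => /predU1P[<- _|B00 B01]; first by rewrite Bw ABw; lra.
    have := incrA 0 (B 0) (in01 0 ltac:(lra)) (in01 (B 0) ltac:(lra)) B00.
    by rewrite Bw ABw; lra.
  + have := BK 1 (in01 1 ltac:(lra)); move: BA1; rewrite in_itv/= => /andP[].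
    move=> + B11; move: B11.
    rewrite le_eqVlt => /predU1P[-> _|B11 B10]; first by rewrite -Bw ABw; lra.
    have := incrA (B 1) 1 (in01 (B 1) ltac:(lra)) (in01 1 ltac:(lra)) B11.
    by rewrite -Bw ABw; lra.
- exists (K + 1)^-1, (Num.max M2 M3); split; first by rewrite invr_gt0; lra.
  move=> z z01; have z01' := proj2 (in01E z) z01.
  have z01c : 0 <= z <= 1 by lra.
  split.
  + have dAK t : 0 < t < 1 ->
        is_derive t 1 (fun y => A y - (K + 1)^-1 * y) (A^`() t - (K + 1)^-1).
      move=> /dA; move: (A^`()) => A1 dAt.
      by derive_by ltac:(exact: dAt); ring.
    rewrite -subr_ge0 -(der1E (dAK z z01)).
    apply: (@incr_derive1_ge0_itv _ _ false true 0 1); last by rewrite in_itv.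
      by move=> t; rewrite inE => /in01E/dAK[].
    move=> x y; rewrite !in_itv/= => x01 y01 xy.
    have Axy : A x < A y by apply: incrA => //; apply: in01; lra.
    have l : y - x <= K * (A y - A x) by apply: lip; lra.
    have : (K + 1)^-1 * (y - x) < A y - A x; last by lra.
    rewrite ltr_pdivrMl; lra.
  + rewrite (AE 2%N)// le_max; apply/orP; left; exact: hM2.
  + rewrite (AE 3%N)// le_max; apply/orP; right; exact: hM3.
Qed.

Lemma boundary_regular_tame A B : distortion A B -> boundary_regular A B ->
  tame A /\ tame B.
Proof.
move=> [AB01 [AK BK] incrA _ _] [[h [Ah Ch _ _]] CB].
have CA : Ck_closed 3 A by exists h.
split; first exact: (tame_of_C3 AB01).
apply: (@tame_of_C3 B A) => //.
- by move=> z /AB01[].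
- move=> y z yin zin yz; rewrite ltNge; apply/negP => Bzy.
  have [_ By] := AB01 y yin; have [_ Bz] := AB01 z zin.
  have : A (B z) <= A (B y).
    by move: Bzy; rewrite le_eqVlt => /predU1P[->//|/incrA -/(_ Bz By)/ltW].
  by rewrite !BK// leNgt yz.
Qed.

End boundary_regular_distortions.

(** * The square distortion and the uniform law *)

Section square_distortion.
Context {R : realType}.
Implicit Types (t x y z w : R).
Local Notation mu := (@lebesgue_measure R).

(** Additivity of Lebesgue measure replaces sorting the intervals. *)
Lemma sum_disjoint_itv_le n (c d : 'I_n -> R) (l : R) : 0 <= l ->
  (forall i, 0 <= c i /\ c i <= d i /\ d i <= l) ->
  trivIset setT (fun i => `]c i, d i[%classic) ->
  \sum_(i < n) (d i - c i) <= l.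
Proof.
move=> l0 cd triv; rewrite -lee_fin -sumEFin.
have mu_itv i : mu `]c i, d i[%classic = (d i - c i)%:E.
  rewrite lebesgue_measure_itv/= lte_fin; case: ltP => // dc.
  have [_ [cdi _]] := cd i.
  have -> : d i = c i by apply/eqP; rewrite eq_le dc cdi.
  by rewrite subrr.
under eq_bigr do rewrite -mu_itv.
have mF i : measurable (`]c i, d i[%classic : set (measurableTypeR R)) by [].
rewrite -(@measure_semi_additive_ord _ _ _ mu n _ mF triv); last first.
  exact: bigsetU_measurable.
have -> : l%:E = mu `[0, l]%classic.
  rewrite lebesgue_measure_itv/= lte_fin.
  case: ltP => [_|l0']; first by rewrite sube0.
  by have -> : l = 0 by apply/eqP; rewrite eq_le l0 l0'.
apply: le_measure; rewrite ?inE//; first exact: bigsetU_measurable.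
elim/big_ind : _ => [//|A B Al Bl x [/Al|/Bl]//|i _ x /=].
rewrite !in_itv/= => /andP[cx xd]; have [c0 [_ dl]] := cd i.
by rewrite (ltW (le_lt_trans c0 cx)) (ltW (lt_le_trans xd dl)).
Qed.

(** Absolute continuity of the square root: the parts of the intervals whose
    image lies below a level l have total image length at most l, and above
    that level the square root is Lipschitz with constant 1 / l. *)
Lemma abs_continuous01_sqrt : abs_continuous01 (@Num.sqrt R).
Proof.
move=> e e0; pose l := e / 4; have l0 : 0 < l by rewrite divr_gt0.
exists (l * l); first by rewrite mulr_gt0.
move=> n a b ab triv sumd.
pose p i := Num.sqrt (a i); pose q i := Num.sqrt (b i).
have p0 i : 0 <= p i by exact: sqrtr_ge0.
have pq i : p i <= q i by have [_ [abi _]] := ab i; exact: ler_wsqrtr.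
have p2 i : p i ^+ 2 = a i by have [a0 _] := ab i; rewrite sqr_sqrtr.
have q2 i : q i ^+ 2 = b i.
  by have [a0 [abi _]] := ab i; rewrite sqr_sqrtr//; exact: le_trans abi.
have -> : \sum_(i < n) `|Num.sqrt (b i) - Num.sqrt (a i)| =
    \sum_(i < n) (Num.min (q i) l - Num.min (p i) l) +
    \sum_(i < n) (Num.max (q i) l - Num.max (p i) l).
  rewrite -big_split/=; apply: eq_bigr => i _.
  rewrite ger0_norm; last by rewrite subr_ge0; exact: pq.
  have := pq i; rewrite -/(p i) -/(q i).
  by rewrite /Num.min /Num.max; case: (ltP (q i) l); case: (ltP (p i) l); lra.
have low : \sum_(i < n) (Num.min (q i) l - Num.min (p i) l) <= l.
  apply: sum_disjoint_itv_le; first exact: ltW.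
    move=> i; have := pq i; have := p0 i.
    by rewrite /Num.min; case: (ltP (q i) l); case: (ltP (p i) l); lra.
  apply/trivIsetP => i j _ _ ij.
  move/trivIsetP : triv => /(_ i j I I ij); rewrite -!subset0 => tij x [].
  rewrite /= !in_itv/= => /andP[xi1 xi2] /andP[xj1 xj2].
  have sq k : Num.min (p k) l < x -> x < Num.min (q k) l -> a k < x ^+ 2 < b k.
    rewrite lt_min gt_min => /orP[px|lx] /andP[xq xl]; last by lra.
    have x0 : 0 < x by exact: le_lt_trans px.
    by rewrite -p2 -q2 !ltrXn2r ?nnegrE// ltW// (lt_trans x0).
  by apply: (tij (x ^+ 2)); rewrite /= !in_itv/= !sq.
have high : \sum_(i < n) (Num.max (q i) l - Num.max (p i) l) <= l.
  apply: (@le_trans _ _ (\sum_(i < n) (b i - a i) / l)); last first.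
    by rewrite -mulr_suml ler_pdivrMr// ltW.
  apply: ler_sum => i _; rewrite -p2 -q2 ler_pdivlMr//.
  have := pq i; have := p0 i.
  by rewrite /Num.max; case: (ltP (q i) l); case: (ltP (p i) l); nra.
apply: (le_lt_trans (lerD low high)); rewrite /l; lra.
Qed.

Lemma abs_continuous01_sqr : abs_continuous01 (fun z : R => z ^+ 2).
Proof.
move=> e e0; exists (e / 2); first by rewrite divr_gt0.
move=> n a b ab _ sumd.
apply: (@le_lt_trans _ _ (\sum_(i < n) 2 * (b i - a i))).
  apply: ler_sum => i _; have [a0 [abi b1]] := ab i.
  rewrite subr_sqr ger0_norm; first by rewrite mulrC ler_wpM2r; lra.
  by rewrite mulr_ge0; lra.
by rewrite -mulr_sumr; lra.
Qed.

Lemma sqrt_distortion : distortion (@Num.sqrt R) (fun z => z ^+ 2).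
Proof.
split.
- move=> z; rewrite !in_itv/= => /andP[z0 z1]; rewrite sqrtr_ge0 sqr_ge0/=.
  by rewrite -[X in _ <= X]sqrtr1 ler_wsqrtr// expr_le1.
- split=> z; rewrite in_itv/= => /andP[z0 z1]; first exact: sqr_sqrtr.
  by rewrite sqrtr_sqr ger0_norm.
- move=> y z; rewrite !in_itv/= => /andP[y0 y1] /andP[z0 z1] yz.
  by rewrite ltr_sqrt// (le_lt_trans y0).
- exact: abs_continuous01_sqrt.
- exact: abs_continuous01_sqr.
Qed.

Lemma sqrt_C3 : Ck_on 3 `]0, 1[ (@Num.sqrt R).
Proof.
have s0 z : 0 < z < 1 -> Num.sqrt z != 0.
  by move=> /andP[z0 _]; rewrite gt_eqF// sqrtr_gt0.
have ds z : 0 < z < 1 -> is_derive z 1 (@Num.sqrt R) (2 * Num.sqrt z)^-1.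
  by move=> /andP[z0 _]; exact: is_derive1_sqrt.
have sz z : 0 < z < 1 -> Num.sqrt z ^+ 2 = z.
  by move=> /andP[z0 _]; rewrite sqr_sqrtr ?ltW.
(* the derivatives are multiples of odd powers of 1 / s, where s = sqrt z has
   the derivative 1 / (2 s) *)
have dpow n z : 0 < z < 1 -> is_derive z 1 (fun z => (Num.sqrt z ^+ n)^-1)
    (- (n%:R / 2) * (Num.sqrt z ^+ n.+2)^-1).
  move=> z01; have dz := ds z z01; have sz0 := s0 z z01.
  have dX := @derX _ (@Num.sqrt R) n z _ dz.
  apply: is_derive_eq (@derV _ (fun z => Num.sqrt z ^+ n) z _ _ dX) _.
    exact: expf_neq0.
  case: n {dX} => [|n]; first by rewrite !mul0r !oppr0 !mul0r.
  by rewrite /= !exprS; field; rewrite expf_neq0 ?sz0.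
have [//|z /in01E z01|z /in01E z01|z /in01E z01|z /in01E z01|//] :=
  @Ck_on3 R `]0, 1[%classic (@Num.sqrt R) (@Num.sqrt R)
  (fun z => 1 / 2 * (Num.sqrt z ^+ 1)^-1)
  (fun z => - (1 / 4) * (Num.sqrt z ^+ 3)^-1)
  (fun z => 3 / 8 * (Num.sqrt z ^+ 5)^-1) (@open01 R).
- by apply: is_derive_eq (ds z z01) _; rewrite expr1; field; exact: s0.
- have d1 := dpow 1%N z z01.
  by apply: is_derive_eq (derM (derC z _) d1) _; field; exact: s0.
- have d3 := dpow 3%N z z01.
  by apply: is_derive_eq (derM (derC z _) d3) _; field; exact: s0.
- by apply: cvgM; [exact: cvg_cst | exact: der_cont (dpow 5%N z z01)].
Qed.

Lemma sqr_C3 : Ck_on 3 `]0, 1[ (fun z : R => z ^+ 2) /\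
  forall z, 0 < z < 1 ->
    (fun z : R => z ^+ 2)^`() z = 2 * z /\
    schwarzian (fun z : R => z ^+ 2) z = - (3 / 2) / z ^+ 2.
Proof.
have [|z _|z _|z _|C D] :=
  @Ck_on3 R `]0, 1[%classic (fun z : R => z ^+ 2) (fun z : R => z ^+ 2)
  (fun z => 2 * z) (fun=> 2) (fun=> 0) (@open01 R).
- by [].
- by derive_by ltac:(fail); rewrite /=; ring.
- by derive_by ltac:(fail); ring.
- exact: cvg_cst.
split=> // z z01; have z0 : z != 0 by lra.
have [D1 D2 D3] := D z (proj2 (in01E z) z01); split=> //.
by rewrite /schwarzian D1 D2 D3; field.
Qed.

Lemma uniform_law_Dplus2 : Dplus2 (uniform_law R) /\
  forall z, 0 < z < 1 -> hill_potential (uniform_law R) z = 0.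
Proof.
have u1 x : 0 < x < 1 -> uniform_law R x = 1.
  by move=> /in01E x01; rewrite /uniform_law indicE mem_set.
have u01 x : (0 < uniform_law R x) = (0 < x < 1).
  rewrite /uniform_law indicE; case: (boolP (0 < x < 1)) => x01.
    by rewrite mem_set ?ltr01//; exact/in01E.
  by rewrite memNset ?ltxx// => /in01E; apply/negP.
have setE : [set x | 0 < uniform_law R x] = `]0, 1[%classic.
  by apply/seteqP; split=> x /=; rewrite u01 in_itv.
have [|x _|C D] := @Ck_on2 R `]0, 1[%classic (uniform_law R)
  (fun=> 1) (fun=> 0) (fun=> 0) (@open01 R).
- by move=> x /in01E/u1.
- exact: cvg_cst.
have [||||||| Du _] := @density_of_antiderivative R (uniform_law R) id.
- by move=> x; rewrite /uniform_law indicE.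
- by rewrite setE; exact: open01.
- by rewrite setE; exact: interval_is_interval.
- move=> x; rewrite u01 => /in01E x01.
  exact: (Ck_on_continuous (k := 0) C).
- by move=> x; rewrite u01 => /u1 ->; exact: derI.
- by move=> x; rewrite u01.
- by move=> z z01; exists z; rewrite ?u01.
have Du2 : Dplus2 (uniform_law R) by split=> //; rewrite setE.
split=> // z z01; rewrite hill_potentialE//.
have [_ /(_ z z01)[-> ->]] := rank_profile_Ck Du2.
have : `]0, 1[%classic (quantile (uniform_law R) z).
  by apply/in01E; rewrite -u01; exact: quantile_supp.
by move=> /D[-> ->]; rewrite expr0n/= mulr0 subr0 !mul0r oppr0 expr0n/= mul0r addr0.
Qed.

Lemma left_weight_cst U c : (forall z, 0 < z < 1 -> z ^+ 2 * U z = c) ->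
  left_weight U c.
Proof.
move=> Uc; have : c @[z --> (0 : R)^'+] --> c by exact: cvg_cst.
apply: cvg_trans; apply: near_eq_cvg; apply/near_right0P.
by exists 1; [rewrite ltr01 lexx | move=> z /Uc].
Qed.

End square_distortion.

(** * Tails, flows and the weights *)

Section weights_of_laws.
Context {R : realType}.
Implicit Types (f v : R -> R) (c p beta s x z : R).

Lemma right_weight_power_tail f p c0 : Dplus2 f -> 1 < p -> 0 < c0 ->
  power_tail f p c0 ->
  right_weight (hill_potential f) (p * (p - 2) / (2 * (p - 1) ^+ 2)).
Proof.
move=> Df2 p1 c00 pt; have [L rL] := right_profile_power_tail Df2 p1 c00 pt.
have := right_weight_of_profile Df2 rL; congr right_weight.
by field; lra.
Qed.

Lemma right_weight_exponential_tail f : Dplus2 f -> exponential_tail f ->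
  right_weight (hill_potential f) (1 / 2).
Proof.
move=> Df2 et; have [L rL] := right_profile_exponential_tail Df2 et.
have := right_weight_of_profile Df2 rL; congr right_weight.
by field.
Qed.

Lemma left_weight_of_profile f beta L : Dplus2 f -> left_profile f beta L ->
  left_weight (hill_potential f) (2 * beta * (1 - beta)).
Proof.
move=> Df2 /(left_profile_reflect _ _ Df2) rL; apply/left_weight_reflect => //.
by apply: right_weight_of_profile rL; have [] := reflect_law_Dplus2 Df2.
Qed.

Lemma power_weight_sign p : 1 < p -> let c := p * (p - 2) / (2 * (p - 1) ^+ 2) in
  (c = 0 <-> p = 2) /\ (2 < p -> 0 < c /\ c < 1 / 2) /\ (p < 2 -> c < 0).
Proof.
move=> p1 c; have d0 : 0 < 2 * (p - 1) ^+ 2.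
  by rewrite mulr_gt0// exprn_gt0// subr_gt0.
have cE : c * (2 * (p - 1) ^+ 2) = p * (p - 2) by rewrite divfK// gt_eqF.
split; [split|split].
- move=> c0; move: cE; rewrite c0 mul0r => /esym/eqP.
  by rewrite mulf_eq0 subr_eq0 => /orP[/eqP|/eqP]//; lra.
- by move=> p2; rewrite /c p2 subrr mulr0 mul0r.
- move=> p2; split; first by rewrite divr_gt0// mulr_gt0; lra.
  by rewrite ltr_pdivrMr//; nra.
- by move=> p2; rewrite /c pmulr_llt0 ?invr_gt0// pmulr_rlt0; lra.
Qed.

(** The distribution functions take their values in [0, 1], so v can be replaced
    by a C^2 extension h to the line. *)
Lemma weights_kernel_flow v (ft : R -> R -> R) t : Ck_closed 2 v ->
  kernel_flow v ft -> Dplus2 (ft 0) -> 0 <= t ->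
  Dplus2 (ft t) /\ forall c,
  (right_weight (hill_potential (ft t)) c <->
   right_weight (hill_potential (ft 0)) c) /\
  (left_weight (hill_potential (ft t)) c <->
   left_weight (hill_potential (ft 0)) c).
Proof.
move=> [h [vh Ch]] [fd flow] D0 t0.
have hc n : (n <= 2)%N -> continuous h^`(n).
  by move=> n2 z; exact: (Ck_on_continuous Ch).
have [K0 hK0] := continuous_bounded01 (hc 0%N isT).
have [K1 hK1] := continuous_bounded01 (hc 1%N isT).
have [K2 hK2] := continuous_bounded01 (hc 2%N isT).
have h_der z : is_derive z 1 h (h^`() z).
  exact: (Ck_on_is_derive (k := 0) Ch).
have h1_der z : is_derive z 1 h^`() (h^`(2) z).
  exact: (Ck_on_is_derive (k := 1) Ch).
apply: (@weights_flow R h h^`() h^`(2) ft (Num.max K0 (Num.max K1 K2))) => //.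
- exact: hc.
- move=> z z01; split; rewrite !le_max.
  + by rewrite (hK0 z z01).
  + by rewrite (hK1 z z01) orbT.
  + by rewrite (hK2 z z01) !orbT.
- by move=> x; have [] := flow x.
- move=> x s s0; have [_ /(_ s s0)] := flow x.
  rewrite vh// in_itv/= cdf_of_ge0 ?cdf_of_le1//; exact/fd/ltW.
Qed.

End weights_of_laws.

Theorem theorem19 (R : realType) :
  (* the boundary weights, and the tails covered by the hypothesis *)
  (forall f : R -> R, Dplus2 f ->
     (forall (beta : R) (L : R -> R), right_profile f beta L ->
        right_weight (hill_potential f) (2 * beta * (1 - beta))) /\
     (forall (beta : R) (L : R -> R), left_profile f beta L ->
        left_weight (hill_potential f) (2 * beta * (1 - beta))) /\
     (forall p c0 : R, 1 < p -> 0 < c0 -> power_tail f p c0 ->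
        (exists L : R -> R, right_profile f (p / (2 * (p - 1))) L) /\
        right_weight (hill_potential f)
          (p * (p - 2) / (2 * (p - 1) ^+ 2))) /\
     (forall p c0 : R, 1 < p -> 0 < c0 -> power_tail (reflect_law f) p c0 ->
        (exists L : R -> R, left_profile f (p / (2 * (p - 1))) L) /\
        left_weight (hill_potential f)
          (p * (p - 2) / (2 * (p - 1) ^+ 2))) /\
     (exponential_tail f ->
        exists L : R -> R, right_profile f (1 / 2) L) /\
     (exponential_tail (reflect_law f) ->
        exists L : R -> R, left_profile f (1 / 2) L)) /\
  (* (i) *)
  (forall f : R -> R, Dplus2 f -> forall c : R,
     (right_weight (hill_potential f) c -> c <= 1 / 2) /\
     (left_weight (hill_potential f) c -> c <= 1 / 2) /\
     (1 / 2 < c ->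
        ~ (\forall z \near (1 : R)^'-,
             c / (1 - z) ^+ 2 <= hill_potential f z) /\
        ~ (\forall z \near (0 : R)^'+,
             c / z ^+ 2 <= hill_potential f z))) /\
  (* (ii) *)
  (forall f : R -> R, Dplus2 f ->
     (exponential_tail f \/
        (exists p c0 : R, 1 < p /\ 0 < c0 /\ power_tail f p c0) ->
        (right_weight (hill_potential f) 0 <->
           exists c0 : R, 0 < c0 /\ power_tail f 2 c0)) /\
     (exponential_tail f -> right_weight (hill_potential f) (1 / 2)) /\
     (forall p c0 c : R, 1 < p -> 0 < c0 -> power_tail f p c0 ->
        right_weight (hill_potential f) c ->
        (c = 0 <-> p = 2) /\
        (2 < p -> 0 < c /\ c < 1 / 2) /\
        (p < 2 -> c < 0))) /\
  (* (iii), distortions, on potentials and on laws *)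
  (forall A B : R -> R, distortion A B -> boundary_regular A B ->
     (forall (U : R -> R) (c : R),
        (right_weight (coadjoint B U) c <-> right_weight U c) /\
        (left_weight (coadjoint B U) c <-> left_weight U c)) /\
     (forall f : R -> R, Dplus2 f ->
        Dplus2 (act_law A f) /\
        forall c : R,
          (right_weight (hill_potential (act_law A f)) c <->
             right_weight (hill_potential f) c) /\
          (left_weight (hill_potential (act_law A f)) c <->
             left_weight (hill_potential f) c))) /\
  (* (iii), flows *)
  (forall (v : R -> R) (ft : R -> R -> R),
     kernel_density v -> Ck_closed 2 v -> kernel_flow v ft -> Dplus2 (ft 0) ->
     forall t : R, 0 <= t ->
       Dplus2 (ft t) /\
       forall c : R,
         (right_weight (hill_potential (ft t)) c <->
            right_weight (hill_potential (ft 0)) c) /\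
         (left_weight (hill_potential (ft t)) c <->
            left_weight (hill_potential (ft 0)) c)) /\
  (* (iii), boundary regularity is essential *)
  (exists A : R -> R, let B := fun z : R => z ^+ 2 in
     [/\ distortion A B,
         Ck_on 3 `]0, 1[ A /\ Ck_on 3 `]0, 1[ B,
         Dplus2 (uniform_law R),
         left_weight (hill_potential (uniform_law R)) 0 &
         left_weight (coadjoint B (hill_potential (uniform_law R))) (- (3 / 2))]).
Proof.
split; [|split; [|split; [|split; [|split]]]].
- move=> f Df2; have [DN _ _] := reflect_law_Dplus2 Df2.
  split; [|split; [|split; [|split; [|split]]]].
  + by move=> beta L; exact: right_weight_of_profile.
  + by move=> beta L; exact: left_weight_of_profile.
  + move=> p c0 p1 c00 pt; split; first exact: right_profile_power_tail pt.
    exact: right_weight_power_tail pt.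
  + move=> p c0 p1 c00 pt; split.
      have [L rL] := right_profile_power_tail DN p1 c00 pt.
      by exists L; apply/left_profile_reflect.
    by apply/left_weight_reflect => //; exact: right_weight_power_tail pt.
  + exact: right_profile_exponential_tail.
  + move=> et; have [L rL] := right_profile_exponential_tail DN et.
    by exists L; apply/left_profile_reflect.
- move=> f Df2 c; have [DN _ _] := reflect_law_Dplus2 Df2.
  split; [|split].
  + exact: right_weight_le.
  + by move=> /(left_weight_reflect _ Df2); exact: right_weight_le.
  + move=> c12; split; first exact: hill_potential_bound.
    move=> /near_left_right Uc; apply: (hill_potential_bound DN c12).
    near=> z; have z01 : 0 < z < 1 by near: z; exact: near_left1_in01.
    by rewrite hill_potential_reflect//; near: z.
- move=> f Df2; split; [|split].
  + move=> tail; split; last first.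
      move=> [c0 [c00 pt]].
      have := right_weight_power_tail Df2 _ c00 pt.
      by rewrite subrr mulr0 mul0r; apply; lra.
    move=> w0; case: tail => [et|[p [c0 [p1 [c00 pt]]]]].
      by have := right_weight_unique w0 (right_weight_exponential_tail Df2 et); lra.
    have [p2 _] := power_weight_sign p1.
    have := right_weight_unique (right_weight_power_tail Df2 p1 c00 pt) w0.
    by move=> /p2 pE; exists c0; split=> //; rewrite -pE.
  + exact: right_weight_exponential_tail.
  + move=> p c0 c p1 c00 pt wc.
    rewrite (right_weight_unique wc (right_weight_power_tail Df2 p1 c00 pt)).
    exact: power_weight_sign.
- move=> A B dAB rAB; have [tA tB] := boundary_regular_tame dAB rAB.
  split; first by move=> U c; exact: weights_coadjoint.
  by move=> f Df2; exact: weights_act_law.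
- by move=> v ft _ Cv flow D0 t t0; exact: weights_kernel_flow flow D0 t0.
- have [Du u0] := uniform_law_Dplus2 (R := R).
  have [C2 S2] := sqr_C3 (R := R).
  exists (@Num.sqrt R); split.
  + exact: sqrt_distortion.
  + by split; [exact: sqrt_C3 | exact: C2].
  + exact: Du.
  + by apply: left_weight_cst => z z01; rewrite u0// mulr0.
  + apply: left_weight_cst => z z01; have [_ S] := S2 z z01.
    rewrite /coadjoint S u0; last by nra.
    by rewrite mul0r add0r mulrC divfK//; rewrite expf_neq0//; lra.
Unshelve. all: end_near. Qed.
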